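(* Let $\Gamma$ be a countable residually finite amenable group and let $(\Gamma_n)_{n\ge1}$ be a sequence of finite index normal subgroups of $\Gamma$ with $\lim_{n\to\infty}\Gamma_n=\{1\}$. If $f\in\mathbb{Z}\Gamma$ and the algebraic $\Gamma$-action $\alpha_f$ on $X_f$ is expansive, then $$h(\alpha_f)=\lim_{n\to\infty}\frac{1}{|\Gamma/\Gamma_n|}\log|\mathrm{Fix}_{\Gamma_n}(X_f)|=\lim_{n\to\infty}\frac{1}{|\Gamma/\Gamma_n|}\log\bigl|L^\infty(\Gamma,\mathbb{Z})^{\Gamma_n}/\rho_f(L^\infty(\Gamma,\mathbb{Z})^{\Gamma_n})\bigr|=\lim_{n\to\infty}\frac{1}{|\Gamma/\Gamma_n|}\log\bigl|\det(\rho_f|_{L^\infty(\Gamma)^{\Gamma_n}})\bigr| .$$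
   Context: $\lim_{n\to\infty}\Gamma_n=\{1\}$ means: for every finite $K\subset\Gamma$ there is $N\ge1$ with $\Gamma_n\cap(K^{-1}K)=\{1\}$ for all $n\ge N$ (where for $K=\varnothing$ nothing is required). $L^\infty(\Gamma)$ is the space of bounded functions $w=(w_\gamma):\Gamma\to\mathbb{R}$, and $L^\infty(\Gamma,\mathbb{Z})$ the subgroup of integer-valued ones. For $f=\sum f_\gamma\gamma\in\mathbb{Z}\Gamma$ and $w\in L^\infty(\Gamma)$, $(\rho_fw)_\gamma=\sum_{\gamma'}w_{\gamma\gamma'}f_{\gamma'}$; and $(\lambda^\gamma w)_{\gamma'}=w_{\gamma^{-1}\gamma'}$. For a subgroup $\Gamma'\subset\Gamma$, $L^\infty(\Gamma)^{\Gamma'}=\{w:\lambda^\gamma w=w\ \forall\gamma\in\Gamma'\}$ and $L^\infty(\Gamma,\mathbb{Z})^{\Gamma'}=L^\infty(\Gamma,\mathbb{Z})\cap L^\infty(\Gamma)^{\Gamma'}$. If $\Gamma'$ has finite index, $L^\infty(\Gamma)^{\Gamma'}\cong\mathbb{R}^{\Gamma'\backslash\Gamma}$ is finite dimensional and $\rho_f$ maps it to itself. With $\mathbb{T}=\mathbb{R}/\mathbb{Z}$, $X_f=\{x\in\mathbb{T}^\Gamma:\sum_{\gamma'}f_{\gamma'}x_{\gamma\gamma'}=0\ \forall\gamma\in\Gamma\}$ is a compact abelian group with the $\Gamma$-action $(\alpha_f^\gamma x)_{\gamma'}=x_{\gamma^{-1}\gamma'}$. $\alpha_f$ is expansive if there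 is an open neighbourhood $\mathcal{U}$ of $0$ in $X_f$ with $\bigcap_{\gamma}\alpha_f^\gamma(\mathcal{U})=\{0\}$. $\mathrm{Fix}_{\Gamma'}(X_f)=\{x\in X_f:\alpha_f^\gamma x=x\ \forall\gamma\in\Gamma'\}$. $h(\alpha_f)$ is the topological entropy: for a Følner sequence $(F_n)$ of nonempty finite subsets of $\Gamma$ ($|\gamma F_n\triangle F_n|/|F_n|\to0$ for all $\gamma$), $h(\alpha_f)=\sup_{\mathcal V}\lim_n\frac1{|F_n|}\log N(\bigvee_{\gamma\in F_n}(\alpha_f^{\gamma})^{-1}\mathcal V)$, the supremum over open covers $\mathcal V$ of $X_f$, $N$ denoting minimal cardinality of a subcover; this does not depend on $(F_n)$. *)

(* Defs.v *)
From HB Require Import structures.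
From mathcomp Require Import all_boot all_order all_algebra finmap.
From mathcomp Require Import generic_quotient ring_quotient.
From mathcomp Require Import all_classical all_reals all_analysis.

Set Implicit Arguments.
Unset Strict Implicit.
Unset Printing Implicit Defensive.

Import Order.TTheory GRing.Theory Num.Theory.
Import numFieldNormedType.Exports.

Local Open Scope classical_set_scope.
Local Open Scope ring_scope.

Section groups.
Variable G : groupType.
Implicit Types (N K : set G).

Definition normal_subgroup N : Prop :=
  group_closed [in N] /\ forall g h, N h -> N (h ^ g)%g.

Definition cosets N : set (set G) :=
  [set [set (g * h)%g | h in N] | g in [set: G]].

Definition finite_index N : Prop := finite_set (cosets N).

Definition subgroup_index N : nat := #|` fset_set (cosets N)|%fset.

Definition residually_finite : Prop :=
  forall g : G, g <> 1%g ->
    exists N, [/\ normal_subgroup N, finite_index N & ~ N g].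

Definition tends_to_trivial (Gamma : nat -> set G) : Prop :=
  forall K, finite_set K -> K !=set0 ->
    exists n0 : nat, forall n, (n0 <= n)%N ->
      Gamma n `&` [set (g^-1 * h)%g | g in K & h in K] = [set 1%g].

Definition folner (R : realType) (F : nat -> {fset G}) : Prop :=
  (forall n, F n != fset0) /\
  forall g : G,
    (fun n => (#|` fset_set ([set (g * h)%g | h in [set` F n]] `+` [set` F n])|)%fset%:R
              / (#|` F n|)%fset%:R : R) @ \oo --> (0 : R).

Definition amenable (R : realType) : Prop :=
  exists F : nat -> {fset G}, folner R F.

End groups.

Section entropy.
Variables (R : realType) (G : groupType) (X : topologicalType).
Implicit Types (V W : set (set X)) (a : G -> X -> X) (A : {fset G}).

Definition expansive a (x0 : X) : Prop :=
  exists U : set X, [/\ open U, U x0 & \bigcap_(g in [set: G]) (a g @` U) = [set x0]].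

Definition open_cover V : Prop :=
  (forall U, V U -> open U) /\ cover V id = [set: X].

(* The common refinement of the covers (a g)^-1 V, for g in A. *)
Definition pulled_join a A V : set (set X) :=
  [set \bigcap_(g in [set` A]) (a g @^-1` c g) |
    c in [set c : G -> set X | forall g, g \in A -> V (c g)]].

(* Cardinality is measured by counting, which is +oo on infinite families, so
   this is the minimal cardinality of a finite subcover, if there is one. *)
Definition min_subcover W : \bar R :=
  ereal_inf [set counting D |
    D in [set D : set (set X) | D `<=` W /\ cover D id = [set: X]]].

(* For a Folner sequence F and an action of G on a compact space, each of the
   limits exists (Ornstein-Weiss) and the supremum does not depend on F. *)
Definition top_entropy a (F : nat -> {fset G}) : \bar R :=
  ereal_sup
    [set limn (fun n => ((#|` F n|)%fset%:R^-1)%:E *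
                        lne (min_subcover (pulled_join a (F n) V)))%E
      | V in open_cover].

End entropy.
Arguments top_entropy R {G X} a F.

Definition integers (R : realType) : zmodClosed R :=
  (@Num.int_num_subdef R : {pred R}).

Section circle.
Variable R : realType.

(* The group R/Z. It is given the quotient topology below, by hand:
   quotient_topology carries another choice structure than Quotient.quot. *)
Definition circle : Type := Quotient.quot (integers R).
HB.instance Definition _ := GRing.Zmodule.on circle.

Definition to_circle (r : R) : circle := \pi_(Quotient.quot (integers R))%qT r.

Definition circle_open (U : set circle) : Prop := open (to_circle @^-1` U).

Lemma circle_openT : circle_open setT.
Proof. by rewrite /circle_open preimage_setT; exact: openT. Qed.

Lemma circle_openI : setI_closed circle_open.
Proof. by move=> U V; exact: openI. Qed.

Lemma circle_open_bigU (I : Type) (U : I -> set circle) :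
  (forall i, circle_open (U i)) -> circle_open (\bigcup_i U i).
Proof. by move=> oU; apply: bigcup_open => i _; exact: oU. Qed.

HB.instance Definition _ :=
  isOpenTopological.Build circle circle_openT circle_openI circle_open_bigU.

End circle.

(* Only the additive group underlying the integral group ring is needed. *)
Notation group_ring G := {fsfun G -> int with 0}.

Section algebraic_action.
Variables (R : realType) (G : groupType) (f : group_ring G).

Definition Xf_set : set {ptws G -> circle R} :=
  [set x | forall g, \sum_(h <- finsupp f) x (g * h)%g *~ f h = 0].

Definition Xf : topologicalType := set_type Xf_set.

Lemma Xf_set0 : Xf_set (fun=> 0).
Proof. by move=> g; rewrite big1 // => h _; rewrite mul0rz. Qed.

Definition Xf0 : Xf := SigSub (mem_set Xf_set0).

Lemma Xf_shift (g : G) (x : Xf) : Xf_set (fun h => \val x (g^-1 * h)%g).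
Proof.
move=> k; have /set_mem /(_ (g^-1 * k)%g) := valP x.
by under eq_bigr do rewrite -mulgA.
Qed.

Definition alphaf (g : G) (x : Xf) : Xf := SigSub (mem_set (Xf_shift g x)).

(* The points of Xf fixed by the subgroup N. *)
Definition Fix (N : set G) : set Xf := [set x | forall g, N g -> alphaf g x = x].

End algebraic_action.
Arguments alphaf R {G} f g x.
Arguments Fix R {G} f N.

Section bounded_functions.
Variables (R : realType) (G : groupType).
Implicit Types (N : set G) (w : G -> R^o).

Definition rho (f : group_ring G) w : G -> R^o :=
  fun g => \sum_(h <- finsupp f) w (g * h)%g * (f h)%:~R.

Definition lambda (g : G) w : G -> R^o := fun h => w (g^-1 * h)%g.

(* The N-invariant bounded functions. *)
Definition Linf N : set (G -> R^o) :=
  [set w | bounded_fun w /\ forall g, N g -> lambda g w = w].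

Definition LinfZ N : set (G -> R^o) :=
  Linf N `&` [set w | forall g, w g \is a Num.int].

End bounded_functions.
Arguments rho R {G} f w.
Arguments Linf R {G} N.
Arguments LinfZ R {G} N.

(* The quotient of an additive group A by a subgroup B, as the set of cosets. *)
Definition quotient_set (V : zmodType) (A B : set V) : set (set V) :=
  [set [set a + b | b in B] | a in A].

Section determinant.
Variables (R : realType) (V : lmodType R).

Definition is_basis (W : set V) n (e : 'I_n -> V) : Prop :=
  (forall c : 'I_n -> R, \sum_i c i *: e i = 0 -> forall i, c i = 0) /\
  W = [set \sum_i c i *: e i | c in [set: 'I_n -> R]].

(* The determinant of phi restricted to a finite dimensional phi-stable
   subspace W, computed in any basis of W; it does not depend on the basis.
   The value is the default 0 if W is not of this kind. *)
Definition det_on (W : set V) (phi : V -> V) : R :=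
  xget 0 [set d | exists n (e : 'I_n -> V) (M : 'M[R]_n),
    [/\ is_basis W e, forall j, phi (e j) = \sum_i M i j *: e i & d = \det M]].

End determinant.

(* Main.v *)
(*
Write M_W for the integer matrix of rho_f from a neighbourhood W f of a window W
to W, where W = F^-1 for a member F of the Folner sequence.

Expansiveness forces rho_f to be injective on bounded functions. By compactness
it is then bounded below, uniformly on periodic functions, and an ultralimit of
periodic solutions gives u in l^1(G) with rho_f u = delta_1. Hence the matrices
B_n of rho_f on the Gamma_n-periodic functions satisfy B_n B_n^T >= c, and
likewise M_W M_W^T >= c, with the same c > 0. On a fixed interval [c, C] the
logarithm is approximated by polynomials, so that ln det per dimension is governed
by the normalized traces of powers. These have the same limits for B_n B_n^T and
for M_W M_W^T. Therefore ln |det B_n| / [G : Gamma_n] converges to some L and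
ln det (M_W M_W^T) / |W| converges to 2 L. The numbers of periodic points and of
cosets are |det B_n| by the Smith normal form.

It remains to compare the covering numbers on W with sqrt (det (M_W M_W^T)), up to
factors exp (o(|W|)). By the Cauchy-Binet formula this is the size of the largest
maximal minor of M_W, as M_W has only o(|W|) more columns than rows.
Lower bound: the representatives of Z^W modulo the lattice spanned by the columns
of a maximal minor yield separated points of X_f.
Upper bound: a point x with lift w is determined up to a small error by the integer
vector rho_f w, and the integer points of the zonotope M_W [0,1]^(W f) are counted by
its decomposition into parallelepipeds. The limit defining the entropy is only
needed for one fine cover, where these estimates yield its existence.
*)
Require Import Defs.
From HB Require Import structures.
From mathcomp Require Import all_boot all_order all_algebra finmap.
From mathcomp Require Import all_classical all_reals all_analysis.
From mathcomp Require Import perm zify ring lra.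
From mathcomp Require spectral complex generic_quotient ring_quotient.

Import Order.TTheory GRing.Theory Num.Theory.
Import numFieldNormedType.Exports.

Set Implicit Arguments.
Unset Strict Implicit.
Unset Printing Implicit Defensive.

Local Open Scope classical_set_scope.
Local Open Scope ring_scope.

(** * Linear algebra *)

(** Since ln is unbounded near 0, traces alone do not control determinants. Everything rests on the
    one constant [dl] of [rho_locality]: it bounds the inverses of rho_f on periodic functions in
    sup norm, hence their kernels in l^1, for all [Gamma n] at once. The equation rho_f u = delta_1
    is solved through the periodic levels because rho_f is a square matrix there, for which
    injectivity already gives invertibility. On a window, the square compression of rho_f may be
    singular. The rectangular matrix, with every column that its rows meet, has a right inverse cut
    out of u without any error at the boundary; this yields the lower bound of its Gram matrix. The
    price is a choice of maximal minors, which costs a binomial coefficient. Windows are inverses of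
    Folner sets because these are almost invariant on the left, whereas rho_f moves points by right
    multiplication. In both counts, the integers attached to boundary points or to excess columns
    are bounded independently of W, so that each of them costs a constant factor q. *)

Section cauchy_binet.
Variable (R : comNzRingType).

Lemma det_mulmx_sum d m (A : 'M[R]_(d, m)) (B : 'M[R]_(m, d)) :
  \det (A *m B) =
  \sum_(phi : {ffun 'I_d -> 'I_m}) (\prod_i A i (phi i)) * \det (rowsub phi B).
Proof.
rewrite /determinant.
under eq_bigr => s _.
  under eq_bigr do rewrite mxE.
  rewrite (bigA_distr_bigA (fun i k => A i k * B k (s i))) big_distrr /=.
  over.
rewrite exchange_big /=; apply: eq_bigr => phi _.
rewrite big_distrr /=; apply: eq_bigr => s _.
rewrite big_split /= mulrCA; congr (_ * (_ * _)).
by apply: eq_bigr => i _; rewrite !mxE.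
Qed.

(* Summing over all maps [phi] rather than over subsets of size [d] counts every
   minor [d`!] times, and vanishing minors for the non-injective ones. *)
Lemma cauchy_binet d m (A : 'M[R]_(d, m)) (B : 'M[R]_(m, d)) :
  \sum_(phi : {ffun 'I_d -> 'I_m}) \det (colsub phi A) * \det (rowsub phi B) =
  d`!%:R * \det (A *m B).
Proof.
under eq_bigr => phi _ do rewrite /(\det (colsub _ _)) big_distrl /=.
rewrite exchange_big /=.
rewrite (eq_bigr (fun=> \det (A *m B))); last first.
  move=> s _; rewrite det_mulmx_sum.
  pose h (p : {ffun 'I_d -> 'I_m}) : {ffun 'I_d -> 'I_m} := [ffun i => p ((s^-1)%g i)].
  rewrite (reindex h) /=; last first.
    exists (fun p : {ffun 'I_d -> 'I_m} => [ffun i => p (s i)]) => p _;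
      by apply/ffunP => i; rewrite !ffunE ?permK ?permKV.
  apply: eq_bigr => p _.
  have -> : rowsub (h p) B = row_perm (s^-1)%g (rowsub p B).
    by apply/matrixP => i j; rewrite !mxE ffunE.
  rewrite row_permE det_mulmx det_perm odd_permV mulrACA.
  under [\prod_i colsub _ _ _ _]eq_bigr => i _ do rewrite mxE ffunE permK.
  by rewrite -signr_addb addbb expr0 mul1r.
by rewrite sumr_const card_Sn mulr_natl.
Qed.

End cauchy_binet.

Section gram.
Variable (R : realFieldType).

(** In the Cauchy-Binet sum of squares, the d! reorderings of [phi] contribute the same square each,
    which cancels the factor d! of the other side. *)
Lemma det_colsub_sqr_le d m (M : 'M[R]_(d, m)) (phi : 'I_d -> 'I_m) :
  injective phi -> \det (colsub phi M) ^+ 2 <= \det (M *m M^T).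
Proof.
move=> phi_inj.
have trE (p : 'I_d -> 'I_m) : \det (rowsub p M^T) = \det (colsub p M).
  by rewrite -det_tr; congr (\det _); apply/matrixP => i j; rewrite !mxE.
have := cauchy_binet M M^T; under eq_bigr do rewrite trE -expr2.
move=> CB.
have dgt0 : 0 < (d`!%:R : R) by rewrite ltr0n fact_gt0.
rewrite -(ler_pM2l dgt0) -CB.
pose h (s : 'S_d) : {ffun 'I_d -> 'I_m} := [ffun i => phi (s i)].
have h_inj : injective h.
  by move=> s t /ffunP st; apply/permP => i; apply: phi_inj; have := st i; rewrite !ffunE.
rewrite (bigID (fun p => p \in h @: [set: 'S_d]))%SET /= -[leLHS]addr0 lerD ?sumr_ge0//;
  last first.
  by move=> ? _; rewrite sqr_ge0.
rewrite big_imset /=; last by move=> ? ? _ _; exact: h_inj.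
rewrite (eq_bigr (fun=> \det (colsub phi M) ^+ 2)); last first.
  move=> s _; have -> : colsub (h s) M = col_perm s (colsub phi M).
    by apply/matrixP => i j; rewrite !mxE ffunE.
  by rewrite col_permE det_mulmx det_perm exprMn sqrr_sign mulr1.
by rewrite sumr_const cardsT card_Sn mulr_natl.
Qed.

(** Averaging: minors with a repeated column vanish and there are C(m, d) d! injective maps, so if
    all squares were too small, their sum could not reach d! times the determinant. *)
Lemma exists_det_colsub d m (M : 'M[R]_(d, m)) :
  0 < \det (M *m M^T) ->
  exists phi : 'I_d -> 'I_m, injective phi /\
    \det (M *m M^T) <= ('C(m, d))%:R * \det (colsub phi M) ^+ 2.
Proof.
move=> det_gt0; apply: contrapT => nophi.
have trE (p : 'I_d -> 'I_m) : \det (rowsub p M^T) = \det (colsub p M).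
  by rewrite -det_tr; congr (\det _); apply/matrixP => i j; rewrite !mxE.
have := cauchy_binet M M^T; under eq_bigr do rewrite trE -expr2.
rewrite (bigID (fun p : {ffun 'I_d -> 'I_m} => injectiveb p)) /= addrC big1 => [|p]; last first.
  move=> /injectivePn[i [j ij pij]]; rewrite -det_tr.
  rewrite (@determinant_alternate _ _ _ i j) ?expr0n// => k.
  by rewrite !mxE pij.
rewrite add0r => CB.
have CB' : 'C(m, d)%:R * (d`!%:R * \det (M *m M^T)) = (m ^_ d)%:R * \det (M *m M^T) :> R.
  by rewrite mulrA -natrM bin_ffact.
have injP (p : {ffun 'I_d -> 'I_m}) : injectiveb p ->
    'C(m, d)%:R * \det (colsub p M) ^+ 2 < \det (M *m M^T).
  move=> /injectiveP p_inj; rewrite ltNge; apply/negP => le.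
  by apply: nophi; exists p.
have card_inj : #|[set p : {ffun 'I_d -> 'I_m} | injectiveb p]%SET| = (m ^_ d)%N.
  by rewrite card_inj_ffuns !card_ord.
have [p0 p0_inj|none] := pickP (fun p : {ffun 'I_d -> 'I_m} => injectiveb p); last first.
  move: CB; rewrite big_pred0// => /esym/eqP; rewrite mulf_eq0 (gt_eqF det_gt0) orbF.
  by rewrite pnatr_eq0 -leqn0 leqNgt fact_gt0.
have : \sum_(p : {ffun 'I_d -> 'I_m} | injectiveb p) ('C(m, d)%:R * \det (colsub p M) ^+ 2)
   < \sum_(p : {ffun 'I_d -> 'I_m} | injectiveb p) \det (M *m M^T).
  rewrite (bigD1 p0)//= [ltRHS](bigD1 p0)//= ltr_leD ?injP// ler_sum// => p /andP[pi _].
  exact/ltW/injP.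
rewrite -big_distrr /= CB CB' sumr_const -cardsE.
by rewrite card_inj mulr_natl ltxx.
Qed.

End gram.

Lemma card_ord_lt N n : (n <= N)%N -> #|[pred x : 'I_N | (x < n)%N]| = n.
Proof.
move=> nN; rewrite -[RHS]card_ord -(card_codom (f := widen_ord nN)); last first.
  by move=> a b /(congr1 val) /= ?; exact/val_inj.
apply: eq_card => x; rewrite inE; apply/idP/codomP => [xn|[y ->]]; last exact: (ltn_ord y).
by exists (Ordinal xn); exact/val_inj.
Qed.

(** In the Smith form B = L D Q the lattice of B is L D Z^d. Hence L maps the box of vectors whose
    i-th entry is below the modulus of the i-th diagonal entry onto representatives. *)
Lemma lattice_representatives d (B : 'M[int]_d) : \det B != 0 ->
  exists s : seq 'cV[int]_d, [/\ uniq s, size s = `|\det B|%N,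
    forall v, exists2 r, r \in s & exists k, v - r = B *m k
  & forall r r' k, r \in s -> r' \in s -> r - r' = B *m k -> r = r'].
Proof.
have [L Lu [Q Qu [e _ BE]]] := int_Smith_normal_form B.
pose delta (i : 'I_d) : int := e`_i.
pose D : 'M[int]_d := \matrix_(i, j) (e`_i *+ (i == j :> nat)).
have DE (v : 'cV[int]_d) i : (D *m v) i 0 = delta i * v i 0.
  rewrite mxE (bigD1 i)//= !mxE eqxx mulr1n big1 ?addr0// => j ji.
  by rewrite mxE eq_sym (negbTE (ji : j != i :> nat)) mulr0n mul0r.
have detD : \det D = \prod_i delta i.
  have -> : D = diag_mx (\row_i delta i).
    by apply/matrixP => i j; rewrite !mxE.
  by rewrite det_diag; apply: eq_bigr => i _; rewrite mxE.
have abs1 (A : 'M[int]_d) : A \in unitmx -> `|\det A|%N = 1%N.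
  rewrite unitmxE => /mulrV /(congr1 absz)/eqP.
  by rewrite abszM muln_eq1 => /andP[/eqP].
move=> Bn0.
have detB : `|\det B|%N = (\prod_i `|delta i|)%N.
  rewrite BE !det_mulmx !abszM (abs1 L Lu) (abs1 Q Qu) mul1n muln1 -/D detD.
  by apply: (big_morph absz abszM).
have delta_neq0 i : delta i != 0.
  move: Bn0; rewrite -(absz_eq0 (\det B)) detB; apply: contra => /eqP di.
  by rewrite (bigD1 i)//= di mul0n.
(* A common bound for the digits, so that the box lives in functions to a single ordinal type. *)
pose N := (\sum_i `|delta i|)%N.
have dN i : (`|delta i| <= N)%N by rewrite /N (bigD1 i)//= leq_addr.
pose F i : pred 'I_N := [pred x : 'I_N | (x < `|delta i|)%N].
pose h (t : {ffun 'I_d -> 'I_N}) : 'cV[int]_d := L *m \col_i (t i : nat)%:Z.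
have h_inj : injective h.
  move=> t t' /(congr1 (mulmx (invmx L))); rewrite !mulKmx// => tt'.
  apply/ffunP => i; apply/val_inj; have := congr1 (fun v : 'cV[int]_d => v i 0) tt'.
  by rewrite !mxE => -[].
exists (map h (enum (family F))); split.
- by rewrite map_inj_uniq// enum_uniq.
- rewrite size_map -cardE card_family detB foldrE big_map big_enum /=.
  by apply: eq_bigr => i _; rewrite card_ord_lt.
- move=> v; pose u := invmx L *m v.
  have lt i : (`|(u i ord0 %% delta i)%Z| < N)%N.
    apply: leq_trans (dN i); have := ltz_mod (u i ord0) (delta_neq0 i).
    have := modz_ge0 (u i ord0) (delta_neq0 i). lia.
  pose t : {ffun 'I_d -> 'I_N} := [ffun i => Ordinal (lt i)].
  exists (h t).
    apply: map_f; rewrite mem_enum; apply/familyP => i; rewrite inE ffunE /=.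
    have := ltz_mod (u i ord0) (delta_neq0 i); have := modz_ge0 (u i ord0) (delta_neq0 i). lia.
  exists (invmx Q *m \col_i (u i ord0 %/ delta i)%Z).
  rewrite BE -/D -!mulmxA mulKVmx// -[X in X - _](mulKVmx Lu) -/u -mulmxBr; congr (_ *m _).
  clearbody u; apply/colP => i; rewrite DE !mxE ffunE /= gez0_abs ?modz_ge0//.
  by apply/eqP; rewrite subr_eq mulrC; apply/eqP; exact: divz_eq.
- move=> r r' k /mapP[t]; rewrite mem_enum => /familyP tF -> /mapP[t'].
  rewrite mem_enum => /familyP t'F ->.
  rewrite BE -/D -!mulmxA -mulmxBr => /(congr1 (mulmx (invmx L))); rewrite !mulKmx// => E.
  congr h; apply/ffunP => i; apply/val_inj.
  have := congr1 (fun v : 'cV[int]_d => v i 0) E; rewrite DE; move: ((Q *m k) i 0) => a;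
    rewrite !mxE.
  have := tF i; have := t'F i; rewrite !inE.
  case: (eqVneq a 0) => [a0 _ _ /eqP|an0 lt lt']; first by rewrite a0 mulr0 subr_eq0 => /eqP[].
  move=> /(congr1 absz); rewrite abszM.
  have : (0 < `|a|)%N by rewrite absz_gt0. move=> a_gt0 E2.
  have : (`|delta i| <= `|(t i : nat)%:Z - (t' i : nat)%:Z|)%N by rewrite E2 leq_pmulr.
  change (val (t i)) with (nat_of_ord (t i)); change (val (t' i)) with (nat_of_ord (t' i)).
  by move: lt lt'; clear; move: `|delta i|%N (t i : nat) (t' i : nat) => x y z; lia.
Qed.

(** * Integer points of zonotopes *)

Section zonotope.
Variable R : realFieldType.

Definition fractional m (u : 'cV[R]_m) : {set 'I_m} := [set j | 0 < u j 0 < 1]%SET.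

Definition in_cube m (u : 'cV[R]_m) := forall j, 0 <= u j 0 <= 1.

(* Moving along a kernel vector supported on the fractional coordinates until
   the boundary of the cube is hit makes one of these coordinates integral. *)
Lemma fewer_fractional d m (M : 'M[R]_(d, m)) (u z : 'cV[R]_m) :
  in_cube u -> (forall j, z j 0 != 0 -> j \in fractional u) -> M *m z = 0 ->
  z != 0 ->
  exists u', [/\ in_cube u', M *m u' = M *m u & fractional u' \proper fractional u].
Proof.
move=> uc zfr Mz z0.
have [j0 zj0] : exists j, z j 0 != 0.
  apply: contrapT => nz; case/eqP: z0; apply/colP => j; rewrite mxE.
  by apply/eqP; apply: contrapT => /negP zj; apply: nz; exists j.
(* Where [z j 0 != 0], this is how far one can move along [z] before coordinate [j] reaches 0 or
   1. *)
pose t j := if 0 < z j 0 then (1 - u j 0) / z j 0 else u j 0 / - z j 0.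
case: (@Order.TotalTheory.arg_minP _ R _ j0 (fun j => z j 0 != 0) t zj0) => j1 zj1 tmin.
exists (u + t j1 *: z); split.
- move=> j; rewrite !mxE.
  have [zj|zj] := eqVneq (z j 0) 0; first by rewrite zj mulr0 addr0.
  have := zfr _ zj; rewrite inE => uj; have := zfr _ zj1; rewrite inE => uj1.
  have t0 : 0 <= t j1.
    rewrite /t; case: ifPn => [z_gt|]; first by rewrite divr_ge0//; lra.
    by rewrite -leNgt => z_le; rewrite divr_ge0//; lra.
  have := tmin _ zj; rewrite /t -/(t j1); case: ifPn => [z_gt|].
    rewrite ler_pdivlMr//; have := mulr_ge0 t0 (ltW z_gt); lra.
  rewrite -leNgt => z_le; have {z_le} zlt : 0 < - z j 0 by rewrite oppr_gt0 lt_neqAle zj.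
  rewrite ler_pdivlMr//; have := mulr_ge0 t0 (ltW zlt); lra.
- by rewrite mulmxDr -scalemxAr Mz scaler0 addr0.
- apply/properP; split.
    apply/fintype.subsetP => j jf; apply: contraT => jn; move: (jf).
    have zj : z j 0 = 0 by apply/eqP; apply: contraNT jn => /zfr.
    by move: jn; rewrite !inE !mxE zj mulr0 addr0 => /negP.
  exists j1; first exact: zfr.
  rewrite inE !mxE /t; case: ifPn => [z_gt|zn]; first by rewrite divfK// addrC subrK ltxx andbF.
  by rewrite invrN mulrN mulNr divfK// subrr ltxx.
Qed.

(** [fewer_fractional] is applied as long as possible. The last clause says that the columns of [M]
    at the fractional coordinates of [u'] are independent, that is, [u'] is a vertex of its fibre in
    the cube. *)
Lemma cube_vertex d m (M : 'M[R]_(d, m)) (u : 'cV[R]_m) : in_cube u ->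
  exists u', [/\ in_cube u', M *m u' = M *m u &
    forall z : 'cV[R]_m, (forall j, z j 0 != 0 -> j \in fractional u') -> M *m z = 0 -> z = 0].
Proof.
have [n] := ubnP #|fractional u|; elim: n u => // n IHn u ltn uc.
have [z|nz] := pselect (exists z : 'cV[R]_m,
    [/\ forall j, z j 0 != 0 -> j \in fractional u, M *m z = 0 & z != 0]).
  have [z' [zf Mz z0]] := z.
  have [u1 [u1c Mu1 /proper_card lt]] := fewer_fractional uc zf Mz z0.
  have [u' [u'c Mu' ind]] := IHn u1 (leq_trans lt ltn) u1c.
  by exists u'; rewrite Mu' Mu1.
exists u; split=> // z zf Mz; apply/eqP; apply: contrapT => /negP z0.
by apply: nz; exists z.
Qed.

(** There are fewer than [size p] roots, so one of the [size p] points 1/2, 1/3, ... is not a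
    root. *)
Lemma exists_nonroot (p : {poly R}) : p != 0 -> exists t, [/\ 0 < t, t < 1 & ~~ root p t].
Proof.
move=> p0; apply: contrapT => noroot.
pose s : seq R := [seq (i.+2%:R)^-1 | i <- iota 0 (size p)].
have s_uniq : uniq s.
  rewrite map_inj_uniq ?iota_uniq// => i j /invr_inj /eqP.
  by rewrite eqr_nat => /eqP[].
have s_root : all (root p) s.
  apply/allP => _ /mapP[i _ ->].
  apply: contrapT => /negP nr; apply: noroot; exists i.+2%:R^-1; split => //.
    by rewrite invf_lt1// ltr1n.
by have := max_poly_roots p0 s_root s_uniq; rewrite size_map size_iota ltnn.
Qed.

Lemma row_free_square d n (A : 'M[R]_(d, n)) :
  (forall l : 'rV_d, l *m A = 0 -> l = 0) -> (forall z : 'cV_n, A *m z = 0 -> z = 0) -> d = n.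
Proof.
have free k l (B : 'M[R]_(k, l)) : (forall v : 'rV_k, v *m B = 0 -> v = 0) -> \rank B = k.
  move=> B0; apply/eqP; rewrite -/(row_free B) -kermx_eq0; apply/eqP/row_matrixP => i.
  by rewrite row0; apply: B0; rewrite -row_mul mulmx_ker row0.
move=> /free dE A0; rewrite -[LHS]dE -mxrank_tr; apply: free => v /(congr1 trmx).
by rewrite trmx_mul trmxK trmx0 => /A0 /(congr1 trmx); rewrite trmxK trmx0.
Qed.

Lemma inj_det_neq0 n (A : 'M[R]_n) : (forall z : 'cV_n, A *m z = 0 -> z = 0) -> \det A != 0.
Proof.
move=> A0; rewrite -det_tr; apply/det0P => -[v v0 /(congr1 trmx)].
rewrite trmx_mul trmxK trmx0 => /A0 /(congr1 trmx); rewrite trmxK trmx0 => vE.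
by rewrite vE eqxx in v0.
Qed.

(** A kernel vector of the submatrix, extended by zero off the image of [phi], is a kernel vector of
    [A] supported in [J]. *)
Lemma colsub_ker d m n (A : 'M[R]_(d, m)) (phi : 'I_n -> 'I_m) (J : {set 'I_m}) :
  injective phi ->
  (forall z : 'cV[R]_m, (forall j, z j 0 != 0 -> j \in J) -> A *m z = 0 -> z = 0) ->
  (forall i, phi i \in J) -> forall z : 'cV[R]_n, colsub phi A *m z = 0 -> z = 0.
Proof.
move=> phi_inj ind phiJ z z0; pose y : 'cV[R]_m := \col_j \sum_(i | phi i == j) z i 0.
have yE i : y (phi i) 0 = z i 0.
  by rewrite mxE (big_pred1 i)// => k; rewrite (inj_eq phi_inj).
have y0 : y = 0.
  apply: ind.
    move=> j; apply: contraNT => jn; rewrite mxE big_pred0// => k; apply/negbTE.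
    by apply: contraNneq jn => <-.
  rewrite -[RHS]z0; apply/colP => k; rewrite !mxE.
  under eq_bigr do rewrite [y _ _]mxE mulr_sumr.
  rewrite (exchange_big_dep xpredT)//=; apply: eq_bigr => i _.
  by rewrite (big_pred1 (phi i)) => [|j]; rewrite ?mxE//= eq_sym.
by apply/colP => i; rewrite -yE y0 !mxE.
Qed.

Section count.
Variables (d m : nat) (M : 'M[int]_(d, m)).
Let MR : 'M[R]_(d, m) := map_mx intr M.
Hypothesis M_full : forall l : 'rV[R]_d, l *m MR = 0 -> l = 0.

(** A covector l killing the fractional columns turns p = M (theta + u) into one equation on theta,
    in which u enters only through the set of its coordinates equal to 1. On the curve theta = (t,
    t^2, ..., t^m) it is a nonzero polynomial equation in t, because l M is nonzero, and finitely
    many such equations have to be avoided. *)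
Lemma generic_shift (Q : nat) : exists theta : 'cV[R]_m, (forall j, 0 < theta j 0 < 1) /\
  forall (p : 'cV[int]_d) (u : 'cV[R]_m), (forall i, (`|p i ord0| <= Q)%N) ->
    in_cube u -> map_mx intr p = MR *m (theta + u) ->
  forall l : 'rV[R]_d, (forall j, j \in fractional u -> (l *m MR) 0 j = 0) -> l = 0.
Proof.
pose bad (J : {set 'I_m}) (l : 'rV[R]_d) := l != 0 /\ forall j, j \in J -> (l *m MR) 0 j = 0.
(* One covector per set [J] suffices to exclude that [J]; the value is 0 when there is no bad
   covector. *)
pose bl J := xget 0 [set l | bad J l].
pose ind (I : {set 'I_m}) : 'cV[R]_m := \col_j (j \in I)%:R.
pose pf (f : {ffun 'I_d -> 'I_(Q.*2.+1)}) : 'cV[R]_d := \col_i (((f i : nat)%:Z - Q%:Z)%:~R).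
(* The exponents of the curve start at 1, so that the constant term cannot cancel a coefficient of l
   M. *)
pose q (x : {set 'I_m} * {set 'I_m} * {ffun 'I_d -> 'I_(Q.*2.+1)}) : {poly R} :=
  (\sum_j ((bl x.1.1 *m MR) 0 j)%:P * 'X^(j.+1)) +
  ((bl x.1.1 *m (MR *m ind x.1.2 - pf x.2)) 0 0)%:P.
have q0 x : bl x.1.1 != 0 -> q x != 0.
  move=> b0; have [j bj] : exists j, (bl x.1.1 *m MR) 0 j != 0.
    apply: contrapT => nz; case/eqP: b0; apply: M_full; apply/rowP => j; rewrite [RHS]mxE.
    by apply/eqP; apply: contrapT => /negP ?; apply: nz; exists j.
  apply: contraNneq bj => /(congr1 (fun p : {poly R} => p`_j.+1)).
  rewrite coefD coefC /= addr0 coef0 coef_sum (bigD1 j)//= coefCM coefXn eqxx mulr1.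
  rewrite big1 ?addr0 => [->//|k kj]; rewrite coefCM coefXn eqSS.
  by rewrite eq_sym (negbTE (kj : k != j :> nat)) mulr0.
pose prodq := \prod_(x | bl x.1.1 != 0) q x.
have prodq0 : prodq != 0 by apply/prodf_neq0 => x; exact: q0.
have [t [t0 t1 tr]] := exists_nonroot prodq0.
exists (\col_j t ^+ j.+1); split=> [j|p u pQ uc pE l lJ].
  by rewrite mxE exprn_gt0//= exprn_ilt1 ?ltW.
apply: contrapT => /eqP l0.
have [b0 bJ] : bad (fractional u) (bl (fractional u)) by apply: (xgetPex 0); exists l.
have flt i : (absz (p i ord0 + Q%:Z)%R < Q.*2.+1)%N by have := pQ i; lia.
pose f : {ffun 'I_d -> 'I_(Q.*2.+1)} := [ffun i => Ordinal (flt i)].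
have fE : pf f = map_mx intr p.
  apply/colP => i; rewrite !mxE ffunE /=; congr (_%:~R).
  by have := pQ i; change (p i 0) with (p i ord0); lia.
pose I : {set 'I_m} := [set j | u j 0 == 1]%SET.
have /negP[] := tr; apply/rootP; rewrite /prodq horner_prod.
rewrite (bigD1 (fractional u, I, f))//= [X in X * _](_ : _ = 0) ?mul0r//.
rewrite hornerD hornerC horner_sum /= fE pE -mulmxBr mulmxA.
move: bJ; set c := bl _ *m MR => cJ; clearbody c.
have cu : c *m ind I = c *m u.
  apply/matrixP => i k; rewrite !mxE; apply: eq_bigr => j _.
  rewrite !ord1 mxE inE; have [jf|jf] := boolP (j \in fractional u).
    by rewrite cJ// !mul0r.
  have := uc j; move: jf; rewrite inE negb_and -!leNgt.
  by have [->|u1] := eqVneq (u j 0) 1; [|move=> H ?; congr (_ * _) => /=; lra].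
rewrite mulmxBr mulmxDr cu opprD addrCA subrr addr0 !mxE; apply/eqP; rewrite subr_eq0.
by apply/eqP; apply: eq_bigr => j _; rewrite !hornerE mxE.
Qed.

(** The entries of [theta + u] lie between 0 and 2. The bound does not involve theta, so
    [generic_shift] can be given its finite range of integer points beforehand. *)
Lemma zonotope_bound (theta u : 'cV[R]_m) (p : 'cV[int]_d) :
  (forall j, 0 < theta j 0 < 1) -> in_cube u -> map_mx intr p = MR *m (theta + u) ->
  forall i, (`|p i ord0| <= 2 * \sum_i \sum_j `|M i j|)%N.
Proof.
move=> th uc pE i; rewrite -(@ler_nat R) natr_absz intr_norm.
have -> : (p i ord0)%:~R = (MR *m (theta + u)) i 0 by rewrite -pE mxE.
rewrite mxE; apply: le_trans (ler_norm_sum _ _ _) _.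
rewrite natrM (bigD1 i)//= natrD mulrDr natr_sum mulr_sumr.
rewrite -[leLHS]addr0 lerD ?mulr_ge0//; apply: ler_sum => j _.
rewrite normrM !mxE mulrC ler_pM//; last by rewrite natr_absz intr_norm.
by have thj := th j; have ucj := uc j; rewrite ger0_norm; lra.
Qed.

Lemma card_set_pairs : #|[set x : {set 'I_m} * {set 'I_m} | (#|x.1| == d) && (x.2 \subset ~: x.1)]%SET|
  = (2 ^ (m - d) * 'C(m, d))%N.
Proof.
rewrite -sum1_card (eq_bigl (fun x : {set 'I_m} * {set 'I_m} =>
  (#|x.1| == d) && (x.2 \subset ~: x.1))); last first.
  by move=> x; rewrite inE.
rewrite -(pair_big_dep (fun J : {set 'I_m} => #|J| == d) (fun J I : {set 'I_m} =>
  I \subset ~: J) (fun _ _ => 1%N)) /=.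
under eq_bigr => J /eqP Jd.
  rewrite sum1_card.
  rewrite (_ : #|_| = 2 ^ (m - d))%N; last first.
    have -> : (m - d = #|~: J|)%N by rewrite -Jd [RHS]cardsCs finset.setCK card_ord.
    by rewrite -card_powerset; apply: eq_card => I; rewrite powersetE.
  over.
by rewrite sum_nat_const -cardsE card_draws card_ord mulnC.
Qed.

(* For a generic shift theta, each integer point p of the zonotope is the image
   of a vertex u of its fibre, and u has exactly d fractional coordinates. Their
   set J, the other (integral) coordinates of u and the class of p modulo the
   lattice spanned by the columns in J determine p. *)
Lemma zonotope_count D :
  (forall phi : 'I_d -> 'I_m, injective phi -> (`|\det (colsub phi M)| <= D)%N) ->
  exists theta : 'cV[R]_m, (forall j, 0 < theta j 0 < 1) /\
  forall P : seq 'cV[int]_d, uniq P ->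
    (forall p, p \in P -> exists u, in_cube u /\ map_mx intr p = MR *m (theta + u)) ->
  (size P <= 2 ^ (m - d) * 'C(m, d) * D)%N.
Proof.
move=> MD; have [theta [th gen]] := generic_shift (2 * \sum_i \sum_j `|M i j|).
exists theta; split=> // P P_uniq PE.
have PV p : p \in P -> exists u, [/\ in_cube u, map_mx intr p = MR *m (theta + u),
    #|fractional u| = d & forall z : 'cV[R]_m,
      (forall j, z j 0 != 0 -> j \in fractional u) -> MR *m z = 0 -> z = 0].
  move=> /PE[u0 [u0c pE0]]; have [u [uc Mu ind]] := cube_vertex MR u0c.
  have pE : map_mx intr p = MR *m (theta + u) by rewrite mulmxDr Mu -mulmxDr.
  exists u; split=> //; apply/esym.
  (* Genericity makes the rows independent and the vertex property the columns, so there are exactly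
     [d] fractional coordinates. *)
  apply: (@row_free_square _ _ (colsub (fun i : 'I_#|fractional u| => enum_val i) MR)).
    move=> l; rewrite mulmx_colsub => /rowP l0; apply: (gen p u) => //;
      first exact: zonotope_bound.
    by move=> j jf; have := l0 (enum_rank_in jf j); rewrite !mxE enum_rankK_in.
  by move=> z; apply: (colsub_ker enum_val_inj ind) => i; exact: enum_valP.
have enumJ (J : {set 'I_m}) : #|J| = d -> exists phi : 'I_d -> 'I_m,
    [/\ injective phi, forall j, j \in J -> exists i, j = phi i & forall i, phi i \in J].
  move=> Jd; exists (fun i => enum_val (cast_ord (esym Jd) i)); split.
  - by move=> i i' /enum_val_inj/cast_ord_inj.
  - move=> j jJ; exists (cast_ord Jd (enum_rank_in jJ j)).
    by rewrite cast_ordK enum_rankK_in.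
  - by move=> i; exact: enum_valP.
have [P0|[p0 p0P]] : P = [::] \/ exists p0, p0 \in P.
  by case: (P) => [|p0 ?]; [left|right; exists p0; exact: mem_head].
  by rewrite P0.
have [u0 [_ _ /enumJ[phi0 _] _]] := PV _ p0P.
pose good (J : {set 'I_m}) (ph : ('I_d -> 'I_m) * seq 'cV[int]_d) := #|J| = d ->
  [/\ injective ph.1, forall j, j \in J -> exists i, j = ph.1 i,
    forall i, ph.1 i \in J & \det (colsub ph.1 M) != 0 ->
    size ph.2 = `|\det (colsub ph.1 M)|%N /\
    forall v, exists2 r, r \in ph.2 & exists k, v - r = colsub ph.1 M *m k].
have /choice[phs phsP] J : exists ph, good J ph.
  have [Jd|/eqP nJd] := eqVneq #|J| d; last by exists (phi0, [::]).
  have [phi [phi_inj phi_surj phiJ]] := enumJ J Jd.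
  have [det0|/lattice_representatives[s [_ ss sP _]]] := eqVneq (\det (colsub phi M)) 0.
    by exists (phi, [::]); split=> //=; rewrite det0 eqxx.
  by exists (phi, s).
pose X : finType := ({set 'I_m} * {set 'I_m} * 'I_D.+1)%type.
(* A label holds the fractional set, the set of coordinates equal to 1 and the index of the class of
   [p] modulo the lattice of the fractional columns. *)
pose rel (p : 'cV[int]_d) (x : X) := let B := colsub (phs x.1.1).1 M in
  [/\ #|x.1.1| = d, x.1.2 \subset ~: x.1.1, \det B != 0,
    (x.2 < D)%N & exists u k, [/\ map_mx intr p = MR *m (theta + u),
    p - nth 0 (phs x.1.1).2 x.2 = B *m k &
    forall j, if j \in x.1.1 then is_true (0 < u j 0 < 1) else u j 0 = (j \in x.1.2)%:R]].
have rel_inj p p' x : rel p x -> rel p' x -> p = p'.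
  case: x => [[J I] n] [/= Jd _ Bn0 _ [u [k [pE pk uE]]]] [_ _ _ _ [u' [k' [p'E p'k u'E]]]].
  have [phi_inj phi_surj phiJ _] := phsP J Jd.
  set phi := (phs J).1 in phi_inj phi_surj phiJ pk p'k Bn0.
  have pp' : p - p' = colsub phi M *m (k - k').
    by rewrite mulmxBr -pk -p'k opprB addrA subrK.
  pose y : 'cV[R]_d := \col_i (u (phi i) 0 - u' (phi i) 0).
  have uy : MR *m (u - u') = colsub phi MR *m y.
    apply/colP => i; rewrite !mxE (bigID [in J]) /= [X in _ + X]big1 ?addr0.
      have JE : J = phi @: [set: 'I_d]%SET.
        apply/setP => j; apply/idP/imsetP => [/phi_surj[i' ->]|[i' _ ->//]].
        by exists i'.
      rewrite {1}JE big_imset /=; last by move=> ? ? _ _; exact: phi_inj.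
      by apply: eq_big => [a|a _]; rewrite ?inE// !mxE.
    move=> j /negbTE jJ; have := uE j; have := u'E j; rewrite jJ !mxE => -> ->.
    by rewrite subrr mulr0.
  have yk : y = map_mx intr (k - k').
    apply/eqP; rewrite -subr_eq0; apply/eqP.
    have : colsub phi MR *m (y - map_mx intr (k - k')) = 0.
      rewrite mulmxBr -uy; apply/eqP; rewrite subr_eq0; apply/eqP.
      have -> : colsub phi MR = map_mx intr (colsub phi M) by apply/matrixP => i j;
        rewrite !mxE.
      rewrite -map_mxM -pp' map_mxB pE p'E -mulmxBr; congr (_ *m _).
      by rewrite opprD addrACA subrr add0r.
    have Bu : colsub phi MR \in unitmx.
      have -> : colsub phi MR = map_mx intr (colsub phi M) by apply/matrixP => i j;
        rewrite !mxE.
      by rewrite unitmxE det_map_mx unitfE intr_eq0.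
    by move/(congr1 (mulmx (invmx (colsub phi MR)))); rewrite mulKmx// mulmx0.
  (* Fractional coordinates lie strictly between 0 and 1, so a difference of two of them that is
     integral vanishes. *)
  have k0 : k - k' = 0.
    apply/colP => i; rewrite [RHS]mxE; apply/eqP; rewrite -absz_eq0.
    have := uE (phi i); have := u'E (phi i); rewrite !phiJ => a b.
    have := congr1 (fun v : 'cV[R]_d => v i 0) yk; rewrite /y [LHS]mxE [RHS]mxE => e.
    have : `|((k - k') i 0)%:~R| < 1 :> R by rewrite -e ltr_norml; lra.
    by rewrite -intr_norm ltrz1; move: ((k - k') i 0) => x; lia.
  by apply/eqP; rewrite -subr_eq0 pp' k0 mulmx0.
have PX p : p \in P -> exists x, rel p x.
  move=> pP; have [u [uc pE Jd ind]] := PV p pP.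
  set J := fractional u in Jd ind.
  have [phi_inj phi_surj phiJ] := phsP J Jd.
  have Bn0 : \det (colsub (phs J).1 M) != 0.
    rewrite -(intr_eq0 R) -det_map_mx map_mxsub; apply: inj_det_neq0.
    exact: (colsub_ker phi_inj ind).
  move=> /(_ Bn0) [szs] /(_ p) [r rs [k rk]].
  have rlt : (index r (phs J).2 < D)%N.
    by apply: leq_trans (MD _ phi_inj); rewrite -szs index_mem.
  exists (J, [set j | u j 0 == 1]%SET, inord (index r (phs J).2)); split => //=.
  - apply/fintype.subsetP => j; rewrite !inE => /eqP ->; by rewrite ltxx andbF.
  - by rewrite inordK// ltnW.
  - exists u, k; split=> //; first by rewrite inordK ?nth_index// ltnW.
    move=> j; have := uc j; rewrite !inE; case: ifP => // /negbT.
    rewrite negb_and -!leNgt; have [->//|u1] := eqVneq (u j 0) 1; move=> /= H1 H2; lra.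
have /choice[h hP] (p : 'cV[int]_d) : exists x, p \in P -> rel p x.
  by have [/PX[x]|] := boolP (p \in P); [exists x|exists (finset.set0, finset.set0, ord0)].
pose A := [set x : X | [&& #|x.1.1| == d, x.1.2 \subset ~: x.1.1 & (x.2 < D)%N]]%SET.
have <- : #|A| = (2 ^ (m - d) * 'C(m, d) * D)%N.
  rewrite -card_set_pairs -[X in (_ * X)%N](card_ord_lt (leqnSn D)) -[in X in (_ * X)%N]cardsE -cardsX.
  apply: eq_card => -[[J I] k]; rewrite !inE /=.
  by rewrite andbA.
rewrite -(size_map h) cardE; apply: uniq_leq_size.
  rewrite map_inj_in_uniq// => p p' pP p'P hpp'; apply: (rel_inj _ _ (h p)); first exact: hP.
  by rewrite hpp'; exact: hP.
move=> _ /mapP[p /hP[Jd Ic _ kD _] ->]; rewrite mem_enum inE.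
by rewrite Jd eqxx Ic kD.
Qed.
End count.
End zonotope.

(** * Eigenvalues and logarithms of determinants *)

Section spectral.
Import spectral complex.
Variable R : rcfType.
Local Notation C := (R[i]).

(** Diagonalisation takes place over the complex numbers, for a hermitian matrix. The eigenvalues
    are real, so determinant and traces descend, and S - lam i is singular over the reals, which
    gives a real eigenvector. *)
Lemma symmetric_eigenvalues d (S : 'M[R]_d) : S^T = S ->
  exists lam : 'I_d -> R, [/\ \det S = \prod_i lam i,
    forall k, \tr (S ^+ k) = \sum_i lam i ^+ k &
    forall i, exists2 v : 'rV[R]_d, v != 0 & v *m S = lam i *: v].
Proof.
move=> Ssym; pose f : {rmorphism R -> C} := real_complex R.
pose SC : 'M[C]_d := map_mx f S.
have SCh : SC \is hermsymmx.
  apply: realsym_hermsym.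
    apply/is_hermitianmxP; rewrite expr0 scale1r; apply/matrixP => i j.
    by rewrite !mxE -[in LHS]Ssym mxE.
  by apply/mxOverP => i j; rewrite mxE; apply/complex_realP; exists (S i j).
have /hermitian_normalmx/orthomx_spectralP SE := SCh.
have Dreal := hermitian_spectral_diag_real SCh.
have Pu : spectralmx SC \in unitmx by exact: spectral_unit.
move: Pu SE Dreal; move: (spectralmx SC) (spectral_diag SC) => P D Pu SE Dreal.
have [lam lamE] : exists lam : 'I_d -> R, forall i, f (lam i) = D 0 i.
  exists (fun i => complex.Re (D 0 i)) => i.
  by have /mxOverP/(_ 0 i) := Dreal; exact: RRe_real.
have f_inj : injective f by exact: fmorph_inj.
have powS k : map_mx f (S ^+ k) = invmx P *m diag_mx (\row_i D 0 i ^+ k) *m P.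
  elim: k => [|k IHk].
    rewrite expr0 map_mx1 (_ : diag_mx _ = 1%:M) ?mulmx1 ?mulVmx//.
    by apply/matrixP => i j; rewrite !mxE expr0.
  have -> : map_mx f (S ^+ k.+1) = SC *m map_mx f (S ^+ k) by rewrite exprS map_mxM.
  rewrite IHk SE -!mulmxA mulKVmx//; congr (_ *m _); rewrite mulmxA; congr (_ *m _).
  apply/matrixP => i j.
  rewrite mul_diag_mx !mxE exprS; case: eqVneq => [->|_]; by rewrite ?mulr0n ?mulr1n ?mulr0.
exists lam; split.
- apply: f_inj; rewrite -det_map_mx -/SC SE !det_mulmx mulrAC -det_mulmx mulVmx// det1 mul1r.
  by rewrite det_diag rmorph_prod; apply: eq_bigr => i _; rewrite lamE.
- move=> k; apply: f_inj; rewrite -trace_map_mx powS mxtrace_mulC mulmxA mulmxV// mul1mx.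
  rewrite rmorph_sum; apply: eq_bigr => i _.
  by rewrite !mxE eqxx mulr1n rmorphXn /= -lamE.
- move=> i; have /eqP/det0P[v v0 vS] : \det (S - (lam i)%:M) = 0.
    apply: f_inj; rewrite -det_map_mx rmorph0 map_mxB map_scalar_mx -/SC lamE.
    have -> : SC - (D 0 i)%:M = invmx P *m (diag_mx (\row_j (D 0 j - D 0 i))) *m P.
      rewrite (_ : diag_mx _ = diag_mx D - (D 0 i)%:M); last first.
        by apply/matrixP => a b; rewrite !mxE mulrnBl.
      by rewrite mulmxBr mulmxBl -SE mul_mx_scalar -scalemxAl mulVmx// scalemx1.
    by rewrite !det_mulmx det_diag (bigD1 i)//= mxE subrr mul0r mulr0 mul0r.
  exists v => //; move/eqP: vS; rewrite mulmxBr subr_eq0 => /eqP ->.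
  by rewrite mul_mx_scalar.
Qed.
End spectral.

Section ln_approximation.
Variable R : realType.

(** Remainder after [m] terms of the power series of - ln (1 - y) at 0. *)
Let rest m (y : R) : R := - ln (1 - y) - \sum_(j < m) y ^+ j.+1 / j.+1%:R.

Let is_derive_rest m (y : R) : y < 1 -> is_derive y 1 (rest m) (y ^+ m / (1 - y)).
Proof.
move=> y1; have y1' : 0 < 1 - y by rewrite subr_gt0.
elim: m => [|m IHm].
  have -> : rest 0 = (- (@ln R \o (cst 1 - id))) :> (R -> R).
    by apply/funext => x; rewrite /rest big_ord0 subr0.
  have dln : is_derive ((cst 1 - id : R -> R) y) 1 (@ln R) (1 - y)^-1 by exact: is_derive1_ln.
  have dlin : is_derive y 1 (cst 1 - id : R -> R) (0 - 1) by exact: is_deriveB.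
  apply: is_derive_eq (is_deriveN (is_derive1_comp dln dlin)) _.
  by rewrite sub0r mulrN1 opprK expr0 mul1r.
have -> : rest m.+1 = rest m - m.+1%:R^-1 *: (id ^+ m.+1 : R -> R) :> (R -> R).
  apply/funext => x; rewrite /rest big_ord_recr /= opprD addrA.
  by rewrite !fctE [_ *: _]mulrC.
have dX : is_derive y 1 (id ^+ m.+1 : R -> R) (m.+1%:R * y ^+ m) .
  by apply: is_derive_eq (is_deriveX m.+1 (is_derive_id y (1 : R))) _; rewrite [_ *: _]mulr1.
apply: is_derive_eq (is_deriveB IHm (is_deriveZ m.+1%:R^-1 dX)) _.
by rewrite [_ *: _]mulKf ?pnatr_eq0// exprS; field; rewrite gt_eqF.
Qed.

(** With y = 1 - x / b one has ln x = ln b + ln (1 - y), where y stays in [0, q] with q = 1 - a / b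
    < 1. By the mean value theorem the remainder of the series is at most q^m / (1 - q). *)
Lemma ln_poly_approx (a b e : R) : 0 < a -> a <= b -> 0 < e ->
  exists p : {poly R}, forall x, a <= x <= b -> `|ln x - p.[x]| <= e.
Proof.
move=> a0 ab e0; have b0 : 0 < b by exact: lt_le_trans ab.
pose q := 1 - a / b.
have q0 : 0 <= q by rewrite subr_ge0 ler_pdivrMr// mul1r.
have q1 : 0 < 1 - q by rewrite /q opprB addrC subrK divr_gt0.
have [m me] : exists m, q ^+ m / (1 - q) <= e.
  have qc : (GRing.exp q) @ \oo --> (0 : R).
    by apply: cvg_expr; rewrite ger0_norm// -subr_gt0.
  have eq0 : 0 < e * (1 - q) by rewrite mulr_gt0.
  have /cvgrPdist_le/(_ _ eq0)[m _ /(_ m (leqnn m))] := qc.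
  rewrite /= sub0r normrN ger0_norm ?exprn_ge0// => ?.
  by exists m; rewrite ler_pdivrMr.
exists ((ln b)%:P - \sum_(j < m) (j.+1%:R^-1)%:P * (1 - (b^-1)%:P * 'X) ^+ j.+1).
move=> x /andP[ax xb]; have x0 : 0 < x by exact: lt_le_trans ax.
set y := 1 - x / b; have y1 : y < 1 by rewrite /y ltrBlDr ltrDl divr_gt0.
have y0 : 0 <= y by rewrite subr_ge0 ler_pdivrMr// mul1r.
have yq : y <= q by rewrite /y /q lerB// ler_pM2r ?invr_gt0.
have -> : ln x - ((ln b)%:P - \sum_(j < m) (j.+1%:R^-1)%:P * (1 - (b^-1)%:P * 'X) ^+ j.+1).[x]
   = - rest m y.
  have -> : x = b * (1 - y) by rewrite /y opprB addrC subrK mulrC divfK ?gt_eqF.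
  rewrite lnM ?posrE ?subr_gt0// /rest !hornerE horner_sum.
  under eq_bigr => j _.
    rewrite !hornerE /= mulVf ?gt_eqF// mul1r opprB [1 + _]addrC subrK mulrC.
    over.
  by rewrite /=; lra.
have [->|yn0] := eqVneq y 0.
  rewrite /rest subr0 ln1 oppr0 big1 ?subrr ?normrN ?normr0 ?ltW// => j _.
  by rewrite exprS !mul0r.
have y_gt0 : 0 < y by rewrite lt_def yn0.
have [||c] := @MVT R (rest m) (fun z => z ^+ m / (1 - z)) 0 y y_gt0.
- by move=> z; rewrite in_itv => /andP[_ zy]; apply: is_derive_rest; exact: lt_trans y1.
- apply: derivable_within_continuous => z; rewrite in_itv => /andP[_ zy].
  by have [] := is_derive_rest m (le_lt_trans zy y1).
rewrite in_itv => /andP[c0 cy]; rewrite subr0.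
have -> : rest m 0 = 0.
  rewrite /rest subr0 ln1 oppr0 big1 ?subrr// => j _; by rewrite exprS !mul0r.
rewrite subr0 normrN => ->.
have c1 : 0 < 1 - c by rewrite subr_gt0; exact: lt_trans y1.
rewrite ger0_norm ?mulr_ge0 ?invr_ge0 ?exprn_ge0//; [|exact: ltW..].
apply: le_trans me; rewrite -[leRHS]mulr1 ler_pM//; last exact: ltW.
  by rewrite mulr_ge0 ?invr_ge0 ?exprn_ge0//; exact: ltW.
apply: ler_pM; rewrite ?invr_ge0 ?exprn_ge0//; [exact: ltW..| |].
  by rewrite lerXn2r ?nnegrE//; [exact: ltW|exact: le_trans (ltW cy) yq].
by rewrite lef_pV2 ?posrE//; have := ltW cy; lra.
Qed.

End ln_approximation.

Definition sqnorm (R : realType) d (v : 'rV[R]_d) : R := \sum_i v 0 i ^+ 2.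

Lemma sqnorm_gt0 (R : realType) d (v : 'rV[R]_d) : v != 0 -> 0 < sqnorm v.
Proof.
move=> v0; rewrite lt_def sumr_ge0 ?andbT => [|i _]; last exact: sqr_ge0.
apply: contraNneq v0 => /eqP; rewrite psumr_eq0 => [|i _]; last exact: sqr_ge0.
move=> /allP v0; apply/eqP/rowP => i; rewrite mxE; apply/eqP.
by have := v0 i; rewrite mem_index_enum sqrf_eq0; apply.
Qed.

Lemma sqnormE (R : realType) d (v : 'rV[R]_d) : sqnorm v = (v *m v^T) 0 0.
Proof. by rewrite mxE; apply: eq_bigr => i _; rewrite mxE expr2. Qed.

(** Says that the symmetric matrix [S] has its spectrum in [a, b], by means of its quadratic
    form. *)
Definition form_bounded (R : realType) (a b : R) d (S : 'M[R]_d) :=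
  S^T = S /\ forall v : 'rV[R]_d, a * sqnorm v <= (v *m S *m v^T) 0 0 <= b * sqnorm v.

(** The error is [e] for each eigenvalue. The polynomial depends on the interval and on [e] only,
    not on the size of the matrix, which makes determinants on quotients and on windows
    comparable. *)
Lemma ln_det_approx (R : realType) (a b e : R) : 0 < a -> a <= b -> 0 < e ->
  exists p : {poly R}, forall d (S : 'M[R]_d), form_bounded a b S ->
    0 < \det S /\ `|ln (\det S) - \sum_(j < size p) p`_j * \tr (S ^+ j)| <= e * d%:R.
Proof.
move=> a0 ab e0; have [p pP] := ln_poly_approx a0 ab e0.
exists p => d S [/symmetric_eigenvalues[lam [detS trS eigS]] Sab].
have lam_ab i : a <= lam i <= b.
  have [v v0 vS] := eigS i; have := Sab v.
  by rewrite vS -scalemxAl mxE -sqnormE !ler_pM2r// sqnorm_gt0.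
have lam0 i : 0 < lam i by have /andP[+ _] := lam_ab i; exact: lt_le_trans.
rewrite detS; split; first by apply: prodr_gt0.
have -> : ln (\prod_i lam i) = \sum_i ln (lam i).
  have : forall s : seq 'I_d, ln (\prod_(i <- s) lam i) = \sum_(i <- s) ln (lam i).
    elim=> [|i s IHs]; first by rewrite !big_nil ln1.
    by rewrite !big_cons lnM ?IHs// posrE// prodr_gt0.
  exact.
under [X in _ - X]eq_bigr do rewrite trS big_distrr /=.
rewrite exchange_big -sumrB; apply: le_trans (ler_norm_sum _ _ _) _.
rewrite mulr_natr -[X in _ *+ X]card_ord -sumr_const; apply: ler_sum => i _.
by rewrite -horner_coef; exact: pP.
Qed.

(** * Norm bounds from row and column sums *)

Section schur_test.
Variable R : realType.

Lemma weighted_cauchy_schwarz n (a v : 'I_n -> R) :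
  (\sum_i a i * v i) ^+ 2 <= (\sum_i `|a i|) * \sum_i `|a i| * v i ^+ 2.
Proof.
have -> : (\sum_i `|a i|) * (\sum_i `|a i| * v i ^+ 2) =
    \sum_i \sum_k `|a i| * `|a k| * ((v i ^+ 2 + v k ^+ 2) / 2).
  have E1 : \sum_i \sum_k `|a i| * `|a k| * (v k ^+ 2) = (\sum_i `|a i|) * \sum_i `|a i| * v i ^+ 2.
    by rewrite big_distrl /=; apply: eq_bigr => i _; rewrite big_distrr /=;
      apply: eq_bigr => k _; rewrite mulrA.
  have E2 : \sum_i \sum_k `|a i| * `|a k| * (v i ^+ 2) = (\sum_i `|a i|) * \sum_i `|a i| * v i ^+ 2.
    by rewrite -E1 exchange_big; apply: eq_bigr => i _; apply: eq_bigr => k _;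
      rewrite (mulrC `|a k|).
  rewrite -[LHS](@mulfK _ 2) ?pnatr_eq0// mulr_natr mulr2n -{1}E1 -E2 -big_split big_distrl /=.
  apply: eq_bigr => i _; rewrite -big_split big_distrl /=; apply: eq_bigr => k _.
  by rewrite -mulrDr mulrA [v k ^+ 2 + _]addrC.
rewrite expr2 big_distrl /=; apply: ler_sum => i _; rewrite big_distrr /=;
  apply: ler_sum => k _.
apply: le_trans (ler_norm _) _; rewrite mulrACA normrM normrM ler_wpM2l ?mulr_ge0//.
have := sqr_ge0 (`|v i| - `|v k|); rewrite sqrrB !real_normK ?num_real// normrM; lra.
Qed.

Definition sums_bounded (K : R) m n (A : 'M[R]_(m, n)) :=
  (forall i, \sum_j `|A i j| <= K) /\ forall j, \sum_i `|A i j| <= K.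

(** Cauchy-Schwarz with weights |A i j| uses the column sums; summing over j then uses the row
    sums. *)
Lemma schur_test (K : R) m n (A : 'M[R]_(m, n)) (v : 'rV[R]_m) : 0 <= K ->
  sums_bounded K A -> sqnorm (v *m A) <= K ^+ 2 * sqnorm v.
Proof.
move=> K0 [rowA colA]; rewrite /sqnorm.
apply: (@le_trans _ _ (\sum_j K * \sum_i `|A i j| * v 0 i ^+ 2)).
  apply: ler_sum => j _; rewrite mxE; under eq_bigr do rewrite mulrC.
  apply: le_trans (weighted_cauchy_schwarz _ _) _.
  by rewrite ler_wpM2r ?sumr_ge0// => i _; rewrite mulr_ge0 ?sqr_ge0.
rewrite -big_distrr /= expr2 -mulrA ler_wpM2l// exchange_big /= big_distrr /=.
by apply: ler_sum => i _; rewrite -big_distrl /= ler_wpM2r ?sqr_ge0.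
Qed.

(** The Schur test for [M] bounds the form from above; for [T] it bounds it from below, as v = (v M)
    T. *)
Lemma form_bounded_gram (k K : R) d m (M : 'M[R]_(d, m)) (T : 'M[R]_(m, d)) :
  0 <= k -> 0 < K -> sums_bounded k M -> sums_bounded K T -> M *m T = 1%:M ->
  form_bounded (K ^- 2) (k ^+ 2) (M *m M^T).
Proof.
move=> k0 K0 Mk TK MT; split=> [|v]; first by rewrite trmx_mul trmxK.
have -> : (v *m (M *m M^T) *m v^T) 0 0 = sqnorm (v *m M).
  by rewrite sqnormE trmx_mul !mulmxA.
rewrite schur_test// andbT mulrC ler_pdivrMr ?exprn_gt0// mulrC.
by rewrite -{1}[v]mulmx1 -MT mulmxA schur_test// ltW.
Qed.

End schur_test.

(** * Expansiveness and compactness *)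

Section circle_lemmas.
Import generic_quotient ring_quotient.
Variable R : realType.
Local Notation tc := (@to_circle R).

Lemma to_circle0 : tc 0 = 0.
Proof. exact: raddf0. Qed.

Lemma to_circle_sum (I : Type) (s : seq I) (F : I -> R) :
  tc (\sum_(i <- s) F i) = \sum_(i <- s) tc (F i).
Proof. exact: raddf_sum. Qed.

Lemma to_circleMz r (m : int) : tc (r *~ m) = tc r *~ m.
Proof. exact: raddfMz. Qed.

Lemma to_circle_eq r s : tc r = tc s <-> r - s \is a Num.int.
Proof.
rewrite /to_circle; split => [/eqP|rs]; first by rewrite -Quotient.idealrBE.
by apply/eqP; rewrite -Quotient.idealrBE.
Qed.

Lemma to_circle_eq0 r : tc r = 0 <-> r \is a Num.int.
Proof. by rewrite -to_circle0 to_circle_eq subr0. Qed.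

Lemma to_circle_lift (theta : R) (x : circle R) :
  exists r, theta <= r < theta + 1 /\ tc r = x.
Proof.
pose s : R := repr (x : Quotient.quot (integers R)).
have sx : tc s = x by exact: reprK.
exists (s - (Num.floor (s - theta))%:~R); split.
  have := floor_itv (s - theta); rewrite intrD; lra.
rewrite -sx; apply/to_circle_eq; rewrite addrAC subrr sub0r rpredN; exact: intr_int.
Qed.

Lemma open_to_circle (A : set R) : open A -> open (tc @` A : set (circle R)).
Proof.
move=> oA; rewrite /open /= /circle_open.
have -> : tc @^-1` (tc @` A) = \bigcup_(m : int) ((fun r => r + m%:~R) @^-1` A).
  apply/seteqP; split=> [r [s As /to_circle_eq /intrP[m sr]]|r [m _ /= Arm]].
    by exists m => //=; rewrite -sr addrC subrK.
  exists (r + m%:~R) => //; apply/to_circle_eq; rewrite addrAC subrr add0r; exact: intr_int.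
apply: bigcup_open => m _; apply: open_comp => // r _.
by apply: cvgD; [exact: cvg_id|exact: cvg_cst].
Qed.

End circle_lemmas.

Section configurations.
Variables (R : realType) (G : groupType) (f : group_ring G).
Local Notation tc := (@to_circle R).
Implicit Types w : G -> R.

Lemma rhoE w g : rho R f w g = \sum_(h <- finsupp f) w (g * h)%g * (f h)%:~R.
Proof. by []. Qed.

Lemma rhoZ (c : R) w g : rho R f (fun h => c * w h) g = c * rho R f w g.
Proof. by rewrite !rhoE mulr_sumr; apply: eq_bigr => h _; rewrite mulrA. Qed.

Lemma rhoB w w' g : rho R f (fun h => w h - w' h) g = rho R f w g - rho R f w' g.
Proof. by rewrite !rhoE -sumrB; apply: eq_bigr => h _; rewrite mulrBl. Qed.

Lemma Xf_set_to_circle w :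
  Xf_set f (fun g => tc (w g)) <-> forall g, rho R f w g \is a Num.int.
Proof.
by split=> wf g; [apply/to_circle_eq0;
  rewrite -(wf g)|rewrite -[RHS](iffRL (to_circle_eq0 _) (wf g))];
  rewrite to_circle_sum; apply: eq_bigr => h _; rewrite mulrzr to_circleMz.
Qed.

Definition point_of w (wf : forall g, rho R f w g \is a Num.int) : Xf R f :=
  SigSub (mem_set (iffRL (Xf_set_to_circle w) wf)).

Definition lifts w (x : Xf R f) := forall g, tc (w g) = \val x g.

Lemma lifts_int w x : lifts w x -> forall g, rho R f w g \is a Num.int.
Proof.
move=> wx; apply/Xf_set_to_circle; have := set_mem (valP x).
by rewrite (_ : \val x = fun g => tc (w g)) //; apply/funext => g; rewrite wx.
Qed.

Lemma lifts_inj w x y : lifts w x -> lifts w y -> x = y.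
Proof. by move=> wx wy; apply/val_inj/funext => g; rewrite -wx wy. Qed.

Lemma lifts_exists (theta : G -> R) (x : Xf R f) :
  exists w, lifts w x /\ forall g, theta g <= w g < theta g + 1.
Proof.
have /choice[w wP] g := to_circle_lift (theta g) (\val x g).
by exists w; split=> g; have [] := wP g.
Qed.

Lemma lifts_alphaf w x g : lifts w x -> lifts (fun h => w (g^-1 * h)%g) (alphaf R f g x).
Proof. by move=> wx h; rewrite wx. Qed.

Definition cylinder w (K : seq G) (e : R) : set (Xf R f) :=
  [set x | forall h, h \in K -> exists r, tc r = \val x h /\ `|r - w h| < e].

(** The cylinders around [w] generate a filter [Fc]. It converges in each coordinate, hence in the
    product topology, so it contains every neighbourhood of the point. *)
Lemma open_cylinder (O : set (Xf R f)) (x0 : Xf R f) w : open O -> O x0 -> lifts w x0 ->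
  exists K e, 0 < e /\ cylinder w K e `<=` O.
Proof.
move=> [B oB <-] Bx0 wx0.
pose cyl (K : seq G) (e : R) : set {ptws G -> circle R} :=
  [set y | forall h, h \in K -> exists r, tc r = y h /\ `|r - w h| < e].
pose Fc : set_system {ptws G -> circle R} :=
  [set A | exists K e, 0 < e /\ cyl K e `<=` A].
have FcF : Filter Fc.
  split.
  - by exists [::], 1.
  - move=> A A' [K [e [e0 KA]]] [K' [e' [e'0 KA']]].
    exists (K ++ K'), (Num.min e e'); split; first by rewrite lt_min e0.
    move=> y Ky; split; [apply: KA|apply: KA'] => h hK;
      have [|r [ry rw]] := Ky h; rewrite ?mem_cat ?hK ?orbT//;
      by exists r; split=> //; move: rw; rewrite lt_min => /andP[].
  - by move=> A A' AA' [K [e [e0 KA]]]; exists K, e; split=> //; exact: subset_trans AA'.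
have : Fc --> (\val x0 : {ptws G -> circle R}).
  apply/cvg_sup => h A [_ [[B' oB' <-] B'x] sB].
  have : nbhs (w h) (tc @^-1` B') by apply: open_nbhs_nbhs; split=> //=; rewrite wx0.
  move=> /nbhs_ballP[e e0 eB]; exists [:: h], e; split=> // y Ky; apply: sB => /=.
  have [|r [<- rw]] := Ky h; first exact: mem_head.
  by apply: eB; rewrite /ball /= distrC.
have nB : nbhs (\val x0 : {ptws G -> circle R}) B by apply: open_nbhs_nbhs.
move=> /(_ _ nB)[K [e [e0 KB]]]; exists K, e; split=> // x Kx; apply: KB.
exact: Kx.
Qed.

Definition rho_injective := forall w B, (forall g, `|w g| <= B) ->
  (forall g, rho R f w g = 0) -> forall g, w g = 0.

(** A bounded kernel element can be scaled until all translates of its class in [Xf] lie in [U].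
    Then the class is 0, so the scaled values are integers below 1/2 in modulus. *)
Lemma expansive_rho_injective : expansive (alphaf R f) (Xf0 R f) -> rho_injective.
Proof.
move=> [U [oU U0 Ucap]] w B wB w0.
have lift0 : lifts (fun=> 0) (Xf0 R f) by move=> g; rewrite to_circle0.
have [K [e [e0 KU]]] := open_cylinder oU U0 lift0.
move=> g; apply: contrapT => /eqP wg.
have B0 : 0 <= B by apply: le_trans (wB g).
(* The denominator [B + 1] is positive even for [B = 0] and makes the bound on [t * w] strict. *)
pose t := (Num.min e (1/2)) / (B + 1).
have B1 : 0 < B + 1 by lra.
have t0 : 0 < t by rewrite divr_gt0// lt_min e0; lra.
have tw h : `|t * w h| < Num.min e (1/2).
  rewrite normrM (gtr0_norm t0); apply: (@le_lt_trans _ _ (t * B)).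
    by rewrite ler_pM2l.
  by rewrite /t mulrAC ltr_pdivrMr// ltr_pM2l; [lra|rewrite lt_min e0; lra].
have twf h : rho R f (fun h => t * w h) h \is a Num.int.
  by rewrite rhoZ w0 mulr0.
pose x := point_of twf.
have xw : lifts (fun h => t * w h) x by [].
have : (\bigcap_(g in [set: G]) (alphaf R f g @` U)) x.
  move=> k _; exists (alphaf R f k^-1%g x).
    apply: KU => h _; exists (t * w (k * h)%g); split; first by rewrite /= invgK.
    by rewrite subr0; have := tw (k * h)%g; rewrite lt_min => /andP[].
  by apply/val_inj/funext => h /=; rewrite invgK mulVKg.
rewrite Ucap => /= x0.
have : tc (t * w g) = 0 by have := xw g; rewrite x0.
move=> /to_circle_eq0/intrP[m tm]; have := tw g; rewrite lt_min tm => /andP[_].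
rewrite -intr_norm => m1; have : `|m|%:~R < 1 :> R by lra.
rewrite ltrz1 => m0; have {}m0 : m = 0 by lia.
by move/eqP: tm; rewrite m0 mulf_eq0 (gt_eqF t0) (negbTE wg).
Qed.

End configurations.

(** * Compactness by ultralimits *)

Section ultralimits.
Variables (R : realType) (G : groupType) (f : group_ring G).
Implicit Types w : G -> R.

Lemma nat_ultrafilter : exists U : set_system nat, UltraFilter U /\ \oo `<=` U.
Proof. exact: ultraFilterLemma. Qed.

Lemma ultralimit (U : set_system nat) (UU : UltraFilter U) (w : nat -> G -> R) (B : R) :
  (forall n g, `|w n g| <= B) ->
  exists l : G -> R, (forall g, `|l g| <= B) /\ forall g, w n g @[n --> U] --> l g.
Proof.
move=> wB; have /choice[l lP] g : exists l, `|l| <= B /\ w n g @[n --> U] --> l.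
  have UI : U ((fun n => w n g) @^-1` `[- B, B]).
    by apply: filterS filterT => n _ /=; rewrite in_itv /= -ler_norml; exact: wB.
  have [l [lB lcl]] := @segment_compact R (- B) B (w n g @[n --> U]) _ UI.
  exists l; split; first by move: lB; rewrite /= in_itv /= -ler_norml.
  move=> A Al; have [//|UnA] := in_ultra_setVsetC ((fun n => w n g) @^-1` A) UU.
  by have [x []] := lcl (~` A) A UnA Al.
by exists l; split=> g; have [lB lc] := lP g.
Qed.

Lemma cvg_norm_le (U : set_system nat) (UF : ProperFilter U) (u : nat -> R) (l d : R) :
  u n @[n --> U] --> l -> U [set n | `|u n| <= d] -> `|l| <= d.
Proof.
move=> /cvgrPdist_lt ul Ud; apply/ler_addgt0Pl => e e0.
have [n /= [lun un]] := filter_ex (filterI (ul _ e0) Ud).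
have := ler_normD (l - u n) (u n); rewrite subrK => /le_trans; apply; lra.
Qed.

Lemma rho_cvg (U : set_system nat) (UF : Filter U) (w : nat -> G -> R) (l : G -> R) g :
  (forall h, w n h @[n --> U] --> l h) -> rho R f (w n) g @[n --> U] --> rho R f l g.
Proof.
move=> wl; rewrite rhoE; under eq_fun do rewrite rhoE.
apply: cvg_big => //; first exact: add_continuous.
by move=> h _; apply: cvgM => //; exact: cvg_cst.
Qed.

Hypothesis G_countable : countable [set: G].

Lemma exhaustion : exists E : nat -> {fset G},
  (forall g, exists n, g \in E n) /\ forall m n, (m <= n)%N -> {subset E m <= E n}.
Proof.
have /countable_injP[e e_inj] := G_countable.
have /choice[E EP] n : exists X : {fset G}, [set g | (e g < n)%N] = [set` X].
  apply/finite_fsetP; apply: (@finite_preimage _ _ `I_n e); last exact: finite_II.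
  by move=> g h _ _; apply: e_inj; rewrite inE.
have EE n g : (g \in E n) = (e g < n)%N.
  apply/idP/idP => H; first by change ([set g | (e g < n)%N] g); rewrite EP.
  by change ([set` E n] g); rewrite -EP.
exists E; split=> [g|m n mn g]; first by exists (e g).+1; rewrite EE.
by rewrite !EE => /leq_trans; apply.
Qed.

Lemma eventually_invS_le (d : R) : 0 < d -> exists n0, forall n, (n0 <= n)%N -> n.+1%:R^-1 <= d.
Proof.
move=> d0; have [k dk] : exists k : nat, d^-1 <= k%:R.
  by exists (Num.bound d^-1); apply/ltW/archi_boundP; rewrite invr_ge0 ltW.
exists k => n kn; rewrite -[leRHS]invrK lef_pV2 ?posrE ?invr_gt0//.
by apply: le_trans dk _; rewrite ler_nat leqW.
Qed.

(* By compactness: a sequence of counterexamples on an exhaustion of G would have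
   as ultralimit a nonzero bounded function in the kernel of rho. *)
Lemma rho_locality : rho_injective R f -> forall e : R, 0 < e ->
  exists (E : {fset G}) (d : R), 0 < d /\ forall w, (forall g, `|w g| <= 1) ->
    (forall g, g \in E -> `|rho R f w g| <= d) -> `|w 1%g| <= e.
Proof.
move=> inj e e0; apply: contrapT => noE.
have [E [Eall Emono]] := exhaustion.
have /choice[w wP] (n : nat) : exists w, [/\ forall g, `|w g| <= 1,
    forall g, g \in E n -> `|rho R f w g| <= n.+1%:R^-1 & e < `|w 1%g|].
  apply: contrapT => now; apply: noE; exists (E n), n.+1%:R^-1; split=> // w w1 wE.
  by rewrite leNgt; apply/negP => we; apply: now; exists w.
have [U [UU ooU]] := nat_ultrafilter.
have [l [l1 wl]] : exists l : G -> R, (forall g, `|l g| <= 1) /\ forall g,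
  w n g @[n --> U] --> l g.
  by apply: ultralimit => n g; have [] := wP n.
have rl g : rho R f l g = 0.
  apply/eqP; rewrite -normr_le0; apply/ler_addgt0Pl => d d0; rewrite addr0.
  have [n0 gn0] := Eall g.
  have [n1 n1d] := eventually_invS_le d0.
  have : rho R f (w n) g @[n --> U] --> rho R f l g by apply: rho_cvg.
  move/cvg_norm_le; apply.
  apply: ooU; exists (maxn n0 n1) => // n /=; rewrite geq_max => /andP[n0n n1n].
  have [_ /(_ g) wg _] := wP n; apply: le_trans (n1d n n1n).
  by apply: wg; exact: Emono gn0.
have /inj/(_ rl)/(_ 1%g) l0 := l1.
have /cvg_norm := wl 1%g; rewrite l0 normr0 => /cvgrPdist_lt/(_ _ e0) UA.
have [n /=] := filter_ex UA; have [_ _ we] := wP n.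
by rewrite sub0r normrN normr_id => /(lt_trans we); rewrite ltxx.
Qed.

Lemma filter_all_seq (T : eqType) (U : set_system nat) (UF : Filter U) (P : T ->
  set nat) (K : seq T) :
  (forall h, h \in K -> U (P h)) -> U [set n | forall h, h \in K -> P h n].
Proof.
elim: K => [|k K IHK] KP; first by apply: filterS filterT.
have UK : U (P k) by apply: KP; exact: mem_head.
have /IHK : forall h, h \in K -> U (P h) by move=> h hK; apply: KP; rewrite inE hK orbT.
by apply: filterS2 UK => n Pk IH h; rewrite inE => /predU1P[->|/IH].
Qed.

(** Two integers within 1/4 of [l] are equal, so the sequence is constant on a set of the filter. *)
Lemma ultra_int (U : set_system nat) (UF : ProperFilter U) (u : nat -> R) (l : R) :
  (forall n, u n \is a Num.int) -> u n @[n --> U] --> l -> l \is a Num.int.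
Proof.
move=> u_int /cvgrPdist_lt ul.
have h0 : 0 < 2^-1 / 2 :> R by lra.
have [n0 /= ln0] := filter_ex (ul _ h0); have /intrP[m um] := u_int n0.
suff -> : l = m%:~R by exact: intr_int.
apply/eqP; rewrite -subr_eq0 -normr_le0; apply/ler_addgt0Pl => e e0; rewrite addr0.
have [n /= [lun lun']] := filter_ex (filterI (ul _ e0) (ul _ h0)).
have /intrP[k uk] := u_int n; suff km : k = m by rewrite -km -uk ltW.
have : `|k%:~R - m%:~R| < 1 :> R.
  rewrite -uk -um; have -> : u n - u n0 = (l - u n0) - (l - u n) by lra.
  apply: le_lt_trans (ler_normB _ _) _; lra.
rewrite -intrB -intr_norm ltrz1; lia.
Qed.

(** A Lebesgue number expressed by lifts. Were there none, an ultralimit of lifts would lift a point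
    of some member of the cover, which contains a cylinder around it. The bound 2 leaves room for
    lifts in [theta, theta + 1) with theta in [0, 1). *)
Lemma lebesgue_number (V : set (set (Xf R f))) : open_cover V ->
  exists (E : {fset G}) (d : R), 0 < d /\ forall (x : Xf R f) w, lifts w x ->
    (forall g, `|w g| <= 2) ->
    exists2 O, V O & forall (y : Xf R f) w', lifts w' y -> (forall h, h \in E ->
      `|w' h - w h| <= d) -> O y.
Proof.
move=> [Vo Vc]; apply: contrapT => noE.
have [E [Eall Emono]] := exhaustion.
have /choice[w wP] (n : nat) : exists w, [/\ exists x : Xf R f, lifts w x, forall g,
  `|w g| <= 2 &
    forall O, V O -> ~ forall (y : Xf R f) w', lifts w' y ->
      (forall h, h \in E n -> `|w' h - w h| <= n.+1%:R^-1) -> O y].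
  apply: contrapT => now; apply: noE; exists (E n), n.+1%:R^-1; split=> // x w wx w2.
  apply: contrapT => noO; apply: now; exists w; split=> //; first by exists x.
  by move=> O VO HO; apply: noO; exists O.
have [U [UU ooU]] := nat_ultrafilter.
have [l [l2 wl]] : exists l : G -> R, (forall g, `|l g| <= 2) /\ forall g,
  w n g @[n --> U] --> l g.
  by apply: ultralimit => n g; have [] := wP n.
have lfi g : rho R f l g \is a Num.int.
  apply: (@ultra_int U _ (fun n => rho R f (w n) g)); last exact: rho_cvg.
  by move=> n; have [[x wx] _ _] := wP n; exact: lifts_int wx g.
pose x := point_of lfi; have l_x : lifts l x by [].
have [V0 V0V V0x] : exists2 O, V O & O x.
  by change (cover V id x); rewrite Vc.
have [K [e [e0 KO]]] := open_cylinder (Vo _ V0V) V0x l_x.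
have e20 : 0 < e / 2 by lra.
have [n1 n1e] := eventually_invS_le e20.
have UK : U [set n | forall h, h \in K -> `|l h - w n h| < e / 2].
  by apply: filter_all_seq => h _; have /cvgrPdist_lt := wl h; apply.
have UE : U [set n | forall h, h \in K -> h \in E n].
  apply: filter_all_seq => h _; apply: ooU; have [n0 hn0] := Eall h.
  by exists n0 => // n /= n0n; exact: Emono hn0.
have Un1 : U [set n | (n1 <= n)%N] by apply: ooU; exists n1.
have [n /= [[nK nE] n1n]] := filter_ex (filterI (filterI UK UE) Un1).
have [_ _ /(_ V0 V0V)] := wP n; apply => y w' w'y w'w; apply: KO => h hK.
exists (w' h); split; first exact: w'y.
have := nK h hK; have := w'w h (nE h hK); have := n1e n n1n.
have := ler_normD (w' h - w n h) (w n h - l h); rewrite subrKA (distrC (w n h));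
  move: n.+1%:R^-1 => z; lra.
Qed.

End ultralimits.

(** * Periodic functions *)

Section cosets.
Variables (G : groupType) (N : set G).
Hypothesis N_normal : normal_subgroup N.

Lemma normal1 : N 1%g.
Proof. by have [[] + _ _] := N_normal; rewrite in_setE. Qed.

Lemma normal_div g h : N g -> N h -> N (g / h)%g.
Proof.
have [[_ Ndiv] _] := N_normal => Ng Nh.
by have := Ndiv g h; rewrite !in_setE; exact.
Qed.

Lemma normalV g : N g -> N g^-1%g.
Proof. by move=> Ng; rewrite -div1g; apply: normal_div => //; exact: normal1. Qed.

Lemma normalM g h : N g -> N h -> N (g * h)%g.
Proof. by move=> Ng Nh; rewrite -[h]invgK; apply: normal_div => //; exact: normalV. Qed.

Lemma normalJ g h : N g -> N (g ^ h)%g.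
Proof. by have [_] := N_normal; apply. Qed.

Definition coset_numbering d (idx : G -> 'I_d) (rp : 'I_d -> G) :=
  (forall g h, idx g = idx h <-> N (g^-1 * h)%g) /\ forall i, idx (rp i) = i.

Lemma exists_coset_numbering : finite_index N ->
  exists (idx : G -> 'I_(subgroup_index N)) rp, coset_numbering idx rp.
Proof.
move=> Nfin; pose X := fset_set (cosets N); pose C g : set G := [set (g * h)%g | h in N].
have CX g : C g \in X by rewrite in_fset_set// in_setE; exists g.
have CE g h : C g = C h <-> N (g^-1 * h)%g.
  split=> [E|Ngh].
    have : C h h by exists 1%g; [exact: normal1|rewrite mulg1].
    by rewrite -E => -[k Nk <-]; rewrite mulKg.
  apply/seteqP; split=> _ [k Nk <-].
    exists ((g^-1 * h)^-1 * k)%g; first by apply: normalM => //; exact: normalV.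
    by rewrite invgM invgK -!mulgA mulVKg.
  by exists (g^-1 * h * k)%g; [exact: normalM|rewrite -mulgA mulVKg].
have lt g : (index (C g) (enum_fset X) < #|` X|)%N by rewrite index_mem; exact: CX.
pose idx g : 'I_(subgroup_index N) := Ordinal (lt g).
have idxE g h : idx g = idx h <-> N (g^-1 * h)%g.
  rewrite -CE; split=> [/(congr1 val) /= E|E]; last by apply/val_inj; rewrite /= E.
  by rewrite -(nth_index setT (CX g)) E nth_index//; exact: CX.
have /choice[rp rpE] (i : 'I_(subgroup_index N)) : exists g, idx g = i.
  have : nth setT (enum_fset X) i \in X by apply: mem_nth; exact: (ltn_ord i).
  rewrite in_fset_set// in_setE => -[g _ gE].
  exists g; apply/val_inj => /=; rewrite -/(C g) in gE; rewrite gE index_uniq//.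
  exact: fset_uniq.
by exists idx, rp.
Qed.

End cosets.

Section periodic.
Variables (R : realType) (G : groupType) (f : group_ring G) (N : set G).
Hypothesis N_normal : normal_subgroup N.
Variables (d : nat) (idx : G -> 'I_d) (rp : 'I_d -> G).
Hypothesis idxP : coset_numbering N idx rp.

Lemma idx_mull g h h' : idx h = idx h' -> idx (g * h)%g = idx (g * h')%g.
Proof. by rewrite !idxP.1 invgM -mulgA mulKg. Qed.

Lemma idx_mulr g g' h : idx g = idx g' -> idx (g * h)%g = idx (g' * h)%g.
Proof.
rewrite !idxP.1 => Ngg'; rewrite invgM -mulgA (mulgA g^-1)%g -conjgE; exact: normalJ.
Qed.

Lemma idx_rp g : idx (rp (idx g)) = idx g.
Proof. exact: idxP.2. Qed.

Definition periodic (v : 'cV[R]_d) (g : G) : R := v (idx g) 0.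

Definition conv_mx : 'M[int]_d :=
  \matrix_(i, j) \sum_(h <- finsupp f | idx (rp i * h)%g == j) f h.
Definition conv_mxR : 'M[R]_d := map_mx intr conv_mx.

Lemma rho_periodic v g : rho R f (periodic v) g = (conv_mxR *m v) (idx g) 0.
Proof.
rewrite rhoE mxE; under [RHS]eq_bigr => j _.
  rewrite !mxE rmorph_sum big_distrl /= big_mkcond /=; over.
rewrite exchange_big /=; apply: eq_bigr => h _.
rewrite -big_mkcond /= (big_pred1 (idx (rp (idx g) * h)%g)) => [|j]; last exact: eq_sym.
by rewrite mulrC /periodic; congr (_ * v _ 0); apply: idx_mulr; rewrite idx_rp.
Qed.

(** The conclusion of [rho_locality] at 1/2. It is used on functions whose value at 1 has modulus 1,
    where any bound below 1 is a contradiction. *)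
Definition local_bound (E : {fset G}) (dl : R) := 0 < dl /\
  forall w : G -> R, (forall g, `|w g| <= 1) ->
    (forall g, g \in E -> `|rho R f w g| <= dl) -> `|w 1%g| <= 1 / 2.

Variables (E : {fset G}) (dl : R).
Hypothesis locE : local_bound E dl.

(** A coordinate of largest modulus is moved to the identity and normalised. If rho were below [dl]
    times this maximum everywhere, [locE] would give 1 <= 1/2. So the inverse has sup norm at most 1
    / dl, whatever [N] is. *)
Lemma periodic_le (v : 'cV[R]_d) (M : R) :
  (forall i, `|(conv_mxR *m v) i 0| <= M) -> forall i, `|v i 0| <= M / dl.
Proof.
have [dl0 loc] := locE; move=> vM i; rewrite ler_pdivlMr//.
case: (@Order.TotalTheory.arg_maxP _ R _ i xpredT (fun j => `|v j 0|) erefl) => i0 _ vmax.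
have [m0|m0] := eqVneq `|v i0 0| 0.
  apply: le_trans (vM i); have -> : `|v i 0| = 0 by apply/eqP;
    rewrite eq_le normr_ge0 andbT -m0; exact: vmax.
  by rewrite mul0r.
have {}m0 : 0 < `|v i0 0| by rewrite lt_def m0 normr_ge0.
apply: (@le_trans _ _ (`|v i0 0| * dl)); first by rewrite ler_pM2r//; exact: vmax.
rewrite leNgt; apply/negP => Mlt.
pose w g := `|v i0 0|^-1 * periodic v (rp i0 * g)%g.
have wE g : rho R f w g = `|v i0 0|^-1 * rho R f (periodic v) (rp i0 * g)%g.
  by rewrite rhoZ !rhoE; congr (_ * _); apply: eq_bigr => h _; rewrite mulgA.
have : `|w 1%g| <= 1 / 2.
  apply: loc => [g|g _].
    by rewrite normrM normfV normr_id ler_pdivrMl// mulr1; exact: vmax.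
  rewrite wE rho_periodic normrM normfV normr_id ler_pdivrMl//.
  by apply: le_trans (vM _) _; exact: ltW.
rewrite /w mulg1 /periodic idxP.2 normrM normfV normr_id mulVf ?gt_eqF//; lra.
Qed.

Lemma det_conv_mx_neq0 : \det conv_mx != 0.
Proof.
rewrite -(intr_eq0 R) -det_map_mx -det_tr; apply/det0P => -[v v0 /(congr1 trmx)].
rewrite trmx_mul trmxK trmx0 => Bv; case/eqP: v0; apply/rowP => i.
have := @periodic_le v^T 0 _ i; rewrite mul0r !mxE normr_le0 => H; apply/eqP; apply: H => j.
by rewrite [X in X *m _]/(conv_mxR) Bv mxE normr0.
Qed.

Lemma conv_mxR_unit : conv_mxR \in unitmx.
Proof. by rewrite unitmxE det_map_mx unitfE intr_eq0 det_conv_mx_neq0. Qed.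

Definition fundamental : 'cV[R]_d := invmx conv_mxR *m \col_i (i == idx 1%g)%:R.

Lemma rho_fundamental g : rho R f (periodic fundamental) g = (idx g == idx 1%g)%:R.
Proof. by rewrite rho_periodic mulKVmx ?conv_mxR_unit// mxE. Qed.

(** Translates of the fundamental solution by the coset representatives; this is the inverse of
    [conv_mxR]. *)
Definition fundamental_mx : 'M[R]_d := \matrix_(i, j) periodic fundamental ((rp j)^-1 * rp i)%g.

Lemma mul_fundamental_mx : conv_mxR *m fundamental_mx = 1%:M.
Proof.
apply/matrixP => i j; rewrite !mxE.
have -> : (i == j)%:R = rho R f (periodic fundamental) ((rp j)^-1 * rp i)%g.
  rewrite rho_fundamental; congr (_%:R); congr nat_of_bool; apply/eqP/eqP => [->|];
    first by rewrite mulVg.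
  by move/(idx_mull (rp j)); rewrite mulVKg mulg1 !idxP.2.
have -> : rho R f (periodic fundamental) ((rp j)^-1 * rp i)%g =
    rho R f (periodic (col j fundamental_mx)) (rp i).
  rewrite !rhoE; apply: eq_bigr => h _; congr (_ * _).
  rewrite {2}/periodic !mxE /periodic; congr (fundamental _ _).
  by rewrite -mulgA; apply: idx_mull; rewrite idx_rp.
rewrite rho_periodic idxP.2 mxE; apply: eq_bigr => k _.
by rewrite !mxE.
Qed.

(** For fixed [i], the coset of (rp j)^-1 rp i runs once through all cosets as j varies, by
    normality. A row is thus a rearrangement of [fundamental]. *)
Lemma sum_row_fundamental i : \sum_j `|fundamental_mx i j| = \sum_k `|fundamental k 0|.
Proof.
rewrite [RHS](reindex (fun j => idx ((rp j)^-1 * rp i)%g)) /=.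
  by apply: eq_bigr => j _; rewrite mxE.
apply: onW_bij; apply: injF_bij => j j' /(idx_mulr (rp i)^-1%g).
rewrite !mulgK => /idxP.1; rewrite invgK => /(@normalJ _ _ N_normal _ (rp j')).
by rewrite conjgE mulgVK => /idxP.1; rewrite !idxP.2.
Qed.

Lemma sum_col_fundamental j : \sum_i `|fundamental_mx i j| = \sum_k `|fundamental k 0|.
Proof.
rewrite [RHS](reindex (fun i => idx ((rp j)^-1 * rp i)%g)) /=.
  by apply: eq_bigr => i _; rewrite mxE.
apply: onW_bij; apply: injF_bij => i i' /(idx_mull (rp j)).
by rewrite !mulVKg !idxP.2.
Qed.

(** Duality: tested on the sign vector of a row, the sup norm bound for the inverse becomes an l^1
    bound for this row. *)
Lemma sum_fundamental_le : \sum_k `|fundamental k 0| <= dl^-1.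
Proof.
rewrite -(sum_row_fundamental (idx 1%g)); set i := idx _.
pose v : 'cV[R]_d := \col_j Num.sg (fundamental_mx i j).
have -> : \sum_j `|fundamental_mx i j| = (fundamental_mx *m v) i 0.
  by rewrite mxE; apply: eq_bigr => j _; rewrite [v _ _]mxE mulrC -normrEsg.
apply: le_trans (ler_norm _) _; rewrite -[leRHS]mul1r; apply: periodic_le => j.
rewrite mulmxA mul_fundamental_mx mul1mx mxE normr_sg.
by case: (_ != 0).
Qed.

Lemma sums_bounded_fundamental : sums_bounded dl^-1 fundamental_mx.
Proof.
by split=> i; rewrite ?sum_row_fundamental ?sum_col_fundamental sum_fundamental_le.
Qed.

Definition norm1 : R := \sum_(h <- finsupp f) `|(f h)%:~R|.

Lemma norm1_ge0 : 0 <= norm1.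
Proof. by rewrite sumr_ge0. Qed.

Lemma sums_bounded_conv : sums_bounded norm1 conv_mxR.
Proof.
have le i j : `|conv_mxR i j| <= \sum_(h <- finsupp f) (if idx (rp i * h)%g == j then `|(f h)%:~R| else 0).
  rewrite !mxE rmorph_sum /= -big_mkcond /=; exact: ler_norm_sum.
split=> [i|j].
  apply: le_trans (ler_sum _ (fun j _ => le i j)) _.
  rewrite exchange_big /=; apply: ler_sum => h _.
  by rewrite -big_mkcond /= (big_pred1 (idx (rp i * h)%g)) => [//|k]; exact: eq_sym.
apply: le_trans (ler_sum _ (fun i _ => le i j)) _.
rewrite exchange_big /=; apply: ler_sum => h _.
rewrite -big_mkcond /= (big_pred1 (idx (rp j * h^-1)%g)) => [//|i].
apply/eqP/eqP => [<-|->].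
  by rewrite -[LHS]idxP.2 -[in LHS](mulgK h (rp i)); apply: idx_mulr; rewrite idx_rp.
rewrite -[RHS]idxP.2 -[in RHS](mulgVK h (rp j)); apply: idx_mulr; by rewrite idx_rp.
Qed.

Lemma form_bounded_conv : form_bounded (dl ^+ 2) (norm1 ^+ 2) (conv_mxR *m conv_mxR^T).
Proof.
have [dl0 _] := locE.
rewrite -[dl]invrK exprVn; apply: form_bounded_gram mul_fundamental_mx.
- exact: norm1_ge0.
- by rewrite invr_gt0.
- exact: sums_bounded_conv.
- exact: sums_bounded_fundamental.
Qed.

End periodic.

(** * A summable fundamental solution *)

Section fundamental_solution.
Variables (R : realType) (G : groupType) (f : group_ring G).
Variable (Gamma : nat -> set G).
Hypothesis Gamma_normal : forall n, normal_subgroup (Gamma n).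
Hypothesis Gamma_fin : forall n, finite_index (Gamma n).
Hypothesis Gamma_triv : tends_to_trivial Gamma.

Lemma eventually_separated (A : {fset G}) :
  exists n0, forall n g h, (n0 <= n)%N -> g \in A -> h \in A -> Gamma n (g^-1 * h)%g -> g = h.
Proof.
(* [tends_to_trivial] speaks of nonempty sets, so the empty set is treated apart. *)
have [K0|/set0P K0] := eqVneq [set` A] set0.
  by exists 0%N => n g h _ gA; have : [set` A] g by []; rewrite K0.
have [n0 n0P] := Gamma_triv (finite_fset A) K0.
exists n0 => n g h n0n gA hA Ngh.
have : (Gamma n `&` [set (g^-1 * h)%g | g in [set` A] & h in [set` A]]) (g^-1 * h)%g.
  by split=> //; exists g => //; exists h.
by rewrite n0P//= => /(congr1 (fun k => g * k)%g); rewrite mulVKg mulg1.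
Qed.

(* The solution is an ultralimit of the [Gamma n]-periodic ones, whose l^1 norms
   on the quotients are bounded by the norms of the inverses of [conv_mxR]. *)
Lemma exists_fundamental_solution (E : {fset G}) (dl : R) : local_bound f E dl ->
  exists u : G -> R, (forall g, rho R f u g = (g == 1%g)%:R) /\
    forall A : {fset G}, \sum_(h <- A) `|u h| <= dl^-1.
Proof.
move=> locE; have dl0 := locE.1.
have numb n := exists_coset_numbering (Gamma_normal n) (Gamma_fin n).
pose idx n := projT1 (cid (numb n)); pose rp n := projT1 (cid (projT2 (cid (numb n)))).
have idxP n : coset_numbering (Gamma n) (idx n) (rp n) := projT2 (cid (projT2 (cid (numb n)))).
pose w n := periodic (idx n) (fundamental R f (idx n) (rp n)).
have w_sum n (A : {fset G}) : {in A &, injective (idx n)} -> \sum_(h <- A) `|w n h| <= dl^-1.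
  move=> inj; apply: le_trans (sum_fundamental_le (Gamma_normal n) (idxP n) locE).
  rewrite -(big_map (idx n) xpredT (fun k => `|fundamental R f (idx n) (rp n) k 0|)).
  rewrite [leRHS](bigID [in [seq idx n h | h <- A]]) /= -[leLHS]addr0 lerD ?sumr_ge0//.
  rewrite -big_uniq//= map_inj_in_uniq ?fset_uniq//.
have w_le n g : `|w n g| <= dl^-1.
  have := w_sum n [fset g]%fset; rewrite big_seq_fset1; apply=> x y.
  by rewrite !inE => /eqP -> /eqP ->.
have [U [UU ooU]] := nat_ultrafilter.
have [l [l2 wl]] := ultralimit UU w_le.
exists l; split=> [g|A].
  have [n0 n0P] := eventually_separated [fset g; 1%g]%fset.
  apply/eqP; rewrite -subr_eq0 -normr_le0.
  apply: (@cvg_norm_le _ U _ (fun n => rho R f (w n) g - (g == 1%g)%:R)).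
    by apply: cvgB; [exact: rho_cvg|exact: cvg_cst].
  apply: ooU; exists n0 => // n /= n0n.
  rewrite (rho_fundamental (Gamma_normal n) (idxP n) locE) (_ : _ == _ = (g == 1%g)) ?subrr ?normr0//.
  apply/eqP/eqP => [/(idxP n).1 Ng|->//]; apply: (n0P n) Ng => //; by rewrite !inE eqxx ?orbT.
have [n0 n0P] := eventually_separated A.
rewrite -[leLHS]ger0_norm ?sumr_ge0//.
apply: (@cvg_norm_le _ U _ (fun n => \sum_(h <- A) `|w n h|)).
  apply: cvg_big => //; first exact: add_continuous.
  by move=> h _; exact: cvg_norm.
apply: ooU; exists n0 => // n /= n0n; rewrite ger0_norm ?sumr_ge0//; apply: w_sum.
by move=> g h gA hA /(idxP n).1; exact: n0P.
Qed.

End fundamental_solution.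

Lemma counting_image (R : realType) (I : eqType) (T : choiceType) (s : seq I) (F : I -> T) :
  uniq s -> {in s &, injective F} ->
  counting [set F i | i in [set i | i \in s]] = (size s)%:R%:E :> \bar R.
Proof.
move=> s_uniq F_inj; have -> : [set F i | i in [set i | i \in s]] = [set` [fset x in map F s]%fset].
  apply/seteqP; split=> x /=; rewrite in_fset.
    by move=> [i iS <-]; exact: map_f.
  by move=> /mapP[i iS ->]; exists i.
rewrite /counting asboolT; last exact: finite_fset.
by rewrite set_fsetK card_fseq undup_id ?size_map// map_inj_in_uniq.
Qed.

Section determinant.
Variables (R : realType) (V : lmodType R).

Lemma basis_sum_inj (W : set V) n (e : 'I_n -> V) m (A B : 'M[R]_(n, m)) :
  is_basis W e -> (forall j, \sum_i A i j *: e i = \sum_i B i j *: e i) -> A = B.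
Proof.
move=> [e_free _] AB; apply/matrixP => i j; apply/eqP; rewrite -subr_eq0; apply/eqP.
apply: (e_free (fun i => A i j - B i j)); under eq_bigr do rewrite scalerBl.
by rewrite sumrB AB subrr.
Qed.

Lemma basis_sum_mul n m k (e : 'I_n -> V) (A : 'M[R]_(n, m)) (B : 'M[R]_(m, k)) j :
  \sum_l B l j *: (\sum_i A i l *: e i) = \sum_i (A *m B) i j *: e i.
Proof.
under eq_bigr do rewrite scaler_sumr.
rewrite exchange_big; apply: eq_bigr => i _ /=; rewrite mxE scaler_suml.
by apply: eq_bigr => l _; rewrite scalerA mulrC.
Qed.

Lemma basis_change (W : set V) n (e : 'I_n -> V) m (e' : 'I_m -> V) :
  is_basis W e -> is_basis W e' -> exists P : 'M[R]_(n, m), forall j,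
    e' j = \sum_i P i j *: e i.
Proof.
move=> [_ We] [_ We'].
have /choice[c cE] j : exists c : 'I_n -> R, e' j = \sum_i c i *: e i.
  have : W (e' j).
    rewrite We'; exists (fun i => (i == j)%:R) => //.
    rewrite (bigD1 j)//= eqxx scale1r big1 ?addr0// => i /negbTE ->; exact: scale0r.
  by rewrite We => -[c _ <-]; exists c.
by exists (\matrix_(i, j) c j i) => j; rewrite cE; apply: eq_bigr => i _; rewrite mxE.
Qed.

(** [det_on] reads the matrix M' of an unspecified basis. The base change P has inverse Q on both
    sides, hence is square, and M P = P M'. *)
Lemma det_onE (W : set V) (phi : {linear V -> V}) n (e : 'I_n -> V) (M : 'M[R]_n) :
  is_basis W e -> (forall j, phi (e j) = \sum_i M i j *: e i) -> det_on W phi = \det M.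
Proof.
move=> be phiM; rewrite /det_on.
case: xgetP => [d -> [m [e' [M' [be' phiM' ->]]]]|/(_ (\det M))[]]; last by exists n, e, M.
have [P PE] := basis_change be be'; have [Q QE] := basis_change be' be.
have PQ : P *m Q = 1%:M.
  apply: (basis_sum_inj be) => j; rewrite -basis_sum_mul.
  under eq_bigr do rewrite -PE. rewrite -QE (bigD1 j)//= mxE eqxx scale1r big1 ?addr0// => i ij.
  by rewrite mxE (negbTE ij) scale0r.
have QP : Q *m P = 1%:M.
  apply: (basis_sum_inj be') => j; rewrite -basis_sum_mul.
  under eq_bigr do rewrite -QE. rewrite -PE (bigD1 j)//= mxE eqxx scale1r big1 ?addr0// => i ij.
  by rewrite mxE (negbTE ij) scale0r.
have nm : n = m.
  apply/eqP; rewrite eqn_leq; apply/andP; split.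
    by rewrite -[X in (X <= _)%N](mxrank1 R) -PQ;
      apply: leq_trans (mxrankM_maxl _ _) (rank_leq_col _).
  by rewrite -[X in (X <= _)%N](mxrank1 R) -QP;
    apply: leq_trans (mxrankM_maxl _ _) (rank_leq_col _).
subst m.
have MP : M *m P = P *m M'.
  apply: (basis_sum_inj be) => j; rewrite -!basis_sum_mul.
  under eq_bigr do rewrite -phiM. under [RHS]eq_bigr do rewrite -PE.
  rewrite -phiM' PE linear_sum; by apply: eq_bigr => i _; rewrite linearZ.
have Pu : P \in unitmx by have [] := mulmx1_unit PQ.
apply: (mulfI (_ : \det P != 0)); first by rewrite -unitfE -unitmxE.
by rewrite -det_mulmx -MP det_mulmx mulrC.
Qed.

End determinant.

Section finite_level.
Variables (R : realType) (G : groupType) (f : group_ring G) (N : set G).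
Hypothesis N_normal : normal_subgroup N.
Variables (d : nat) (idx : G -> 'I_d) (rp : 'I_d -> G).
Hypothesis idxP : coset_numbering N idx rp.
Hypothesis det_neq0 : \det (conv_mx f idx rp) != 0.
Local Notation B := (conv_mx f idx rp).
Local Notation BR := (conv_mxR R f idx rp).
Local Notation tc := (@to_circle R).

(** Invariance is under left translations by [N], while [idx] numbers the cosets g N; conjugation
    passes from one to the other. *)
Lemma invariant_rp (T : Type) (w : G -> T) :
  (forall g h, N g -> w (g^-1 * h)%g = w h) -> forall g, w g = w (rp (idx g)).
Proof.
move=> wN g; have /idxP.1 Ng : idx (rp (idx g)) = idx g by exact: idxP.2.
have /(wN _ g) <- := @normalJ _ _ N_normal _ (rp (idx g))^-1%g Ng.
by rewrite conjgE invgK -mulgA mulVKg invgM invgK mulgVK.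
Qed.

Lemma idx_invariant g h : N g -> idx (g^-1 * h)%g = idx h.
Proof.
move=> Ng; apply/idxP.1; rewrite invgM invgK -mulgA -conjgE; exact: normalJ.
Qed.

Lemma LinfE : Linf R N = [set periodic idx v | v in [set: 'cV[R]_d]].
Proof.
apply/seteqP; split=> [w [_ wN]|_ [v _ <-]].
  have wN' g h : N g -> w (g^-1 * h)%g = w h by move=> /wN/(congr1 (fun w => w h)).
  exists (\col_i w (rp i)) => //; apply/funext => g.
  by rewrite /periodic mxE -(invariant_rp wN').
split.
  exists (\sum_i `|v i 0|); split; first exact: num_real.
  move=> x vx g _; apply: le_trans (ltW vx).
  by rewrite /periodic (bigD1 (idx g))//= lerDl sumr_ge0.
by move=> g Ng; apply/funext => h; rewrite /lambda /periodic idx_invariant.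
Qed.

Definition int_periodic (v : 'cV[int]_d) : G -> R^o := periodic idx (map_mx intr v).

Lemma LinfZE : LinfZ R N = [set int_periodic v | v in [set: 'cV[int]_d]].
Proof.
apply/seteqP; split=> [w [+ w_int]|_ [v _ <-]].
  rewrite LinfE => -[v _ vw]; have /choice[c cE] i : exists m, v i 0 = m%:~R.
    by apply/intrP; have := w_int (rp i); rewrite -vw /periodic idxP.2.
  exists (\col_i c i) => //; rewrite -vw; apply/funext => g.
  by rewrite /int_periodic /periodic !mxE cE.
split; first by rewrite LinfE; exists (map_mx intr v).
by move=> g; rewrite /int_periodic /periodic mxE; exact: intr_int.
Qed.

Lemma rho_int_periodic v : rho R f (int_periodic v) = int_periodic (B *m v).
Proof.
by apply/funext => g; rewrite (rho_periodic f N_normal idxP) /int_periodic /periodic map_mxM.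
Qed.

Lemma int_periodic_inj : injective int_periodic.
Proof.
move=> v v' vv'; apply/colP => i; have := congr1 (fun w => w (rp i)) vv'.
by rewrite /int_periodic /periodic idxP.2 !mxE => /intr_inj.
Qed.

Lemma int_periodicD v v' : int_periodic (v + v') = int_periodic v + int_periodic v'.
Proof. by apply/funext => g; rewrite /int_periodic /periodic map_mxD mxE. Qed.

(** [int_periodic] identifies the integral periodic functions with Z^d and rho with B, so the
    quotient is Z^d modulo the lattice of B. *)
Lemma counting_quotient :
  counting (quotient_set (LinfZ R N) (rho R f @` LinfZ R N)) = (`|\det B|%N)%:R%:E :> \bar R.
Proof.
have [s [s_uniq sD s_ex s_inj]] := lattice_representatives det_neq0.
pose F v := [set int_periodic v + b | b in rho R f @` LinfZ R N].
have FE v v' k : v - v' = B *m k -> F v `<=` F v'.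
  move=> vv' _ [b0 [w + <-] <-]; rewrite {1}LinfZE => -[l _ <-].
  exists (rho R f (int_periodic (k + l))).
    by exists (int_periodic (k + l)) => //; rewrite LinfZE; exists (k + l).
  rewrite !rho_int_periodic -!int_periodicD mulmxDr -vv'; congr int_periodic.
  by rewrite addrA [v' + _]addrC subrK.
have FP v v' : F v = F v' <-> exists k, v - v' = B *m k.
  split=> [FF|[k kE]].
    have : F v (int_periodic v).
      exists (int_periodic 0).
        exists (int_periodic 0); rewrite ?rho_int_periodic ?mulmx0//.
        by rewrite LinfZE; exists 0.
      by rewrite -int_periodicD addr0.
    rewrite FF => -[b [w + <-] bE]; rewrite {1}LinfZE => -[k _ kE].
    move: bE; rewrite -kE rho_int_periodic -int_periodicD => /int_periodic_inj <-.
    by exists k; rewrite addrC addKr.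
  apply/seteqP; split; first exact: FE kE.
  by apply: (FE _ _ (- k)); rewrite mulmxN -kE opprB.
rewrite -sD -(@counting_image _ _ _ s F)//; last first.
  by move=> r r' rs r's /FP[k rk]; exact: s_inj rk.
congr counting; apply/seteqP; split=> [_ [a aZ <-]|_ [r _ <-]].
  move: aZ; rewrite {1}LinfZE => -[v _ <-]; have [r rs [k rk]] := s_ex v.
  have /FP rv : exists k, r - v = B *m k by exists (- k); rewrite mulmxN -rk opprB.
  by exists r.
by exists (int_periodic r) => //; rewrite LinfZE; exists r.
Qed.

Lemma conv_mxR_unitmx : BR \in unitmx.
Proof. by rewrite unitmxE det_map_mx unitfE intr_eq0. Qed.

(** The fixed points form B^-1 Z^d modulo Z^d: a fixed point has a periodic lift v, the vector B v
    is integral, and its class modulo B Z^d determines the point. *)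
Lemma counting_Fix : counting (Fix R f N) = (`|\det B|%N)%:R%:E :> \bar R.
Proof.
have [s [s_uniq sD s_ex s_inj]] := lattice_representatives det_neq0.
pose w (r : 'cV[int]_d) := periodic idx (invmx BR *m map_mx intr r).
have wE r g : rho R f (w r) g = (r (idx g) 0)%:~R.
  by rewrite (rho_periodic f N_normal idxP) mulKVmx ?conv_mxR_unitmx// mxE.
have w_int r g : rho R f (w r) g \is a Num.int by rewrite wE; exact: intr_int.
pose F r := point_of (w_int r).
have Fl r : lifts (w r) (F r) by [].
have wB r r' k : r - r' = B *m k -> F r = F r'.
  move=> rr'; apply/val_inj/funext => g; apply/to_circle_eq.
  have -> : w r g - w r' g = periodic idx (invmx BR *m map_mx intr (r - r')) g.
    by rewrite map_mxB mulmxBr /w /periodic [RHS]mxE [X in _ = _ + X]mxE.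
  by rewrite rr' map_mxM mulKmx ?conv_mxR_unitmx// /periodic mxE; exact: intr_int.
have F_inj : {in s &, injective F}.
  move=> r r' rs r's FF.
  have /choice[k kE] i : exists m, w r (rp i) - w r' (rp i) = m%:~R.
    apply/intrP; apply/to_circle_eq;
      have : \val (F r) (rp i) = \val (F r') (rp i) by rewrite FF.
    exact.
  apply: (s_inj r r' (\col_i k i)) => //.
  have E1 : invmx BR *m map_mx intr (r - r') = map_mx intr (\col_i k i).
    apply/colP => i; rewrite map_mxB mulmxBr [RHS]mxE [X in _ = X%:~R]mxE -kE.
    by rewrite /w /periodic idxP.2 [LHS]mxE [X in _ + X = _]mxE.
  have E2 : map_mx intr (r - r') = map_mx intr (B *m \col_i k i) :> 'cV[R]_d.
    by rewrite map_mxM -E1 mulKVmx// conv_mxR_unitmx.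
  apply/colP => i; apply: (@intr_inj R); have := congr1 (fun v : 'cV[R]_d => v i 0) E2.
  by rewrite mxE [RHS]mxE.
rewrite -sD -(@counting_image _ _ _ s F)//.
congr counting; apply/seteqP; split=> [x xF|_ [r _ <-]]; last first.
  by move=> g Ng; apply/val_inj/funext => h /=; rewrite /w /periodic idx_invariant.
have xN g h : N g -> \val x (g^-1 * h)%g = \val x h by move=> /xF/(congr1 val) {2}<-.
have /choice[v vE] i : exists r, tc r = \val x (rp i).
  by have [r []] := to_circle_lift 0 (\val x (rp i)); exists r.
have vx : lifts (periodic idx (\col_i v i)) x.
  by move=> g; rewrite (invariant_rp xN) -vE /periodic mxE.
have /choice[p pE] i : exists m, (BR *m (\col_i v i)) i 0 = m%:~R.
  by apply/intrP; have := lifts_int vx (rp i); rewrite (rho_periodic f N_normal idxP) idxP.2.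
have [r rs [k rk]] := s_ex (\col_i p i).
exists r => //; rewrite -(wB _ _ _ rk); apply: lifts_inj (Fl _) _.
suff -> : w (\col_i p i) = periodic idx (\col_i v i) by [].
rewrite /w; congr periodic; have -> : map_mx intr (\col_i p i) = BR *m (\col_i v i).
  by apply/colP => i; rewrite [LHS]mxE mxE pE.
by rewrite mulKmx ?conv_mxR_unitmx.
Qed.

Lemma rho_linear : linear (rho R f).
Proof.
move=> c w w'; apply/funext => g; rewrite [LHS]rhoE /=.
have -> : (c *: rho R f w + rho R f w') g = c * rho R f w g + rho R f w' g by [].
rewrite !rhoE big_distrr -big_split /=; apply: eq_bigr => h _.
by rewrite mulrA -mulrDl.
Qed.

HB.instance Definition _ := GRing.isLinear.Build R (G -> R^o) (G -> R^o) _ (rho R f) rho_linear.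

Lemma det_on_conv : det_on (Linf R N) (rho R f) = (\det B)%:~R.
Proof.
pose e (i : 'I_d) : G -> R^o := periodic idx (delta_mx i 0).
have sumE (c : 'I_d -> R) : \sum_i c i *: e i = periodic idx (\col_i c i) :> (G -> R^o).
  apply/funext => g; rewrite fct_sumE (bigD1 (idx g))//= big1 ?addr0 => [|i ig].
    rewrite /e /periodic mxE; change (c (idx g) * (delta_mx (idx g) 0 : 'cV[R]_d) (idx g) 0 = c (idx g)).
    by rewrite mxE !eqxx mulr1.
  rewrite /e /periodic; change (c i * (delta_mx i 0 : 'cV[R]_d) (idx g) 0 = 0).
  by rewrite mxE eq_sym (negbTE ig) mulr0.
rewrite -det_map_mx -/BR; apply: (det_onE (e := e)).
  split=> [c|].
    rewrite sumE => c0 i; have := congr1 (fun w => w (rp i)) c0.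
    by rewrite /periodic idxP.2 mxE.
  rewrite LinfE; apply/seteqP; split=> [_ [v _ <-]|_ [c _ <-]].
    by exists (fun i => v i 0) => //; rewrite sumE; congr periodic; apply/colP => i;
      rewrite mxE.
  by rewrite sumE; exists (\col_i c i).
move=> j; rewrite sumE; apply/funext => g;
  rewrite [LHS](rho_periodic f N_normal idxP) /periodic.
by rewrite -colE !mxE.
Qed.

End finite_level.

(** * Asymptotics of determinants *)

Section moments.
Variables (R : realType) (G : groupType) (f : group_ring G).
Implicit Types w : G -> R.
Local Notation kappa := (norm1 R f).

(** The adjoint of rho_f for the l^2 pairing, so that [rho_sq] matches the Gram matrices B B^T. *)
Definition rho_adj w : G -> R := fun g => \sum_(h <- finsupp f) w (g * h^-1)%g * (f h)%:~R.
Definition rho_sq w : G -> R := rho R f (rho_adj w).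

Lemma rho_bound w (C : R) : (forall g, `|w g| <= C) -> forall g, `|rho R f w g| <= kappa * C.
Proof.
move=> wC g; rewrite rhoE; apply: le_trans (ler_norm_sum _ _ _) _.
rewrite big_distrl /=; apply: ler_sum => h _; rewrite normrM mulrC ler_wpM2l//.
Qed.

Lemma rho_adj_bound w (C : R) : (forall g, `|w g| <= C) ->
  forall g, `|rho_adj w g| <= kappa * C.
Proof.
move=> wC g; apply: le_trans (ler_norm_sum _ _ _) _.
rewrite big_distrl /=; apply: ler_sum => h _; rewrite normrM mulrC ler_wpM2l//.
Qed.

Lemma iter_rho_sq_bound j w : (forall g, `|w g| <= 1) ->
  forall g, `|iter j rho_sq w g| <= (kappa ^+ 2) ^+ j.
Proof.
move=> w1; elim: j => [|j IHj] g; first by rewrite expr0.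
by rewrite iterS exprS expr2 -mulrA; apply: rho_bound => h; exact: rho_adj_bound.
Qed.

Lemma rho_sqE w g : rho_sq w g =
  \sum_(h <- finsupp f) (\sum_(k <- finsupp f) w (g * (h * k^-1))%g * (f k)%:~R) * (f h)%:~R.
Proof.
rewrite /rho_sq rhoE; apply: eq_bigr => h _; congr (_ * _).
by apply: eq_bigr => k _; rewrite mulgA.
Qed.

(** The quotients h k^-1 contain the support of f f^*; adding 1 makes the sets [range_ j] increase
    with [j]. *)
Definition range1 : seq G := 1%g :: [seq (h * k^-1)%g | h <- finsupp f, k <- finsupp f].

Fixpoint range_ (j : nat) : seq G :=
  if j is j'.+1 then [seq (a * b)%g | a <- range1, b <- range_ j'] else [:: 1%g].

Lemma rho_sq_local w w' g :
  (forall e, e \in range1 -> w (g * e)%g = w' (g * e)%g) -> rho_sq w g = rho_sq w' g.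
Proof.
move=> ww'; rewrite !rho_sqE; apply: eq_big_seq => h hf; congr (_ * _).
by apply: eq_big_seq => k kf; rewrite ww'// inE; apply/orP; right; apply/allpairsP;
  exists (h, k).
Qed.

Lemma iter_rho_sq_local j w w' g :
  (forall e, e \in range_ j -> w (g * e)%g = w' (g * e)%g) ->
  iter j rho_sq w g = iter j rho_sq w' g.
Proof.
elim: j g => [|j IHj] g ww'; first by have := ww' 1%g; rewrite mulg1 inE; apply.
rewrite !iterS; apply: rho_sq_local => e ef; apply: IHj => e' e'f.
by rewrite -mulgA; apply: ww'; apply/allpairsP; exists (e, e').
Qed.

Lemma iter_rho_sq_shift j w g k :
  iter j rho_sq (fun h => w (g * h)%g) k = iter j rho_sq w (g * k)%g.
Proof.
elim: j k => [//|j IHj] k; rewrite !iterS !rho_sqE; apply: eq_bigr => h _.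
by congr (_ * _); apply: eq_bigr => l _; rewrite IHj mulgA.
Qed.

Definition moment j : R := iter j rho_sq (fun g => (g == 1%g)%:R) 1%g.

Lemma moment_bound j : `|moment j| <= (kappa ^+ 2) ^+ j.
Proof. by apply: iter_rho_sq_bound => g; case: (_ == _); rewrite ?normr1 ?normr0. Qed.

Lemma mulmx_delta n (A : 'M[R]_n) i k : A i k = (A *m delta_mx k 0 : 'cV_n) i 0.
Proof. by rewrite -colE mxE. Qed.

Section periodic_moment.
Variable N : set G.
Hypothesis N_normal : normal_subgroup N.
Variables (d : nat) (idx : G -> 'I_d) (rp : 'I_d -> G).
Hypothesis idxP : coset_numbering N idx rp.
Local Notation BR := (conv_mxR R f idx rp).

Lemma rho_adj_periodic (v : 'cV[R]_d) : rho_adj (periodic idx v) = periodic idx (BR^T *m v).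
Proof.
apply/funext => g; rewrite /periodic [RHS]mxE; under [RHS]eq_bigr => j _.
  rewrite !mxE rmorph_sum big_distrl /= big_mkcond /=; over.
rewrite exchange_big /=; apply: eq_bigr => h _.
rewrite -big_mkcond /= (big_pred1 (idx (g * h^-1)%g)) => [|i]; first by rewrite mulrC.
apply/eqP/eqP => [ig|->].
  by rewrite -(idxP.2 i) -[in LHS](mulgK h (rp i)); apply: (idx_mulr N_normal idxP).
by rewrite -[in RHS](mulgVK h g); apply: (idx_mulr N_normal idxP); rewrite idxP.2.
Qed.

Lemma iter_rho_sq_periodic j (v : 'cV[R]_d) :
  iter j rho_sq (periodic idx v) = periodic idx ((BR *m BR^T) ^+ j *m v).
Proof.
elim: j => [|j IHj]; first by rewrite expr0 mul1mx.
have -> : (BR *m BR^T) ^+ j.+1 = BR *m BR^T *m (BR *m BR^T) ^+ j by rewrite exprS.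
rewrite iterS IHj /rho_sq rho_adj_periodic.
by apply/funext => g; rewrite (rho_periodic f N_normal idxP) -!mulmxA.
Qed.

(** When [N] meets [range_ j] at most in 1, the delta function and its periodisation agree wherever
    the j-th iterate looks, so every diagonal entry is the moment. *)
Lemma trace_periodic j : (forall g, g \in range_ j -> N g -> g = 1%g) ->
  \tr ((BR *m BR^T) ^+ j) = d%:R * moment j.
Proof.
move=> Nj; rewrite /mxtrace (eq_bigr (fun=> moment j)) => [|i _].
  by rewrite sumr_const card_ord mulr_natl.
rewrite mulmx_delta -[in X in _ X 0](idxP.2 i) -/(periodic idx _ (rp i)) -iter_rho_sq_periodic.
rewrite -[rp i]mulg1 -iter_rho_sq_shift /moment; apply: iter_rho_sq_local => e ej.
rewrite mul1g /periodic mxE eqxx andbT; congr (_%:R); congr nat_of_bool.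
apply/eqP/eqP => [|->]; last by rewrite mulg1 idxP.2.
rewrite -[RHS](idxP.2 i) -[in RHS](mulg1 (rp i)) => /esym/idxP.1.
by rewrite mulg1 mulKg => /Nj; apply.
Qed.

End periodic_moment.

(** * Matrices on finite windows *)

Section window.
Variable W : {fset G}.
Definition thick : {fset G} := (W `|` [fset (g * h)%g | g in W, h in finsupp f])%fset.
Definition elt (A : {fset G}) (i : 'I_(#|` A|)) : G := nth 1%g (enum_fset A) i.
Local Notation d := (#|` W|).
Local Notation m := (#|` thick|).

Lemma elt_in (A : {fset G}) (i : 'I_(#|` A|)) : elt i \in A.
Proof. exact: mem_nth. Qed.

Lemma elt_inj (A : {fset G}) : injective (@elt A).
Proof.
by move=> i k /eqP; rewrite nth_uniq ?fset_uniq// => /eqP; exact: val_inj.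
Qed.

Lemma elt_surj (A : {fset G}) g : g \in A -> exists i : 'I_(#|` A|), elt i = g.
Proof.
move=> gA; have lt : (index g (enum_fset A) < #|` A|)%N by rewrite index_mem.
by exists (Ordinal lt); exact: nth_index.
Qed.

Lemma sum_elt (V : nmodType) (A : {fset G}) (F : G -> V) :
  \sum_(i < #|` A|) F (elt i) = \sum_(x <- A) F x.
Proof. by rewrite (big_nth 1%g) big_mkord. Qed.

Lemma sum_uniq_le (u : G -> R) (C : R) : (forall A : {fset G}, \sum_(h <- A) `|u h| <= C) ->
  forall s : seq G, uniq s -> \sum_(h <- s) `|u h| <= C.
Proof.
move=> uC s s_uniq; rewrite (perm_big [fset x in s]%fset) ?uC//.
by apply: uniq_perm => // x; rewrite in_fset.
Qed.

Lemma sum_coef_le (A : {fset G}) : \sum_(h <- A) `|(f h)%:~R : R| <= kappa.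
Proof.
rewrite (bigID [in finsupp f]) /= [X in _ + X]big1 ?addr0 => [|h /fsfun_dflt ->]; last first.
  by rewrite normr0.
rewrite -big_filter (perm_big [seq h <- finsupp f | h \in A]); last first.
  by apply: uniq_perm; rewrite ?filter_uniq// => h; rewrite !mem_filter andbC.
by rewrite big_filter big_mkcond; apply: ler_sum => h _; case: ifP.
Qed.

Lemma thick_mul g h : g \in W -> h \in finsupp f -> (g * h)%g \in thick.
Proof. by move=> gW hf; rewrite inE; apply/orP; right; apply/imfset2P; exists g => //;
  exists h. Qed.

Definition win_mx : 'M[int]_(d, m) := \matrix_(i, k) f ((elt i)^-1 * elt k)%g.
Definition win_mxR : 'M[R]_(d, m) := map_mx intr win_mx.

(** No row is truncated: each product of an element of [W] with one of the support of f is a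
    column. *)
Lemma win_row (y : G -> R) i : \sum_k win_mxR i k * y (elt k) = rho R f y (elt i).
Proof.
under eq_bigr do rewrite !mxE.
rewrite (sum_elt _ (fun x => (f ((elt i)^-1 * x)%g)%:~R * y x)) rhoE.
rewrite (bigID [in [seq (elt i * h)%g | h <- finsupp f]]) /= [X in _ + X]big1 ?addr0;
  last first.
  move=> x xn; rewrite fsfun_dflt ?mul0r//; apply: contra xn => xf.
  by apply/mapP; exists ((elt i)^-1 * x)%g; rewrite ?mulVKg.
rewrite -big_filter (perm_big [seq (elt i * h)%g | h <- finsupp f]); last first.
  apply: uniq_perm; first exact: filter_uniq (fset_uniq _).
    by rewrite map_inj_uniq ?fset_uniq//; exact: mulgI.
  move=> x; rewrite mem_filter; apply: andb_idr => /mapP[h hf ->].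
  exact: thick_mul (elt_in _) hf.
by rewrite big_map; apply: eq_bigr => h _; rewrite mulKg mulrC.
Qed.

Definition win_ext (v : 'cV[R]_d) (g : G) : R := \sum_i v i 0 * (g == elt i)%:R.

Lemma win_ext_elt v i : win_ext v (elt i) = v i 0.
Proof.
rewrite /win_ext (bigD1 i)//= eqxx mulr1 big1 ?addr0// => k ki.
by rewrite (inj_eq (@elt_inj W)) eq_sym (negbTE ki) mulr0.
Qed.

Lemma rho_adj_win_ext v g : rho_adj (win_ext v) g = \sum_i v i 0 * (f ((elt i)^-1 * g)%g)%:~R.
Proof.
rewrite /rho_adj; under eq_bigr do rewrite big_distrl /=.
rewrite exchange_big; apply: eq_bigr => i _ /=.
under eq_bigr do rewrite -mulrA; rewrite -big_distrr /=; congr (_ * _).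
have eqE h : (g * h^-1 == elt i)%g = (h == (elt i)^-1 * g)%g.
  by apply/eqP/eqP => [<-|->]; rewrite invgM ?invgK ?mulgVK ?mulVKg.
have [hf|hf] := boolP (((elt i)^-1 * g)%g \in finsupp f).
  rewrite (bigD1_seq _ hf) ?fset_uniq//= big1 ?addr0 => [|h hn].
    by rewrite eqE eqxx mul1r.
  by rewrite eqE (negbTE hn) mul0r.
rewrite fsfun_dflt// big_seq big1// => h hs; rewrite eqE.
by case: eqP hs hf => [-> ->//|]; rewrite mul0r.
Qed.

(** The transpose amounts to extension by zero followed by [rho_adj], so the Gram matrix is the
    compression of [rho_sq] to [W]. *)
Lemma win_gramE v i : (win_mxR *m win_mxR^T *m v) i 0 = rho_sq (win_ext v) (elt i).
Proof.
rewrite -mulmxA mxE /rho_sq -win_row; apply: eq_bigr => k _; congr (_ * _).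
by rewrite rho_adj_win_ext mxE; apply: eq_bigr => l _; rewrite !mxE mulrC.
Qed.

Definition deep (j : nat) (g : G) := all (fun e => (g * e)%g \in W) (range_ j).

Lemma range1_1 j : 1%g \in range_ j.
Proof.
elim: j => [|j IHj]; first by rewrite inE.
by apply/allpairsP; exists (1%g, 1%g); rewrite ?mulg1 ?mem_head.
Qed.

(** At points whose j-step range stays inside [W], the compression is not felt. *)
Lemma win_gram_pow j v i : deep j (elt i) ->
  ((win_mxR *m win_mxR^T) ^+ j *m v) i 0 = iter j rho_sq (win_ext v) (elt i).
Proof.
elim: j i => [|j IHj] i di; first by rewrite expr0 mul1mx /= win_ext_elt.
have -> : (win_mxR *m win_mxR^T) ^+ j.+1 = win_mxR *m win_mxR^T *m (win_mxR *m win_mxR^T) ^+ j by rewrite exprS.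
rewrite -mulmxA win_gramE iterS; apply: rho_sq_local => e er.
have dj : deep j (elt i * e)%g.
  apply/allP => e' e'r; rewrite -mulgA; apply: (allP di).
  by apply/allpairsP; exists (e, e').
have /elt_surj[k kE] : (elt i * e)%g \in W.
  by have := allP dj 1%g (range1_1 j); rewrite mulg1.
by rewrite -kE win_ext_elt IHj// kE.
Qed.

Lemma sums_bounded_win : sums_bounded kappa win_mxR.
Proof.
split=> [i|k].
  under eq_bigr do rewrite !mxE.
  rewrite (sum_elt _ (fun x => `|(f ((elt i)^-1 * x)%g)%:~R|)).
  rewrite -(big_map (fun x => (elt i)^-1 * x)%g xpredT (fun x => `|(f x)%:~R|)).
  apply: (sum_uniq_le sum_coef_le); rewrite map_inj_uniq ?fset_uniq//; exact: mulgI.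
under eq_bigr do rewrite !mxE.
rewrite (sum_elt _ (fun x => `|(f (x^-1 * elt k)%g)%:~R|)).
rewrite -(big_map (fun x => x^-1 * elt k)%g xpredT (fun x => `|(f x)%:~R|)).
apply: (sum_uniq_le sum_coef_le); rewrite map_inj_uniq ?fset_uniq// => x y.
by move=> /mulIg/invg_inj.
Qed.

Section inverse.
Variables (u : G -> R) (K : R).
Hypothesis uP : forall g, rho R f u g = (g == 1%g)%:R.
Hypothesis uK : forall A : {fset G}, \sum_(h <- A) `|u h| <= K.

Definition win_inv : 'M[R]_(m, d) := \matrix_(k, i) u ((elt i)^-1 * elt k)%g.

(** The columns are translates of [u] cut off outside the thickening; by [win_row] the cut loses
    nothing. *)
Lemma win_invP : win_mxR *m win_inv = 1%:M.
Proof.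
apply/matrixP => i j; rewrite [LHS]mxE; under eq_bigr do rewrite [win_inv _ _]mxE.
rewrite (win_row (fun x => u ((elt j)^-1 * x)%g)) [RHS]mxE.
have -> : rho R f (fun x => u ((elt j)^-1 * x)%g) (elt i) = rho R f u ((elt j)^-1 * elt i)%g.
  by rewrite !rhoE; apply: eq_bigr => h _; rewrite mulgA.
rewrite uP; congr (_%:R); congr nat_of_bool; apply/eqP/eqP => [|->]; last exact: mulVg.
by move=> /(congr1 (fun x => elt j * x)%g); rewrite mulVKg mulg1 => /elt_inj.
Qed.

Lemma sums_bounded_win_inv : sums_bounded K win_inv.
Proof.
split=> [k|i].
  under eq_bigr do rewrite mxE.
  rewrite (sum_elt _ (fun x => `|u (x^-1 * elt k)%g|)).
  rewrite -(big_map (fun x => x^-1 * elt k)%g xpredT (fun x => `|u x|)).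
  apply: (sum_uniq_le uK); rewrite map_inj_uniq ?fset_uniq// => x y.
  by move=> /mulIg/invg_inj.
under eq_bigr do rewrite mxE.
rewrite (sum_elt _ (fun x => `|u ((elt i)^-1 * x)%g|)).
rewrite -(big_map (fun x => (elt i)^-1 * x)%g xpredT (fun x => `|u x|)).
apply: (sum_uniq_le uK); rewrite map_inj_uniq ?fset_uniq//; exact: mulgI.
Qed.

Lemma form_bounded_win : 0 < K ->
  form_bounded (K ^- 2) (kappa ^+ 2) (win_mxR *m win_mxR^T).
Proof.
move=> K0; apply: form_bounded_gram win_invP => //.
- exact: norm1_ge0.
- exact: sums_bounded_win.
- exact: sums_bounded_win_inv.
Qed.

End inverse.

End window.
End moments.

(** * Boundaries of Folner windows *)

Section boundary.
Variable G : groupType.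

Definition bdry (E : seq G) (W : {fset G}) : nat :=
  count (fun g => ~~ all (fun e => (g * e)%g \in W) E) (enum_fset W).

Definition inv_fset (F : {fset G}) : {fset G} := [fset g^-1%g | g in F]%fset.

Lemma card_inv_fset F : #|` inv_fset F| = #|` F|.
Proof. by rewrite card_imfset//; exact: invg_inj. Qed.

Lemma in_inv_fset F g : (g \in inv_fset F) = (g^-1%g \in F).
Proof.
apply/imfsetP/idP => [[h hF ->]|gF]; first by rewrite invgK.
by exists g^-1%g; rewrite ?invgK.
Qed.

Lemma perm_inv_fset F : perm_eq (inv_fset F) [seq g^-1%g | g <- F].
Proof.
apply: uniq_perm; rewrite ?fset_uniq// ?map_inj_uniq ?fset_uniq//; first exact: invg_inj.
move=> g; rewrite in_inv_fset; apply/idP/mapP => [gF|[h hF ->]]; last by rewrite invgK.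
by exists g^-1%g; rewrite ?invgK.
Qed.

Lemma bdry_le_sum E W : (bdry E W <= \sum_(e <- E) count (fun g =>
  (g * e)%g \notin W) (enum_fset W))%N.
Proof.
rewrite /bdry; elim: E => [|e E IHE]; first by rewrite big_nil /= count_pred0.
rewrite big_cons; apply: leq_trans (leq_add (leqnn _) IHE).
rewrite -count_predUI; apply: leq_trans (leq_addr _ _).
by apply: sub_count => g /=; rewrite negb_and.
Qed.

Lemma finite_setY (T : Type) (A B : set T) : finite_set A -> finite_set B ->
  finite_set (A `+` B).
Proof.
move=> fA fB; apply: sub_finite_set (_ : finite_set (A `|` B)); last by rewrite finite_setU.
by rewrite setY_def => x [[]|[]]; [left|right].
Qed.

(** If g lies in F^-1 but g e does not, then g^-1 lies in F but not in e F. *)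
Lemma count_translate_le (F : {fset G}) e :
  (count (fun g => (g * e)%g \notin inv_fset F) (enum_fset (inv_fset F)) <=
   #|` fset_set ([set (e * h)%g | h in [set` F]] `+` [set` F])|)%N.
Proof.
set Y := _ `+` _; have finY : finite_set Y.
  by apply: finite_setY; [apply: finite_image|]; exact: finite_fset.
have /seq.permP -> := perm_inv_fset F; rewrite count_map -size_filter.
apply: uniq_leq_size; first by rewrite filter_uniq ?fset_uniq.
move=> g; rewrite mem_filter /= in_inv_fset invgM invgK => /andP[eg gF].
rewrite (in_fset_set finY) in_setE /Y setY_def; right; split=> //.
by move=> [h hF gE]; case/negP: eg; rewrite -gE mulKg.
Qed.

Lemma folner_bdry (R : realType) (F : nat -> {fset G}) : folner R F ->
  forall E (eta : R), 0 < eta ->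
  \forall n \near \oo, (bdry E (inv_fset (F n)))%:R <= eta * (#|` F n|)%:R.
Proof.
move=> [F0 Flim] E eta eta0.
have F_gt0 n : 0 < (#|` F n|)%:R :> R by rewrite ltr0n cardfs_gt0.
pose X e n := #|` fset_set ([set (e * h)%g | h in [set` F n]] `+` [set` F n])|.
have : \forall n \near \oo, forall e, e \in E ->
  (X e n)%:R <= eta / (size E).+1%:R * (#|` F n|)%:R.
  apply: (@filter_all_seq _ \oo _ (fun e =>
    [set n | (X e n)%:R <= eta / (size E).+1%:R * (#|` F n|)%:R])) => e _.
  have d0 : 0 < eta / (size E).+1%:R by rewrite divr_gt0.
  have /cvgrPdist_le/(_ _ d0) := Flim e; apply: filterS => n /=.
  by rewrite sub0r normrN ger0_norm ?divr_ge0// ler_pdivrMr.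
apply: filterS => n nE.
apply: (@le_trans _ _ (\sum_(e <- E) (X e n)%:R)).
  rewrite -natr_sum ler_nat; apply: leq_trans (bdry_le_sum _ _) _.
  by apply: leq_sum => e _; exact: count_translate_le.
apply: (@le_trans _ _ (\sum_(e <- E) (eta / (size E).+1%:R * (#|` F n|)%:R))).
  by rewrite big_seq [leRHS]big_seq; apply: ler_sum.
rewrite big_const_seq count_predT iter_addr_0 -[_ *+ size E]mulr_natr [X in X * _]mulrC -mulrA [leRHS]mulrC. rewrite ler_wpM2l//.
rewrite mulrAC ler_pdivrMr//. rewrite ler_wpM2l ?ler_nat ?leqnSn //. exact: ltW.
Qed.

End boundary.

Section asymptotics.
Variables (R : realType) (G : groupType) (f : group_ring G).
Local Notation kappa := (norm1 R f).

(** [L] is the supremum of the eventual lower bounds. The conclusion covers every eventual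
    approximation P, so that a P shared by two sequences can be compared with the limit of one. *)
Lemma near_limit (x : nat -> R) :
  (forall e, 0 < e -> exists P, \forall n \near \oo, `|x n - P| <= e) ->
  exists L, forall e P, (\forall n \near \oo, `|x n - P| <= e) -> `|L - P| <= e.
Proof.
move=> xP; pose A := [set q | \forall n \near \oo, q <= x n].
have lowA e P : (\forall n \near \oo, `|x n - P| <= e) -> A (P - e).
  by apply: filterS => n; rewrite ler_norml; lra.
have upA e P : (\forall n \near \oo, `|x n - P| <= e) -> ubound A (P + e).
  move=> nP q qA; have [n [/= h1 h2]] := filter_ex (filterI nP qA).
  by move: h1; rewrite ler_norml; lra.
have [P nP] := xP 1 ltr01.
have supA : has_sup A by split; [exists (P - 1); exact: lowA|exists (P + 1); exact: upA].
exists (sup A) => e P' nP'; rewrite ler_norml.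
have := sup_upper_bound supA (lowA _ _ nP').
have := ge_sup supA.1 (upA _ _ nP'); lra.
Qed.

Lemma sums_bounded_mul (a b : R) m n p (A : 'M[R]_(m, n)) (B : 'M[R]_(n, p)) :
  0 <= a -> 0 <= b -> sums_bounded a A -> sums_bounded b B -> sums_bounded (a * b) (A *m B).
Proof.
move=> a0 b0 [rA cA] [rB cB].
have le i k : `|(A *m B) i k| <= \sum_j `|A i j| * `|B j k|.
  rewrite mxE; apply: le_trans (ler_norm_sum _ _ _) _.
  by apply: ler_sum => j _; rewrite normrM.
split=> [i|k].
  apply: le_trans (ler_sum _ (fun k _ => le i k)) _; rewrite exchange_big /=.
  apply: (@le_trans _ _ (\sum_j `|A i j| * b)).
    by apply: ler_sum => j _; rewrite -big_distrr /= ler_wpM2l.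
  by rewrite -big_distrl /= ler_wpM2r.
apply: le_trans (ler_sum _ (fun i _ => le i k)) _; rewrite exchange_big /=.
apply: (@le_trans _ _ (\sum_j a * `|B j k|)).
  by apply: ler_sum => j _; rewrite -big_distrl /= ler_wpM2r.
by rewrite -big_distrr /= ler_wpM2l.
Qed.

Lemma sums_bounded_pow (a : R) n (A : 'M[R]_n) j : 0 <= a -> sums_bounded a A ->
  sums_bounded (a ^+ j) (A ^+ j).
Proof.
move=> a0 Aa; elim: j => [|j IHj]; last by rewrite !exprS; apply: sums_bounded_mul;
  rewrite ?exprn_ge0.
rewrite !expr0; split=> i; rewrite (bigD1 i)//= big1 ?addr0 => [|k ki]; rewrite mxE.
- by rewrite eqxx normr1.
- by rewrite eq_sym (negbTE ki) normr0.
- by rewrite eqxx normr1.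
- by rewrite (negbTE ki) normr0.
Qed.

Lemma range_subS j : {subset range_ f j <= range_ f j.+1}.
Proof. by move=> e ej; apply/allpairsP; exists (1%g, e); rewrite mul1g mem_head. Qed.

Lemma range_sub j k : (j <= k)%N -> {subset range_ f j <= range_ f k}.
Proof.
move=> /subnKC <-; elim: (k - j)%N => [|l IHl]; first by rewrite addn0.
by rewrite addnS => e /IHl; exact: range_subS.
Qed.

Section window_trace.
Variables (W : {fset G}) (j J : nat).
Hypothesis jJ : (j <= J)%N.
Local Notation S := (win_mxR R f W *m (win_mxR R f W)^T).
Local Notation d := (#|` W|).

Lemma win_gram_diag i : deep f W j (elt i) -> (S ^+ j) i i = moment R f j.
Proof.
move=> di; rewrite mulmx_delta (win_gram_pow _ di) -[elt i]mulg1 -iter_rho_sq_shift /moment.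
apply: iter_rho_sq_local => e ej; rewrite mul1g.
have /elt_surj[k kE] : (elt i * e)%g \in W by exact: (allP di).
rewrite -kE win_ext_elt mxE eqxx andbT; congr (_%:R); congr nat_of_bool.
apply/eqP/eqP => [ki|e1].
  by move: kE; rewrite ki => /(congr1 (fun x => (elt i)^-1 * x)%g); rewrite mulVg mulKg.
by apply: (@elt_inj _ W); rewrite kE e1 mulg1.
Qed.

Lemma bdry_sum (E : seq G) :
  (bdry E W)%:R = \sum_(i < d) (~~ all (fun e => (elt i * e)%g \in W) E)%:R :> R.
Proof.
rewrite (sum_elt W (fun g => (~~ all (fun e => (g * e)%g \in W) E)%:R)).
by rewrite /bdry -sum1_count big_mkcond natr_sum; apply: eq_bigr => g _; case: (~~ _).
Qed.

(** Deep rows give the moment exactly, and any other row errs by at most twice the common bound of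
    moment and entry. The boundary is taken for [J], so that one set serves all powers in a
    polynomial. *)
Lemma trace_win :
  `|\tr (S ^+ j) - d%:R * moment R f j| <= 2 * (kappa ^+ 2) ^+ j * (bdry (range_ f J) W)%:R.
Proof.
have -> : d%:R * moment R f j = \sum_(i < d) moment R f j by rewrite sumr_const card_ord mulr_natl.
rewrite /mxtrace -sumrB bdry_sum big_distrr /=.
apply: le_trans (ler_norm_sum _ _ _) _; apply: ler_sum => i _.
have [di|ndi] := boolP (deep f W j (elt i)).
  by rewrite win_gram_diag// subrr normr0 mulr_ge0// mulr_ge0// exprn_ge0// sqr_ge0.
have -> : ~~ all (fun e => (elt i * e)%g \in W) (range_ f J).
  by apply: contra ndi => /allP dJ; apply/allP => e /(range_sub jJ)/dJ.
rewrite mulr1 mulr_natl mulr2n; apply: le_trans (ler_normB _ _) _; apply: lerD;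
  last exact: moment_bound.
have Sk : sums_bounded (kappa ^+ 2) S.
  have Mk := sums_bounded_win R f W.
  rewrite expr2; apply: sums_bounded_mul; rewrite ?norm1_ge0//.
  by split=> k; under eq_bigr do rewrite mxE; [exact: Mk.2|exact: Mk.1].
have [+ _] := sums_bounded_pow j (sqr_ge0 kappa) Sk; move=> /(_ i).
by apply: le_trans; rewrite (bigD1 i)//= lerDl sumr_ge0.
Qed.

End window_trace.

Section limit.
Variable Gamma : nat -> set G.
Hypothesis Gamma_normal : forall n, normal_subgroup (Gamma n).
Hypothesis Gamma_triv : tends_to_trivial Gamma.
Variables (d : nat -> nat) (idx : forall n, G -> 'I_(d n)) (rp : forall n, 'I_(d n) -> G).
Hypothesis idxP : forall n, coset_numbering (Gamma n) (idx n) (@rp n).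
Variables (E0 : {fset G}) (dl : R).
Hypothesis locE : local_bound f E0 dl.
Variable u : G -> R.
Hypothesis uP : forall g, rho R f u g = (g == 1%g)%:R.
Hypothesis uK : forall A : {fset G}, \sum_(h <- A) `|u h| <= dl^-1.
Variable F : nat -> {fset G}.
Hypothesis F_folner : folner R F.

Local Notation W n := (inv_fset (F n)).
Local Notation B n := (conv_mx f (idx n) (@rp n)).
Local Notation BR n := (conv_mxR R f (idx n) (@rp n)).
Local Notation gram n := (win_mxR R f (W n) *m (win_mxR R f (W n))^T).

Lemma form_bounded_widen (a b b' : R) n (S : 'M[R]_n) : b <= b' ->
  form_bounded a b S -> form_bounded a b' S.
Proof.
move=> bb' [St Sf]; split=> // v; have /andP[-> Sb] := Sf v.
by apply: le_trans Sb _; rewrite ler_wpM2r// sumr_ge0// => i _; exact: sqr_ge0.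
Qed.

(** The summand [dl ^+ 2] ensures [dl ^+ 2 <= b], as [ln_det_approx] requires. *)
Let b := dl ^+ 2 + kappa ^+ 2.

Lemma form_bounded_gram_win n : form_bounded (dl ^+ 2) b (gram n).
Proof.
have dl0 := locE.1; apply: (@form_bounded_widen _ (kappa ^+ 2)); first by rewrite lerDr sqr_ge0.
rewrite -[dl]invrK exprVn; apply: form_bounded_win uP uK _; by rewrite invr_gt0.
Qed.

Lemma det_gram_win_gt0 n : 0 < \det (gram n).
Proof.
have dl0 := locE.1.
have [|||p pP] := @ln_det_approx R (dl ^+ 2) b 1; rewrite ?exprn_gt0// ?lerDl ?sqr_ge0//.
by have [] := pP _ _ (form_bounded_gram_win n).
Qed.

(** [P] is the approximating polynomial with powers replaced by moments. It serves both sequences: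
    traces on the quotients are eventually exact, those on windows err by the boundary. The factor 2
    comes from the determinant of B B^T. *)
Lemma ln_det_near (e : R) : 0 < e -> exists P,
  (\forall n \near \oo, `|2 * ln (`|\det (B n)|%N)%:R - P * (d n)%:R| <= e * (d n)%:R) /\
  (\forall n \near \oo, `|ln (\det (gram n)) - P * (#|` F n|)%:R| <= e * (#|` F n|)%:R).
Proof.
move=> e0; have dl0 := locE.1; have e20 : 0 < e / 2 by lra.
have [|||p pP] := @ln_det_approx R (dl ^+ 2) b (e / 2); rewrite ?exprn_gt0// ?lerDl ?sqr_ge0//.
pose P := \sum_(j < size p) p`_j * moment R f j.
exists P; split.
  have [n0 n0P] := eventually_separated Gamma_triv [fset x in 1%g :: range_ f (size p)]%fset.
  exists n0 => // n /= n0n.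
  have SB : form_bounded (dl ^+ 2) b (BR n *m (BR n)^T).
    apply: (@form_bounded_widen _ (kappa ^+ 2)); first by rewrite lerDr sqr_ge0.
    exact: (form_bounded_conv (Gamma_normal n) (idxP n) locE).
  have [_] := pP _ _ SB.
  have -> : \sum_(j < size p) p`_j * \tr ((BR n *m (BR n)^T) ^+ j) = P * (d n)%:R.
    rewrite /P big_distrl /=; apply: eq_bigr => j _.
    rewrite (trace_periodic R (Gamma_normal n) (idxP n)) ?mulrA 1?mulrAC//.
    move=> g gj Ng; apply/esym/(n0P n) => //; rewrite ?invg1 ?mul1g// !in_fset.
      exact: mem_head.
    by rewrite inE (range_sub (ltnW (ltn_ord j)) gj) orbT.
  have -> : ln (\det (BR n *m (BR n)^T)) = 2 * ln (`|\det (B n)|%N)%:R.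
    rewrite det_mulmx det_tr det_map_mx -expr2 -real_normK ?num_real//.
    rewrite natr_absz intr_norm lnXn ?mulr_natl// normr_gt0 intr_eq0.
    exact: (det_conv_mx_neq0 (Gamma_normal n) (idxP n) locE).
  move=> H; apply: le_trans H _; rewrite ler_wpM2r//; lra.
pose C := \sum_(j < size p) `|p`_j| * (2 * (kappa ^+ 2) ^+ j).
have C0 : 0 <= C by rewrite sumr_ge0// => j _; rewrite !mulr_ge0// exprn_ge0// sqr_ge0.
have eta0 : 0 < e / 2 / (C + 1) by rewrite divr_gt0//; lra.
have := folner_bdry F_folner (range_ f (size p)) eta0; apply: filterS => n nb.
have [_] := pP _ _ (form_bounded_gram_win n).
have tr_le : `|\sum_(j < size p) p`_j * \tr ((gram n) ^+ j) - P * (#|` F n|)%:R| <= e / 2 * (#|` F n|)%:R.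
  apply: (@le_trans _ _ (C * (bdry (range_ f (size p)) (W n))%:R)).
    rewrite /P /C !big_distrl /= -sumrB; apply: le_trans (ler_norm_sum _ _ _) _.
    apply: ler_sum => j _; rewrite -mulrA -mulrBr normrM -mulrA ler_wpM2l//.
    by rewrite [moment _ _ _ * _]mulrC -(card_inv_fset (F n)) trace_win// ltnW.
  apply: (@le_trans _ _ (C * (e / 2 / (C + 1) * (#|` F n|)%:R))); first by rewrite ler_wpM2l.
  rewrite mulrA ler_wpM2r// mulrCA ler_piMr ?ltW// // ltr_pdivrMr ?mul1r; lra.
rewrite -[X in e / 2 * X%:R](card_inv_fset (F n)) in tr_le;
  rewrite -[X in e * X%:R](card_inv_fset (F n)) => H.
have := ler_normD (ln (\det (gram n)) - \sum_(j < size p) p`_j * \tr ((gram n) ^+ j))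
  (\sum_(j < size p) p`_j * \tr ((gram n) ^+ j) - P * (#|` F n|)%:R).
rewrite subrKA => /le_trans; apply; lra.
Qed.

(** The windows define the limit 2 L; the numbers [P] of [ln_det_near] are close to it and carry it
    over to the quotients. *)
Lemma exists_log_det : exists L : R,
  (forall e, 0 < e -> \forall n \near \oo,
     `|ln (`|\det (B n)|%N)%:R - L * (d n)%:R| <= e * (d n)%:R) /\
  (forall e, 0 < e -> \forall n \near \oo,
     `|ln (\det (gram n)) - 2 * L * (#|` F n|)%:R| <= e * (#|` F n|)%:R).
Proof.
pose x n : R := ln (\det (gram n)) / (#|` F n|)%:R.
have F_gt0 n : 0 < (#|` F n|)%:R :> R by rewrite ltr0n cardfs_gt0 F_folner.1.
have xE n (e P : R) : (`|ln (\det (gram n)) - P * (#|` F n|)%:R| <= e * (#|` F n|)%:R) = (`|x n - P| <= e).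
  have -> : ln (\det (gram n)) - P * (#|` F n|)%:R = (x n - P) * (#|` F n|)%:R.
    by rewrite mulrBl divfK// gt_eqF.
  by rewrite normrM (gtr0_norm (F_gt0 n)) ler_pM2r.
have [|L LP] := near_limit (x := x).
  by move=> e e0; have [P [_ nP]] := ln_det_near e0; exists P; apply: filterS nP => n;
    rewrite xE.
exists (L / 2); split=> e e0; have e20 : 0 < e / 2 by lra.
  have [P [nB nW]] := ln_det_near e20.
  have PL : `|L - P| <= e / 2 by apply: LP; apply: filterS nW => n; rewrite xE.
  apply: filterS nB => n nB.
  have -> : ln (`|\det (B n)|%N)%:R - L / 2 * (d n)%:R =
    ((2 * ln (`|\det (B n)|%N)%:R - P * (d n)%:R) - (L - P) * (d n)%:R) / 2 by lra.
  rewrite normrM (ger0_norm (_ : 0 <= 2^-1)) ?invr_ge0// ler_pdivrMr//.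
  apply: le_trans (ler_normB _ _) _; rewrite normrM normr_nat.
  have := ler_wpM2r (ler0n R (d n)) PL; have : 0 <= e * (d n)%:R by rewrite mulr_ge0// ltW.
  lra.
have [P [_ nW]] := ln_det_near e20.
have PL : `|L - P| <= e / 2 by apply: LP; apply: filterS nW => n; rewrite xE.
apply: filterS nW => n; rewrite !xE (_ : 2 * (L / 2) = L) => [xP|]; last by lra.
have := ler_normB (x n - P) (L - P); rewrite opprB addrA subrK => /le_trans; apply; lra.
Qed.

End limit.

End asymptotics.

(** * Counting configurations on windows *)

Section thickness.
Variables (G : groupType) (f : group_ring G) (W : {fset G}).

(** A point of the thickening outside [W] is g h with g in the boundary and h in the support of
    f. *)
Lemma card_thick_le : (#|` thick f W| - #|` W| <= bdry (finsupp f) W * size (finsupp f))%N.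
Proof.
rewrite -cardfsDS; last exact: fsubsetUl.
pose bad := [seq g <- enum_fset W | ~~ all (fun e => (g * e)%g \in W) (finsupp f)].
apply: (@leq_trans (size [seq (g * h)%g | g <- bad, h <- finsupp f])).
  apply: uniq_leq_size; first exact: fset_uniq.
  move=> x; rewrite !inE => /andP[xW /orP[xW'|/imfset2P[g gW [h hf xE]]]];
    first by rewrite xW' in xW.
  apply/allpairsP; exists (g, h); split=> //=; rewrite mem_filter gW andbT.
  by apply/allPn; exists h => //; rewrite -xE.
by rewrite size_allpairs size_filter.
Qed.

Lemma card_thick_ge : (#|` W| <= #|` thick f W|)%N.
Proof. exact/fsubset_leq_card/fsubsetUl. Qed.

End thickness.

Lemma sum_inj_eq (V : nmodType) n m (phi : 'I_n -> 'I_m) (F : 'I_m -> V) : injective phi ->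
  (forall l, l \notin codom phi -> F l = 0) -> \sum_l F l = \sum_j F (phi j).
Proof.
move=> phi_inj F0; rewrite (bigID (fun l => l \in phi @: [set: 'I_n]))%SET /=.
rewrite big_imset /=; last by move=> ? ? _ _; exact: phi_inj.
rewrite [X in _ + X]big1 ?addr0 => [|l lphi].
  by apply: eq_bigl => j; rewrite inE.
by apply: F0; apply: contra lphi => /codomP[j ->]; rewrite imset_f// inE.
Qed.

Lemma sum_inj_le (R : realType) n m (phi : 'I_n -> 'I_m) (F : 'I_m -> R) : injective phi ->
  (forall l, 0 <= F l) -> \sum_j F (phi j) <= \sum_l F l.
Proof.
move=> phi_inj F0; pose F' l := if l \in codom phi then F l else 0.
have -> : \sum_j F (phi j) = \sum_l F' l.
  rewrite (sum_inj_eq (F := F') phi_inj) => [|l /negbTE ln]; last by rewrite /F' ln.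
  by apply: eq_bigr => j _; rewrite /F' codom_f.
by apply: ler_sum => l _; rewrite /F'; case: ifP.
Qed.

Lemma subr_cancel (V : zmodType) (x x' y a a' : V) : x - y - a = x' - y - a' -> x - x' = a - a'.
Proof.
rewrite addrAC [RHS]addrAC => /addIr xa.
by rewrite -(subrK a x) xa [LHS]addrC !addrA addNr add0r addrC.
Qed.

Section separated.
Variables (R : realType) (G : groupType) (f : group_ring G).
Local Notation kappa := (norm1 R f).
Local Notation tc := (@to_circle R).
Variables (u : G -> R) (K : R).
Hypothesis uP : forall g, rho R f u g = (g == 1%g)%:R.
Hypothesis uK : forall A : {fset G}, \sum_(h <- A) `|u h| <= K.

(** Chosen with [kappa * mesh < 1]: if a function stays below [mesh] where rho looks, an integral
    value of rho must be 0. Also [mesh <= 1/2]. *)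
Definition mesh : R := (2 * (kappa + 1))^-1.

Definition near_on (W : {fset G}) (x x' : Xf R f) := forall w w', lifts w x -> lifts w' x' ->
  forall g, g \in W -> exists k : int, `|w g - w' g - k%:~R| < mesh.

Lemma encode_int (Q : nat) : exists c : int -> 'I_(Q.*2.+1),
  forall a b : int, (`|a| <= Q)%N -> (`|b| <= Q)%N -> c a = c b -> a = b.
Proof.
exists (fun a => inord (absz (a + Q%:Z)%R)) => a b aQ bQ /(congr1 val) /=.
by rewrite !inordK; lia.
Qed.

Lemma nat_bound (x : R) : exists n : nat, x <= n%:R.
Proof.
exists (Num.bound `|x|); apply: le_trans (ler_norm _) _; apply/ltW/archi_boundP;
  exact: normr_ge0.
Qed.

(* The points are pi (w_r), where w_r = sum_i v_r(i) u(g_i^-1 .) and the v_r are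
   bounded representatives of Z^W modulo the lattice spanned by the columns
   [phi]. If w_r and w_r' are close to each other modulo 1 on W, then
   v_r - v_r' = M k + e where k is the integer part of w_r - w_r' and e vanishes
   away from the boundary of W, so the class of v_r - v_r' is determined by e and
   by the values of k off [phi]. *)
Lemma separated_count : exists q : nat, (0 < q)%N /\ forall (W : {fset G})
    (phi : 'I_#|` W| -> 'I_#|` thick f W|), injective phi ->
  \det (colsub phi (win_mx f W)) != 0 ->
  exists x : seq (Xf R f), size x = `|\det (colsub phi (win_mx f W))|%N /\
    forall (T : finType) (c : Xf R f -> T),
      (forall y y', y \in x -> y' \in x -> c y = c y' -> near_on W y y') ->
      (size x <= #|T| * q ^ (bdry (finsupp f) W + (#|` thick f W| - #|` W|)))%N.
Proof.
(* The first bound is for the integer parts k, the second for the error vector e as a sum of two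
   vectors v and of rho k. *)
have [Q QP] := nat_bound (Num.max (2 * kappa * K + 1) (kappa + kappa + kappa * (2 * kappa * K + 1))).
have [Qk Qe] : 2 * kappa * K + 1 <= Q%:R /\ kappa + kappa + kappa * (2 * kappa * K + 1) <= Q%:R.
  by move: QP; rewrite ge_max => /andP[].
pose q := Q.*2.+1; exists q; split=> // W phi phi_inj det0.
set d := #|` W|; set m := #|` thick f W|; set B := colsub phi _ in det0 *.
have [s [s_uniq sD s_ex s_inj]] := lattice_representatives det0.
have k0 : 0 <= kappa := norm1_ge0 R f.
have BRu : map_mx intr B \in @unitmx R d by rewrite unitmxE det_map_mx unitfE intr_eq0.
(* Removing the integer parts of B^-1 r leaves v_r = B y with y in [0, 1)^d, which bounds the
   entries of v_r by [kappa]. *)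
pose fl (r : 'cV[int]_d) : 'cV[int]_d := \col_j Num.floor ((invmx (map_mx intr B) *m map_mx intr r : 'cV[R]_d) j 0).
pose v r : 'cV[int]_d := r - B *m fl r.
have v_le r i : `|(v r i 0)%:~R| <= kappa :> R.
  have -> : (v r i 0)%:~R = \sum_j (B i j)%:~R * ((invmx (map_mx intr B) *m map_mx intr r : 'cV[R]_d) j 0 - (fl r j 0)%:~R).
    pose y : 'cV[R]_d := invmx (map_mx intr B) *m map_mx intr r.
    have : map_mx intr (v r) = map_mx intr B *m (y - map_mx intr (fl r)).
      by rewrite mulmxBr mulKVmx// /v map_mxB map_mxM.
    move=> /(congr1 (fun z : 'cV[R]_d => z i 0)); rewrite [LHS]mxE => ->; rewrite mxE.
    by apply: eq_bigr => j _; rewrite mxE; congr (_ * _); rewrite mxE; congr (_ + _);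
      rewrite [LHS]mxE mxE.
  apply: le_trans (ler_norm_sum _ _ _) _.
  apply: (@le_trans _ _ (\sum_j `|win_mxR R f W i (phi j)|)).
    apply: ler_sum => j _; rewrite normrM.
    have -> : (B i j)%:~R = win_mxR R f W i (phi j) by rewrite /B !mxE.
    rewrite ler_piMr// [fl r j 0]mxE.
    have := floor_itv ((invmx (map_mx intr B) *m map_mx intr r : 'cV[R]_d) j 0).
    rewrite intrD ler_norml; lra.
  have [+ _] := sums_bounded_win R f W => /(_ i); apply: le_trans.
  exact: (sum_inj_le (F := fun l => `|win_mxR R f W i l|) phi_inj).
pose w r g : R := \sum_i (v r i 0)%:~R * u ((elt i)^-1 * g)%g.
have w_le r g : `|w r g| <= kappa * K.
  apply: le_trans (ler_norm_sum _ _ _) _.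
  apply: (@le_trans _ _ (\sum_(i < d) kappa * `|u ((elt i)^-1 * g)%g|)).
    by apply: ler_sum => i _; rewrite normrM ler_wpM2r.
  rewrite -big_distrr /= ler_wpM2l// (sum_elt W (fun h => `|u (h^-1 * g)%g|)).
  rewrite -(big_map (fun h => h^-1 * g)%g xpredT (fun h => `|u h|)).
  apply: (sum_uniq_le uK); rewrite map_inj_uniq ?fset_uniq// => a b.
  by move=> /mulIg/invg_inj.
have rw r g : rho R f (w r) g = win_ext (map_mx intr (v r)) g.
  rewrite rhoE /w; under eq_bigr do rewrite big_distrl /=.
  rewrite exchange_big; apply: eq_bigr => i _ /=; rewrite [in RHS]mxE.
  under eq_bigr do rewrite -mulrA; rewrite -big_distrr /=; congr (_ * _).
  have -> : \sum_(h <- finsupp f) u ((elt i)^-1 * (g * h))%g * (f h)%:~R = (((elt i)^-1 * g)%g == 1%g)%:R.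
    by rewrite -uP rhoE; apply: eq_bigr => h _; rewrite mulgA.
  congr (_%:R); congr nat_of_bool.
  apply/eqP/eqP => [|->]; last exact: mulVg.
  by move=> /(congr1 (fun h => elt i * h)%g); rewrite mulVKg mulg1.
have w_int r g : rho R f (w r) g \is a Num.int.
  rewrite rw; apply: rpred_sum => i _; rewrite mxE; apply: rpredM; first exact: intr_int.
  exact: natr_int.
pose x r : Xf R f := point_of (w_int r).
have xl r : lifts (w r) (x r) by [].
exists (map x s); split; first by rewrite size_map.
move=> T c cnear.
(* The first representative whose point has the colour of that of [r]: points of equal colour get a
   common reference. *)
pose base r := nth 0 s (find (fun r' => c (x r') == c (x r)) s).
have baseP r : r \in s -> base r \in s /\ c (x (base r)) = c (x r).
  move=> rs; have hs : has (fun r' => c (x r') == c (x r)) s by apply/hasP; exists r.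
  by split; [rewrite mem_nth// -has_find|apply/eqP; exact: (nth_find 0 hs)].
have kE r : exists k : G -> int, r \in s -> (forall g,
  `|w r g - w (base r) g - (k g)%:~R| <= 1 / 2) /\
    forall g, g \in W -> `|w r g - w (base r) g - (k g)%:~R| < mesh.
  have [rs|_] := boolP (r \in s); last by exists (fun=> 0).
  have [bs cb] := baseP r rs.
  have near : near_on W (x r) (x (base r)) by apply: cnear; rewrite ?map_f.
  have /choice[kr krP] g : exists z : int, `|w r g - w (base r) g - z%:~R| <= 1 / 2 /\
      (g \in W -> `|w r g - w (base r) g - z%:~R| < mesh).
    have [gW|gW] := boolP (g \in W).
      have [z zP] := near _ _ (xl r) (xl (base r)) g gW.
      exists z; split=> //; apply: le_trans (ltW zP) _.
      rewrite /mesh div1r lef_pV2 ?posrE//; lra.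
    exists (Num.floor (w r g - w (base r) g + 1 / 2)); split=> //.
    have := floor_itv (w r g - w (base r) g + 1 / 2); rewrite intrD ler_norml; lra.
  by exists kr => _; split=> g; have [] := krP g.
have /choice[k kP] := kE.
pose kU r : 'cV[int]_m := \col_l k r (elt l).
pose e r : 'cV[int]_d := v r - v (base r) - win_mx f W *m kU r.
have k_leR r g : r \in s -> `|(k r g)%:~R| <= 2 * kappa * K + 1 :> R.
  move=> rs; have [/(_ g) kg _] := kP r rs.
  have := ler_normB (w r g - w (base r) g) (w r g - w (base r) g - (k r g)%:~R).
  rewrite opprB addrC subrK => /le_trans; apply.
  have := ler_normB (w r g) (w (base r) g); have := w_le r g; have := w_le (base r) g; lra.
have k_le r g : r \in s -> (`|k r g| <= Q)%N.
  by move=> rs; rewrite -(ler_nat R) natr_absz intr_norm; apply: le_trans (k_leR _ _ rs) _.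
have eE r i : (e r i 0)%:~R = (v r i 0)%:~R - (v (base r) i 0)%:~R - rho R f (fun g =>
  (k r g)%:~R) (elt i) :> R.
  rewrite -(@win_row R G f W (fun g => (k r g)%:~R) i).
  have -> : \sum_l win_mxR R f W i l * (k r (elt l))%:~R = ((win_mx f W *m kU r) i 0)%:~R.
    by rewrite [X in X%:~R]mxE rmorph_sum; apply: eq_bigr => l _; rewrite rmorphM !mxE.
  rewrite -!intrB; congr (_%:~R); rewrite /e [LHS]mxE [X in X + _]mxE.
  by congr (_ + _); [congr (_ + _); rewrite mxE|rewrite mxE].
have e_le r i : r \in s -> (`|e r i ord0| <= Q)%N.
  move=> rs; rewrite -(ler_nat R) natr_absz intr_norm; apply: le_trans Qe; rewrite eE.
  apply: le_trans (ler_normB _ _) _; apply: lerD.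
    by apply: le_trans (ler_normB _ _) _; apply: lerD.
  by apply: rho_bound => g; exact: k_leR.
have e0 r i : r \in s -> all (fun h => (elt i * h)%g \in W) (finsupp f) -> e r i 0 = 0.
  move=> rs /allP good; have [_ kW] := kP r rs.
  have eE2 : (e r i 0)%:~R = rho R f (fun g => w r g - w (base r) g - (k r g)%:~R) (elt i).
    by rewrite eE !rhoB !rw !win_ext_elt !mxE.
  have : `|(e r i 0)%:~R| < 1 :> R.
    rewrite eE2 rhoE; apply: le_lt_trans (ler_norm_sum _ _ _) _.
    apply: (@le_lt_trans _ _ (kappa * mesh)).
      rewrite /norm1 big_distrl /= big_seq [leRHS]big_seq; apply: ler_sum => h hf.
      by rewrite normrM mulrC ler_wpM2l// ltW// kW// good.
    rewrite /mesh ltr_pdivrMr//; lra.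
  rewrite -intr_norm ltrz1; lia.
have [cd cdP] := encode_int Q.
pose bad (i : 'I_d) := ~~ all (fun h => (elt i * h)%g \in W) (finsupp f).
pose off (l : 'I_m) := l \notin codom phi.
(* What has to be recorded besides the colour: [e] at the boundary rows and [k] off the chosen
   columns. *)
pose D := ({ffun {i | bad i} -> 'I_(Q.*2.+1)} * {ffun {l | off l} -> 'I_(Q.*2.+1)})%type.
pose data r : D := ([ffun i => cd (e r (val i) 0)], [ffun l => cd (kU r (val l) 0)]).
have inj r r' : r \in s -> r' \in s -> c (x r) = c (x r') -> data r = data r' -> r = r'.
  move=> rs r's cc [/ffunP ee /ffunP kk].
  have bb : base r = base r' by rewrite /base cc.
  have eer : e r = e r'.
    apply/colP => i; have [gi|bi] := boolP (all (fun h => (elt i * h)%g \in W) (finsupp f)).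
      by rewrite !e0.
    have := ee (exist _ i bi); rewrite !ffunE => /cdP; apply; exact: e_le.
  have kkU l : l \notin codom phi -> kU r l 0 = kU r' l 0.
    move=> lo; have := kk (exist _ l lo); rewrite !ffunE => /cdP; apply; rewrite mxE;
      exact: k_le.
  apply: (s_inj r r' (\col_j (kU r (phi j) 0 - kU r' (phi j) 0) + fl r - fl r')) => //.
  have rE : r = v r + B *m fl r by rewrite subrK.
  have r'E : r' = v r' + B *m fl r' by rewrite subrK.
  rewrite {1}rE {1}r'E mulmxBr mulmxDr opprD addrACA -[RHS]addrA; congr (_ + _).
  have -> : v r - v r' = win_mx f W *m (kU r - kU r').
    by rewrite mulmxBr; move: eer; rewrite /e bb; exact: subr_cancel.
  apply/colP => i; rewrite [LHS]mxE [RHS]mxE (sum_inj_eq phi_inj) => [|l lo].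
    by apply: eq_bigr => j _; rewrite !mxE.
  by rewrite [X in _ * X]mxE kkU// [X in _ + X]mxE subrr mulr0.
rewrite size_map.
have -> : (q ^ (bdry (finsupp f) W + (#|` thick f W| - #|` W|)))%N = #|{: D}|.
  rewrite card_prod !card_ffun !card_sig card_ord expnD; congr (q ^ _ * q ^ _)%N.
    rewrite /bdry -sum1_count big_mkcond -sum1_card [RHS]big_mkcond.
    rewrite -(sum_elt W (fun g => if ~~ all (fun h =>
      (g * h)%g \in W) (finsupp f) then 1 else 0)%N).
    by apply: eq_bigr => i _; rewrite inE.
  have -> : #|[pred l | off l]| = #|[predC [in codom phi]]| by apply: eq_card => l;
    rewrite !inE.
  by rewrite -[X in (X - _)%N](card_ord m) -(cardC [in codom phi]) (card_codom phi_inj) card_ord addKn.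
rewrite -card_prod -(size_map (fun r => (c (x r), data r))) cardE; apply: uniq_leq_size.
  rewrite map_inj_in_uniq// => r r' rs r's E; apply: inj => //;
    [exact: (congr1 fst E)|exact: (congr1 snd E)].
by move=> ? _; rewrite mem_enum.
Qed.

End separated.

(** * Open covers and their subcovers *)

Section fine_cover.
Variables (R : realType) (G : groupType) (f : group_ring G).
Local Notation tc := (@to_circle R).

(** Its members constrain the coordinate at 1 alone; the translates indexed by [F] then constrain
    the coordinates in F^-1. *)
Definition fine_cover (dl : R) : set (set (Xf R f)) :=
  [set [set y | exists r, tc r = \val y 1%g /\ `|r - a| < dl] | a in [set: R]].

Lemma open_fine_cover dl : 0 < dl -> open_cover (fine_cover dl).
Proof.
move=> dl0; split=> [_ [a _ <-]|].
  pose O : set (circle R) := tc @` ball a dl.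
  have oO : open O by apply: open_to_circle; exact: ball_open.
  have -> : [set y : Xf R f | exists r, tc r = \val y 1%g /\ `|r - a| < dl] =
      (fun y : Xf R f => \val y) @^-1` ((fun z : {ptws G -> circle R} => z 1%g) @^-1` O).
    apply/seteqP; split=> y /= [r]; first by move=> [ry ra]; exists r => //;
      rewrite /ball /= distrC.
    by rewrite /ball /= distrC => ra ry; exists r.
  apply: open_comp => [y _|]; first exact: initial_continuous.
  apply: open_comp => // z _; exact: (@proj_continuous _ _ 1%g).
apply/seteqP; split=> // y _.
have [r [_ ry]] := to_circle_lift 0 (\val y 1%g).
exists [set y | exists r', tc r' = \val y 1%g /\ `|r' - r| < dl]; first by exists r.
by exists r; rewrite subrr normr0.
Qed.

Lemma fine_cover_near (F : {fset G}) (C : set (Xf R f)) x x' :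
  pulled_join (alphaf R f) F (fine_cover (mesh R f / 2)) C -> C x -> C x' ->
  near_on (inv_fset F) x x'.
Proof.
move=> [c cV <-] Cx Cx' w w' wx w'x g gF; rewrite in_inv_fset in gF.
have [a _ ca] := cV _ gF.
have := Cx _ gF; have := Cx' _ gF; rewrite /= -ca /= invgK mulg1 => -[r' [r'x r'a]] [r [rx ra]].
move: rx r'x; rewrite -(wx g) -(w'x g) =>
  /esym/to_circle_eq/intrP[k kE] /esym/to_circle_eq/intrP[k' k'E].
exists (k - k'); rewrite intrB.
have -> : w g - w' g - (k%:~R - k'%:~R) = (r - a) - (r' - a) by rewrite -kE -k'E; lra.
apply: le_lt_trans (ler_normB _ _) _; lra.
Qed.

End fine_cover.

Section subcovers.
Variables (R : realType) (G : groupType) (f : group_ring G).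
Local Notation kappa := (norm1 R f).
Local Notation tc := (@to_circle R).

Lemma counting_image_le (I : eqType) (T : choiceType) (s : seq I) (F : I -> T) :
  (counting [set F i | i in [set i | i \in s]] <= (size s)%:R%:E :> \bar R)%E.
Proof.
have -> : [set F i | i in [set i | i \in s]] = [set` [fset x in map F s]%fset].
  apply/seteqP; split=> x /=; rewrite in_fset.
    by move=> [i iS <-]; exact: map_f.
  by move=> /mapP[i iS ->]; exists i.
rewrite /counting asboolT; last exact: finite_fset.
by rewrite set_fsetK card_fseq lee_fin ler_nat -(size_map F) size_undup.
Qed.

(** A longest duplicate-free list of elements of [A] exhausts [A], and the bound makes it exist. *)
Lemma exists_enumeration (T : eqType) (A : T -> Prop) (n : nat) :
  (forall s : seq T, uniq s -> (forall x, x \in s -> A x) -> (size s <= n)%N) ->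
  exists s : seq T, [/\ uniq s, forall x, x \in s <-> A x & (size s <= n)%N].
Proof.
move=> An; pose P k := `[< exists s : seq T, [/\ uniq s, forall x, x \in s ->
  A x & size s = k] >].
have P0 : exists k, P k by exists 0%N; apply/asboolP; exists [::].
have Pn k : P k -> (k <= n)%N by move=> /asboolP[s [us sA <-]]; exact: An.
case: (ex_maxnP P0 Pn) => k /asboolP[s [us sA sk]] kmax.
exists s; split=> // [x|]; last exact: An.
split=> [/sA//|Ax]; apply: contraT => xs.
have : P (size (x :: s)).
  by apply/asboolP; exists (x :: s); split=> //=; [rewrite xs|move=> y;
    rewrite inE => /predU1P[->|/sA]].
by move=> /kmax; rewrite /= sk ltnn.
Qed.

Section lower.
Variables (u : G -> R) (K : R).
Hypothesis uP : forall g, rho R f u g = (g == 1%g)%:R.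
Hypothesis uK : forall A : {fset G}, \sum_(h <- A) `|u h| <= K.

(** Each separated point is coloured by a member of [D] containing it; by [fine_cover_near] equal
    colours force closeness, so [separated_count] bounds the minor that dominates the
    determinant. *)
Lemma subcover_lower : exists q : nat, (0 < q)%N /\ forall F : {fset G}, let W := inv_fset F in
  0 < \det (win_mxR R f W *m (win_mxR R f W)^T) ->
  forall D : set (set (Xf R f)), D `<=` pulled_join (alphaf R f) F (fine_cover (mesh R f / 2)) ->
    cover D id = [set: Xf R f] -> finite_set D ->
  \det (win_mxR R f W *m (win_mxR R f W)^T) <=
    'C(#|` thick f W|, #|` W|)%:R *
    ((#|` fset_set D|)%:R * q%:R ^+ (bdry (finsupp f) W + (#|` thick f W| - #|` W|))) ^+ 2.
Proof.
have [q [q0 qP]] := separated_count uP uK; exists q; split=> // F W det0 D DV Dc Dfin.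
have [phi [phi_inj detle]] := exists_det_colsub det0.
apply: le_trans detle _; rewrite ler_wpM2l//.
have detE : \det (colsub phi (win_mxR R f W)) = (\det (colsub phi (win_mx f W)))%:~R.
  by rewrite /win_mxR -map_mxsub det_map_mx.
have [d0|d0] := eqVneq (\det (colsub phi (win_mx f W))) 0.
  by rewrite detE d0 expr0n sqr_ge0.
have [x [sx xP]] := qP W phi phi_inj d0.
have [S0 [S0D _]] : exists S0, D S0 /\ S0 (Xf0 R f).
  have : cover D id (Xf0 R f) by rewrite Dc.
  by move=> [S0 DS0 S0x]; exists S0.
pose Y := fset_set D.
have S0Y : S0 \in Y by rewrite in_fset_set// in_setE.
have /choice[c cP] y : exists S : Y, (val S) y.
  have : cover D id y by rewrite Dc.
  move=> [S DS Sy]; have SY : S \in Y by rewrite in_fset_set// in_setE.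
  by exists [` SY]%fset.
have := xP Y c _; rewrite sx => le.
rewrite detE -[leLHS]real_normK ?num_real// ler_sqr ?nnegrE ?mulr_ge0 ?exprn_ge0//.
rewrite -intr_norm -natr_absz -natrX -natrM ler_nat [X in (X * _)%N]cardfE.
apply: le => y y' _ _ cyy'; have cyD : D (val (c y)).
  have := fsvalP (c y); rewrite in_fset_set// in_setE; exact.
by apply: fine_cover_near (DV _ cyD) (cP y) _; rewrite cyy'; exact: cP.
Qed.

End lower.
Section upper.
Hypothesis G_countable : countable [set: G].
Hypothesis rho_inj : rho_injective R f.

Definition spread (E W : {fset G}) : {fset G} := [fset (g * e)%g | g in W, e in E]%fset.

Lemma card_spread_le (E W : {fset G}) : (#|` (spread E W `\` W)%fset| <= bdry E W * #|` E|)%N.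
Proof.
pose bad := [seq g <- enum_fset W | ~~ all (fun e => (g * e)%g \in W) E].
apply: (@leq_trans (size [seq (g * h)%g | g <- bad, h <- enum_fset E])).
  apply: uniq_leq_size; first exact: fset_uniq.
  move=> x; rewrite !inE => /andP[xW /imfset2P[g gW [h hf xE]]].
  apply/allpairsP; exists (g, h); split=> //=; rewrite mem_filter gW andbT.
  by apply/allPn; exists h => //; rewrite -xE.
by rewrite size_allpairs size_filter.
Qed.

(* If two lifts differ by at most 1 and have the same image under rho near h,
   then [rho_locality], applied to their difference, makes them close at h. *)
Lemma code_determines_cell (V : set (set (Xf R f))) : open_cover V -> exists E : {fset G},
  forall (F : {fset G}) (x : Xf R f) (w : G -> R), lifts w x -> (forall g, `|w g| <= 2) ->
  exists c : G -> set (Xf R f), (forall g, g \in F -> V (c g)) /\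
    forall y w', lifts w' y -> (forall g, `|w' g - w g| <= 1) ->
      (forall g, g \in spread E (inv_fset F) -> rho R f w' g = rho R f w g) ->
      forall g, g \in F -> c g (alphaf R f g y).
Proof.
move=> Vc; have [E1 [dl [dl0 leb]]] := lebesgue_number G_countable Vc.
have [E2 [dl2 [dl20 loc]]] := rho_locality G_countable rho_inj dl0.
(* Closeness is wanted on translates of [E1]; at each point it follows from equality of rho on a
   translate of [E2]. *)
exists [fset (h * e)%g | h in E1, e in E2]%fset => F x w wx w2.
have /choice[c cP] g : exists S, V S /\ forall (y : Xf R f) w', lifts w' y ->
    (forall h, h \in E1 -> `|w' h - w (g^-1 * h)%g| <= dl) -> S y.
  have [S VS SP] := leb _ _ (lifts_alphaf g wx) (fun h => w2 (g^-1 * h)%g).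
  by exists S.
exists c; split=> [g _|y w' w'y ww' rw g gF]; first by have [] := cP g.
have [_ cg] := cP g; apply: cg (lifts_alphaf g w'y) _ => h hE.
pose D k := w' (g^-1 * h * k)%g - w (g^-1 * h * k)%g.
have : `|D 1%g| <= dl.
  apply: loc => [k|k kE]; first exact: ww'.
  have -> : rho R f D k = rho R f w' (g^-1 * h * k)%g - rho R f w (g^-1 * h * k)%g.
    by rewrite !rhoE -sumrB; apply: eq_bigr => l _; rewrite mulrBl /D !mulgA.
  rewrite rw ?subrr ?normr0 ?ltW//; apply/imfset2P.
  exists g^-1%g; first by rewrite /= in_inv_fset invgK.
  exists (h * k)%g; last by rewrite mulgA.
  by apply/imfset2P; exists h => //; exists k.
by rewrite /D mulg1.
Qed.

Lemma win_full W (u : G -> R) : (forall g, rho R f u g = (g == 1%g)%:R) ->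
  forall l : 'rV[R]_(#|` W|), l *m win_mxR R f W = 0 -> l = 0.
Proof.
by move=> uP l l0; rewrite -[l]mulmx1 -(win_invP W uP) mulmxA l0 mul0mx.
Qed.

(** A point is coded by the integers rho w on [W], counted as points of a shifted zonotope, and by
    those on the rest of [spread E W], counted crudely. Points with equal codes lie in one cell of
    the join. *)
Lemma subcover_upper (u : G -> R) (V : set (set (Xf R f))) :
  (forall g, rho R f u g = (g == 1%g)%:R) -> open_cover V ->
  exists (E : {fset G}) (q : nat), (0 < q)%N /\ forall F : {fset G}, let W := inv_fset F in
    exists D : set (set (Xf R f)), [/\ D `<=` pulled_join (alphaf R f) F V,
      cover D id = [set: Xf R f] &
      (counting D <= (q%:R ^+ (bdry E W * #|` E|) *
         (2 ^+ (#|` thick f W| - #|` W|) * 'C(#|` thick f W|, #|` W|)%:R *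
         Num.sqrt (\det (win_mxR R f W *m (win_mxR R f W)^T))))%:E)%E].
Proof.
move=> uP Vc; have [E EP] := code_determines_cell Vc.
have [Q QP] := nat_bound (kappa * 2).
exists E, Q.*2.+1; split=> // F W.
set d := #|` W|; set m := #|` thick f W|; set gram := \det _.
(* Integral minors whose squares are at most [gram] are bounded by the truncated root. *)
pose N := Num.truncn (Num.sqrt gram).
have N_le : N%:R <= Num.sqrt gram by have := truncn_itv (sqrtr_ge0 gram) => /andP[].
have minors (phi : 'I_d -> 'I_m) : injective phi -> (`|\det (colsub phi (win_mx f W))| <= N)%N.
  move=> phi_inj; rewrite truncn_ge_nat ?sqrtr_ge0// natr_absz intr_norm -sqrtr_sqr.
  by rewrite ler_wsqrtr// -det_map_mx map_mxsub det_colsub_sqr_le.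
have [theta [th count]] := zonotope_count (win_full uP) minors.
(* The generic shift, extended by 0 off the thickening. With lifts in [theta, theta + 1), the vector
   w - theta lies in the cube. *)
pose th' g : R := if [pick l | elt l == g] is Some l then theta l 0 else 0.
have th'01 g : 0 <= th' g < 1.
  by rewrite /th'; case: pickP => [l _|_]; [have := th l; lra|lra].
have /choice[w wP] (x : Xf R f) := lifts_exists th' x.
have wl x : lifts (w x) x by have [] := wP x.
have wth x g : th' g <= w x g < th' g + 1 by have [] := wP x.
have w2 x g : `|w x g| <= 2 by rewrite ler_norml; have := wth x g; have := th'01 g; lra.
have /choice[v vP] x : exists v : G -> int, forall g, rho R f (w x) g = (v g)%:~R.
  have /choice[v vP] g : exists k : int, rho R f (w x) g = k%:~R.
    by apply/intrP; exact: lifts_int (wl x) g.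
  by exists v.
have v_le x g : (`|v x g| <= Q)%N.
  rewrite -(ler_nat R) natr_absz intr_norm -vP; apply: le_trans QP; exact: rho_bound.
pose p x : 'cV[int]_d := \col_i v x (elt i).
have [P [P_uniq PE Pn]] : exists P : seq 'cV[int]_d, [/\ uniq P,
    forall y, y \in P <-> (exists x, p x = y) & (size P <= 2 ^ (m - d) * 'C(m, d) * N)%N].
  apply: exists_enumeration => s s_uniq sP; apply: count => // _ /sP[x <-].
  exists (\col_l w x (elt l) - theta); split=> [l|].
    rewrite !mxE; have := wth x (elt l); rewrite /th';
      case: pickP => [l' /eqP/elt_inj ->|/(_ l)].
      lra.
    by rewrite eqxx.
  apply/colP => i; rewrite addrC subrK !mxE -vP -(@win_row R G f W (w x) i).
  by apply: eq_bigr => l _; rewrite !mxE.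
have [cd cdP] := encode_int Q.
pose X := (spread E W `\` W)%fset.
pose cod x : {ffun X -> 'I_(Q.*2.+1)} := [ffun g => cd (v x (val g))].
have codP x y : p x = p y -> cod x = cod y -> forall g, g \in spread E W -> v x g = v y g.
  move=> pxy /ffunP cxy g gE; have [/elt_surj[i <-]|gW] := boolP (g \in W).
    by have := congr1 (fun z : 'cV[int]_d => z i 0) pxy; rewrite !mxE.
  have gX : g \in X by rewrite inE gW.
  by have := cxy [` gX]%fset; rewrite !ffunE => /cdP; apply.
have /choice[c cP] x := EP F x (w x) (wl x) (w2 x).
pose cell x := \bigcap_(g in [set` F]) (alphaf R f g @^-1` c x g).
have cell_mem x y : p x = p y -> cod x = cod y -> cell x y.
  move=> pxy cxy g gF; have [_ cxP] := cP x; apply: cxP (wl y) _ _ _ gF.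
    by move=> h; rewrite ler_norml; have := wth x h; have := wth y h; lra.
  by move=> h hE; rewrite !vP (codP _ _ pxy cxy).
pose codes := [seq (y, t) | y <- P, t <- enum {: {ffun X -> 'I_(Q.*2.+1)}}].
(* A code that is not attained gets the default point [Xf0], whose cell still belongs to the
   join. *)
have rep t : exists x, (exists x', p x' = t.1 /\ cod x' = t.2) -> p x = t.1 /\ cod x = t.2.
  have [[x' x't]|nt] := pselect (exists x', p x' = t.1 /\ cod x' = t.2); first by exists x'.
  by exists (Xf0 R f) => /nt.
have /choice[r rP] := rep.
exists [set cell (r t) | t in [set t | t \in codes]]; split.
- move=> _ [t _ <-]; exists (c (r t)) => //=; exact: (cP (r t)).1.
- apply/seteqP; split=> // y _.
  have [ry cy] : p (r (p y, cod y)) = p y /\ cod (r (p y, cod y)) = cod y by apply: rP;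
    exists y.
  exists (cell (r (p y, cod y))); last exact: cell_mem.
  exists (p y, cod y) => //=; apply/allpairsP; exists (p y, cod y); split=> //=.
    by apply/PE; exists y.
  by rewrite mem_enum.
apply: (le_trans (counting_image_le codes (fun t => cell (r t))));
  rewrite lee_fin size_allpairs -cardT.
rewrite card_ffun card_ord -cardfE mulnC natrM.
apply: ler_pM => //.
  by rewrite natrX; apply: ler_weXn2l; [rewrite ler1n|exact: card_spread_le].
apply: (@le_trans _ _ (2 ^ (m - d) * 'C(m, d) * N)%:R); first by rewrite ler_nat.
by rewrite !natrM natrX ler_wpM2l.
Qed.

End upper.
End subcovers.

(** * Entropy *)

Section extended.
Variable R : realType.

Lemma le_lne (x y : \bar R) : (x <= y)%E -> (lne x <= lne y)%E.
Proof.
case: x y => [r| |] [s| |]//=; rewrite ?leey ?leNye// lee_fin => rs.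
case: (leP r 0) => r0; first by rewrite leNye.
case: (leP s 0) => s0; first by have := lt_le_trans r0 rs; rewrite ltNge s0.
by rewrite lee_fin ler_ln.
Qed.

Lemma lne_EFin (r : R) : 0 < r -> lne r%:E = (ln r)%:E.
Proof. by move=> r0; rewrite /lne leNgt r0. Qed.

Lemma cvg_EFin_squeeze (t : nat -> \bar R) (L : R) :
  (forall e, 0 < e -> \forall n \near \oo, ((L - e)%:E <= t n <= (L + e)%:E)%E) ->
  t @ \oo --> L%:E.
Proof.
move=> tL; have fin n (e : R) : ((L - e)%:E <= t n <= (L + e)%:E)%E -> t n \is a fin_num.
  by move=> /andP[h1 h2]; rewrite fin_numE; case: (t n) h1 h2.
apply/fine_cvgP; split; first by have := tL 1 ltr01; apply: filterS => n; exact: fin.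
apply/cvgrPdist_le => e e0; have := tL e e0; apply: filterS => n nL.
move: (nL); rewrite -(fineK (fin _ _ nL)) !lee_fin /= => /andP[h1 h2].
by rewrite ler_norml; lra.
Qed.

(* [limn] of a divergent sequence has the default value 0. *)
Lemma limn_le (t : nat -> \bar R) (L : R) : 0 <= L ->
  (forall e, 0 < e -> \forall n \near \oo, (t n <= (L + e)%:E)%E) -> (limn t <= L%:E)%E.
Proof.
move=> L0 tL; have [tc|tnc] := pselect (cvgn t); last by rewrite dvgP.
apply/lee_addgt0Pr => e e0; rewrite -EFinD; apply: lime_le => //; exact: tL.
Qed.

(** The hypothesis is solved for the logarithm of the cardinality; infinite subcovers count as
    +oo. *)
Lemma min_subcover_ge (X : topologicalType) (V : set (set X)) (g c q : R) (beta : nat) :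
  0 < g -> 0 < c -> 0 < q ->
  (forall D, D `<=` V -> cover D id = [set: X] -> finite_set D ->
     g <= c * ((#|` fset_set D|)%:R * q ^+ beta) ^+ 2) ->
  (((ln g - ln c) / 2 - beta%:R * ln q)%:E <= lne (min_subcover R V))%E.
Proof.
move=> g0 c0 q0 VD; set lo := _ - _.
rewrite -[lo]expRK -lne_EFin ?expR_gt0//; apply: le_lne.
apply: le_ereal_inf_tmp => _ [D [DV Dc] <-]; rewrite /counting; case: asboolP => Dfin;
  last exact: leey.
have := VD D DV Dc Dfin; set n : R := _%:R => gn; rewrite lee_fin.
have n0 : 0 < n.
  rewrite lt_def ler0n andbT; apply: contraTneq gn => ->.
  by rewrite mul0r expr0n mulr0 -ltNge.
rewrite -[leRHS]lnK// ler_expR /lo.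
have qb : 0 < q ^+ beta by rewrite exprn_gt0.
have : ln g <= ln c + 2 * (ln n + beta%:R * ln q).
  apply: le_trans (_ : ln (c * (n * q ^+ beta) ^+ 2) <= _).
    by rewrite ler_ln ?posrE// mulr_gt0// exprn_gt0// mulr_gt0.
  by rewrite lnM ?posrE ?exprn_gt0 ?mulr_gt0// lnXn ?mulr_gt0// lnM// lnXn// -[_ *+ 2]mulr_natl -[_ *+ beta]mulr_natl.
lra.
Qed.

(** One term of the binomial expansion gives C(m, d) x^(m - d) <= (1 + x)^m, which is at most exp (m
    x). *)
Lemma ln_bin_le (m d : nat) (x : R) : (d <= m)%N -> 0 < x ->
  ln ('C(m, d))%:R <= m%:R * x - (m - d)%:R * ln x.
Proof.
move=> dm x0; have C0 : 0 < ('C(m, d))%:R :> R by rewrite ltr0n bin_gt0.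
have xd : 0 < x ^+ (m - d) by rewrite exprn_gt0.
rewrite lerBrDr mulr_natl -lnXn// -lnM//.
have -> : m%:R * x = ln (expR x ^+ m) by rewrite -expRM_natl expRK.
rewrite ler_ln ?posrE ?mulr_gt0// ?exprn_gt0 ?expR_gt0//.
apply: (@le_trans _ _ ((1 + x) ^+ m)); last first.
  by rewrite lerXn2r ?nnegrE ?expR_ge0 ?expR_ge1Dx//; lra.
rewrite exprDn -bin_sub// (bigD1 (inord (m - d) : 'I_m.+1))//= inordK ?ltnS ?leq_subr//.
rewrite expr1n mul1r mulr_natl lerDl sumr_ge0// => i _.
by rewrite expr1n mul1r mulrn_wge0// exprn_ge0// ltW.
Qed.

End extended.

Section entropy_limit.
Variables (R : realType) (G : groupType) (f : group_ring G) (F : nat -> {fset G}).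
Hypothesis F_folner : folner R F.
Local Notation W n := (inv_fset (F n)).
Local Notation d n := (#|` F n|)%:R.
Local Notation m n := (#|` thick f (W n)|).
Local Notation gram n := (\det (win_mxR R f (W n) *m (win_mxR R f (W n))^T)).

Lemma card_gt0 n : 0 < (d n : R).
Proof. by rewrite ltr0n cardfs_gt0 F_folner.1. Qed.

Lemma bdry_small (E : seq G) (k e : R) : 0 <= k -> 0 < e ->
  \forall n \near \oo, (bdry E (W n))%:R * k <= e * d n.
Proof.
move=> k0 e0; have e1 : 0 < e / (k + 1) by rewrite divr_gt0//; lra.
have := folner_bdry F_folner E e1; apply: filterS => n nb.
apply: (@le_trans _ _ (e / (k + 1) * d n * k)); first by rewrite ler_wpM2r.
rewrite mulrAC ler_wpM2r// mulrAC ler_pdivrMr ?ler_wpM2l//; lra.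
Qed.

Lemma excess_small (k e : R) : 0 <= k -> 0 < e ->
  \forall n \near \oo, (m n - #|` W n|)%:R * k <= e * d n.
Proof.
move=> k0 e0.
have k0' : 0 <= (size (finsupp f))%:R * k by rewrite mulr_ge0.
have := bdry_small (finsupp f) k0' e0; apply: filterS => n; apply: le_trans.
by rewrite mulrA ler_wpM2r// -natrM ler_nat card_thick_le.
Qed.

Lemma ln_bin_small (e : R) : 0 < e ->
  \forall n \near \oo, ln ('C(m n, #|` W n|))%:R <= e * d n.
Proof.
(* The bound is |W| x + (m - |W|) (x - ln x): the first term is small by x <= e / 2, the second
   because few columns are in excess. *)
move=> e0; pose x : R := Num.min 1 (e / 2).
have x0 : 0 < x by rewrite lt_min ltr01; lra.
have x1 : x <= 1 by rewrite ge_min lexx.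
have xe : x <= e / 2 by rewrite ge_min lexx orbT.
have lx : ln x <= 0 by rewrite ln_le0.
have k0 : 0 <= 1 - ln x by lra.
have e2 : 0 < e / 2 by lra.
have := excess_small k0 e2; apply: filterS => n nb.
have Wm := card_thick_ge f (W n).
apply: le_trans (ln_bin_le Wm x0) _.
have -> : (m n)%:R = d n + (m n - #|` W n|)%:R :> R.
  by rewrite -(card_inv_fset (F n)) -natrD subnKC.
have := ler_wpM2l (ltW (card_gt0 n)) xe.
have : (m n - #|` W n|)%:R * x <= (m n - #|` W n|)%:R by rewrite ler_piMr.
move: nb; set b : R := (_ - _)%:R; lra.
Qed.

Variables (L : R).
Hypothesis gram_gt0 : forall n, 0 < gram n.
Hypothesis gramL : forall e, 0 < e -> \forall n \near \oo,
  `|ln (gram n) - 2 * L * d n| <= e * d n.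

Lemma bin_gt0R n : 0 < ('C(m n, #|` W n|))%:R :> R.
Proof. by rewrite ltr0n bin_gt0 card_thick_ge. Qed.

Lemma divide_card n (x : \bar R) (a : R) :
  (((a * d n)%:E <= x)%E -> (a%:E <= ((d n)^-1)%:E * x)%E) *
  ((x <= (a * d n)%:E)%E -> (((d n)^-1)%:E * x <= a%:E)%E).
Proof.
have dn := card_gt0 n.
have aE : a%:E = (((d n)^-1)%:E * (a * d n)%:E)%E by rewrite -EFinM mulrC mulfK// gt_eqF.
by split=> ax; rewrite [in X in is_true X]aE; apply: lee_wpmul2l => //;
  rewrite lee_fin invr_ge0 ltW.
Qed.

Lemma entropy_lower (V : set (set (Xf R f))) (q : nat) : (0 < q)%N ->
  (forall n D, D `<=` pulled_join (alphaf R f) (F n) V -> cover D id = [set: Xf R f] ->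
    finite_set D ->
    gram n <= 'C(m n, #|` W n|)%:R *
    ((#|` fset_set D|)%:R * q%:R ^+ (bdry (finsupp f) (W n) + (m n - #|` W n|))) ^+ 2) ->
  forall e, 0 < e -> \forall n \near \oo,
    ((L - e)%:E <= ((d n)^-1)%:E * lne (min_subcover R (pulled_join (alphaf R f) (F n) V)))%E.
Proof.
(* The determinant, the binomial coefficient, the boundary and the excess columns get an error of e
   / 4 each. *)
move=> q0 VD e e0; have e4 : 0 < e / 4 by lra.
have qR : 0 < q%:R :> R by rewrite ltr0n.
have lq : 0 <= ln q%:R :> R by rewrite ln_ge0// ler1n.
have g := gramL e4; have c := ln_bin_small e4.
have b1 := bdry_small (finsupp f) lq e4; have b2 := excess_small lq e4.
apply: filterS (filterI (filterI g c) (filterI b1 b2)) => n [[/= gn cn] [b1n b2n]].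
apply: (divide_card _ _ _).1; apply: le_trans (min_subcover_ge (gram_gt0 n) (bin_gt0R n) qR (VD n)).
rewrite lee_fin natrD [(_ + _) * ln q%:R]mulrDl.
have := mulr_ge0 (ltW e0) (ltW (card_gt0 n)).
move: gn cn b1n b2n; rewrite ler_norml => /andP[+ _].
move: (ln (gram n)) (ln 'C(_, _)%:R) (_ * ln q%:R) (_ * ln q%:R) (d n) => x1 x2 x3 x4 x5.
by clear -L; move: e => x6; lra.
Qed.

Lemma entropy_upper (V : set (set (Xf R f))) (q k : nat) (E : seq G) : (0 < q)%N ->
  (forall n, exists D : set (set (Xf R f)), [/\ D `<=` pulled_join (alphaf R f) (F n) V,
      cover D id = [set: Xf R f] &
      (counting D <= (q%:R ^+ (bdry E (W n) * k) *
         (2 ^+ (m n - #|` W n|) * 'C(m n, #|` W n|)%:R * Num.sqrt (gram n)))%:E)%E]) ->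
  forall e, 0 < e -> \forall n \near \oo,
    (((d n)^-1)%:E * lne (min_subcover R (pulled_join (alphaf R f) (F n) V)) <= (L + e)%:E)%E.
Proof.
move=> q0 VD e e0; have e4 : 0 < e / 4 by lra.
have qR : 0 < q%:R :> R by rewrite ltr0n.
have lq : 0 <= k%:R * ln q%:R :> R by rewrite mulr_ge0// ln_ge0// ler1n.
have l2 : 0 <= ln 2 :> R by rewrite ln_ge0// ler1n.
have g := gramL e4; have c := ln_bin_small e4.
have b1 := bdry_small E lq e4; have b2 := excess_small l2 e4.
apply: filterS (filterI (filterI g c) (filterI b1 b2)) => n [[/= gn cn] [b1n b2n]].
apply: (divide_card _ _ _).2.
have [D [DV Dc Dle]] := VD n.
apply: le_trans (le_lne (_ : _ <= counting D)%E) _; first by apply: ereal_inf_lbound; exists D.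
apply: le_trans (le_lne Dle) _.
have sg : 0 < Num.sqrt (gram n) by rewrite sqrtr_gt0.
have qb : 0 < q%:R ^+ (bdry E (W n) * k) :> R by rewrite exprn_gt0.
have tb : 0 < 2 ^+ (m n - #|` W n|) :> R by rewrite exprn_gt0.
have cb := bin_gt0R n.
rewrite lne_EFin ?mulr_gt0// lee_fin !lnM ?posrE ?mulr_gt0// !lnXn//.
have -> : ln (Num.sqrt (gram n)) = ln (gram n) / 2.
  by rewrite -[in RHS](sqr_sqrtr (ltW (gram_gt0 n))) lnXn// -[_ *+ 2]mulr_natr mulfK//.
rewrite -[ln q%:R *+ _]mulr_natl -[ln 2 *+ _]mulr_natl natrM -mulrA.
have := mulr_ge0 (ltW e0) (ltW (card_gt0 n)).
move: gn cn b1n b2n; rewrite ler_norml => /andP[_].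
move: (ln (gram n)) (ln _) (_ * (k%:R * _)) (_ * ln 2) (d n) => x1 x2 x3 x4 x5.
by clear -L; move: e => x6; lra.
Qed.

End entropy_limit.

Theorem theorem5p7 (R : realType) (G : groupType)
    (Gamma : nat -> set G) (f : group_ring G) :
  countable [set: G] -> residually_finite G -> amenable G R ->
  (forall n, normal_subgroup (Gamma n)) ->
  (forall n, finite_index (Gamma n)) ->
  tends_to_trivial Gamma ->
  expansive (alphaf R f) (Xf0 R f) ->
  forall F : nat -> {fset G}, folner R F ->
  [/\ (fun n => ((subgroup_index (Gamma n))%:R^-1)%:E *
        lne (counting (Fix R f (Gamma n))))%E @ \oo
        --> top_entropy R (alphaf R f) F,
      (fun n => ((subgroup_index (Gamma n))%:R^-1)%:E *
        lne (counting (quotient_set (LinfZ R (Gamma n))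
                        (rho R f @` LinfZ R (Gamma n)))))%E @ \oo
        --> top_entropy R (alphaf R f) F
    & (fun n => ((subgroup_index (Gamma n))%:R^-1)%:E *
        lne (`|det_on (Linf R (Gamma n)) (rho R f)|%:E))%E @ \oo
        --> top_entropy R (alphaf R f) F].
Proof.
move=> G_countable _ _ Gamma_normal Gamma_fin Gamma_triv exp F F_folner.
have rho_inj := expansive_rho_injective exp.
have [E0 [dl [dl0 loc]]] : exists E0 dl, local_bound f E0 (dl : R).
  have h0 : 0 < 1 / 2 :> R by lra.
  by have [E0 [dl [dl0 loc]]] := rho_locality G_countable rho_inj h0; exists E0, dl.
have locE : local_bound f E0 dl by split.
have [u [uP uK]] := exists_fundamental_solution Gamma_normal Gamma_fin Gamma_triv locE.
have numb n := exists_coset_numbering (Gamma_normal n) (Gamma_fin n).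
pose idx n := projT1 (cid (numb n)); pose rp n := projT1 (cid (projT2 (cid (numb n)))).
have idxP n : coset_numbering (Gamma n) (idx n) (rp n) := projT2 (cid (projT2 (cid (numb n)))).
have [L [detL gramL]] := exists_log_det Gamma_normal Gamma_triv idxP locE uP uK F_folner.
have det_neq0 n := det_conv_mx_neq0 (Gamma_normal n) (idxP n) locE.
have d0 n : 0 < (subgroup_index (Gamma n))%:R :> R.
  by rewrite ltr0n; apply: leq_ltn_trans (ltn_ord (idx n 1%g)).
pose D n := `|\det (conv_mx f (idx n) (rp n))|%N.
have D1 n : 1 <= (D n)%:R :> R by rewrite ler1n absz_gt0.
have detcvg : (fun n => ((subgroup_index (Gamma n))%:R^-1)%:E * lne ((D n)%:R)%:E)%E @ \oo --> L%:E.
  apply: cvg_EFin_squeeze => e e0; have := detL e e0; apply: filterS => n.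
  rewrite lne_EFin ?(lt_le_trans ltr01)// -EFinM !lee_fin ler_norml.
  by rewrite ler_pdivlMl// ler_pdivrMl// mulrBr mulrDr => /andP[h1 h2]; apply/andP; split; lra.
(* The determinants are nonzero integers, so their logarithms are nonnegative. [limn_le] asks for
   this sign because a divergent [limn] is 0. *)
have L0 : 0 <= L.
  apply/ler_addgt0Pl => e e0; have [n _ /(_ n (leqnn n))] := detL e e0.
  rewrite ler_norml => /andP[_]; rewrite lerBlDr -mulrDl => le.
  have := le_trans (ln_ge0 (D1 n)) le; by rewrite pmulr_lge0.
have gram_gt0 := det_gram_win_gt0 locE uP uK F.
have -> : top_entropy R (alphaf R f) F = L%:E.
  apply/le_anti/andP; split.
    apply: ge_ereal_sup => _ [V Vc <-].
    have [E [q [q0 qP]]] := subcover_upper G_countable rho_inj uP Vc.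
    apply: limn_le L0 _ => e e0.
    exact: (entropy_upper F_folner gram_gt0 gramL q0 (fun n => qP (F n)) e0).
  have [q [q0 qP]] := subcover_lower uP uK.
  have mesh0 : 0 < mesh R f / 2.
    by rewrite divr_gt0// invr_gt0 mulr_gt0// ltr_wpDl ?norm1_ge0.
  have Vc := open_fine_cover f mesh0.
  (* For this cover the upper and lower estimates meet, so its limit exists and attains the
     supremum. *)
  pose t n := (((#|` F n|)%:R^-1)%:E * lne (min_subcover R (pulled_join (alphaf R f) (F n) (fine_cover (f := f) (mesh R f / 2)))))%E.
  have tL : t @ \oo --> L%:E.
    have [E [q' [q'0 q'P]]] := subcover_upper G_countable rho_inj uP Vc.
    apply: cvg_EFin_squeeze => e e0.
    have lo := entropy_lower F_folner gram_gt0 gramL q0 (fun n => qP (F n) (gram_gt0 n)) e0.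
    have up := entropy_upper F_folner gram_gt0 gramL q'0 (fun n => q'P (F n)) e0.
    by apply: filterS (filterI lo up) => n /andP.
  have <- : limn t = L%:E by apply: cvg_lim.
  by apply: ereal_sup_ubound; exists (fine_cover (f := f) (mesh R f / 2)).
split; apply: cvg_trans detcvg; apply: near_eq_cvg; near=> n.
- by rewrite (counting_Fix R (Gamma_normal n) (idxP n)).
- by rewrite (counting_quotient R (Gamma_normal n) (idxP n)).
- by rewrite (det_on_conv R f (Gamma_normal n) (idxP n)) -intr_norm -natr_absz.
Unshelve. all: by end_near.
Qed.
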